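(* In the setting described in the context, for every $2\le p<\infty$ there is a constant $C_p>0$, depending only on $p$, such that if $P_t1=1$ $m$-a.e. for every $t>0$ (conservativeness), then for every $f\in L^p(m)$ $$\|H\|_p\le C_p\|f\|_p .$$
   Context: Setting. $E$ is a locally compact separable metric space with Borel $\sigma$-algebra $\mathcal B(E)$, and $m$ is a Radon measure on $E$ with $\operatorname{supp} m=E$. $L^p(m)$ is the real $L^p$-space with norm $\|\cdot\|_p$. Let $d=\{(x,y)\in E\times E: x=y\}$. $(\mathcal E,\mathcal D(\mathcal E))$ is a regular (symmetric) Dirichlet form on $L^2(m)$ which is pure-jump: there is a symmetric jumping measure $J$ on $E\times E\setminus d$ such that $$\mathcal E(u,v)=\tfrac12\iint_{E\times E\setminus d}(u(y)-u(x))(v(y)-v(x))\,J(dx,dy)$$ for all $u,v\in\mathcal D(\mathcal E)$ (taken in quasi-continuous versions). It is assumed that $J$ is given by a kernel: $J(dx,dy)=J(x,dy)\,m(dx)$. $X=(X_t)$ is the associated $m$-symmetric Hunt process, with laws $\mathbb P_x$, expectations $\mathbb E_x$ and cemetery $\Delta$. Its semigroup $P_tg(x)=\mathbb E_x g(X_t)$ (with $g(\Delta)=0$; also used for non-negative measurable $g$, with values in $[0,\infty]$) extends to a semigroup of sub-Markovian contractions on $L^p(m)$, $1\le p\le\infty$, strongly continuous for $1\le p<\infty$ and symmetric on $L^2(m)$. Square function. The carré du champ operator is $\Gamma[u](x)=\tfrac12\int_{E\setminus\{x\}}(u(y)-u(x))^2\,J(x,dy)$. For $f\in L^p(m)$,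 $1<p<\infty$, $$H(x)=\Big(\int_0^\infty P_t\,\Gamma[P_tf](x)\,dt\Big)^{1/2}\in[0,\infty].$$ *)

(* Defs.v *)
From HB Require Import structures.
From mathcomp Require Import all_boot all_order all_algebra.
From mathcomp Require Import all_classical all_reals all_analysis measurable_realfun.

Set Implicit Arguments.
Unset Strict Implicit.
Unset Printing Implicit Defensive.
Import Order.TTheory GRing.Theory Num.Theory.
Import numFieldNormedType.Exports.

Local Open Scope classical_set_scope.
Local Open Scope ring_scope.

HB.mixin Record isBorel (d : measure_display) (R : realType) T
    & Metric R T & Measurable d T := {
  measurable_borelE : (@measurable d T) = <<s @open T >>
}.

#[short(type="borelMetricType")]
HB.structure Definition BorelMetric (d : measure_display) (R : realType) :=
  {T of Metric R T & Measurable d T & isBorel d R T}.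

Definition separable (T : topologicalType) :=
  exists2 A : set T, countable A & dense A.

(* [radon_on D M mu]: [mu], restricted to the subspace [D], is a Radon measure;
   [M] is the sigma-algebra on which [mu] is considered. *)
Definition radon_on (R : realType) (T : topologicalType) (D : set T)
    (M : set_system T) (mu : set T -> \bar R) :=
  (forall K, compact K -> K `<=` D -> (mu K < +oo)%E) /\
  (forall A, M A -> A `<=` D ->
    mu A = ereal_sup [set mu K | K in [set K | compact K /\ K `<=` A]]).

Section state_space.
Context {d : measure_display} {R : realType} {E : borelMetricType d R}.
Implicit Types (m : {measure set E -> \bar R}) (u v : E -> R).

Definition full_support m :=
  forall U : set E, open U -> U !=set0 -> (0 < m U)%E.

Definition inner m u v : R := (\int[m]_x (u x * v x))%R.

Definition Cc : set (E -> R) :=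
  [set u | continuous u /\ compact (closure [set x | u x != 0])].

Section dirichlet_form.
Context (m : {measure set E -> \bar R}).
(* The domain is a set of functions, not of classes; it is saturated for
   m-a.e. equality by [df_ae]. *)
Context (D : set (E -> R)) (a : (E -> R) -> (E -> R) -> R).

Definition form1 u v : R := a u v + inner m u v.

Record dirichlet_form : Prop := {
  df_L2 : forall u, D u -> u \in Lfun m 2%:E ;
  df_ae : forall u v, D u -> measurable_fun [set: E] v ->
    {ae m, forall x, u x = v x} ->
    D v /\ (forall w, D w -> a u w = a v w) ;
  df_zero : D (cst 0) ;
  df_lin : forall (c : R) u v, D u -> D v -> D (fun x => c * u x + v x) ;
  df_bilin : forall (c : R) u v w, D u -> D v -> D w ->
    a (fun x => c * u x + v x) w = c * a u w + a v w ;
  df_sym : forall u v, D u -> D v -> a u v = a v u ;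
  df_ge0 : forall u, D u -> 0 <= a u u ;
  df_dense : forall f, f \in Lfun m 2%:E -> forall e : R, 0 < e ->
    exists2 u, D u & inner m (f \- u) (f \- u) < e ;
  df_closed : forall u_ : nat -> E -> R, (forall n, D (u_ n)) ->
    (forall e : R, 0 < e -> exists n0 : nat, forall i j : nat,
      (n0 <= i)%N -> (n0 <= j)%N ->
      form1 (u_ i \- u_ j) (u_ i \- u_ j) < e) ->
    exists2 u, D u & form1 (u_ n \- u) (u_ n \- u) @[n --> \oo] --> (0 : R) ;
  df_markov : forall u, D u ->
    let v := fun x => Num.min (Num.max (u x) 0) 1 in D v /\ a v v <= a u u
}.

Record regular_form : Prop := {
  regular_domain : forall u, D u -> forall e : R, 0 < e ->
    exists2 w, (D `&` Cc) w & form1 (u \- w) (u \- w) < e ;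
  regular_Cc : forall f, Cc f -> forall e : R, 0 < e ->
    exists2 w, (D `&` Cc) w & forall x, `|f x - w x| < e
}.

Definition open_capacity (G : set E) : \bar R :=
  ereal_inf [set (form1 u u)%:E | u in
    [set u | D u /\ {ae m, forall x, G x -> 1 <= u x}]].

Definition quasi_continuous u := forall e : R, 0 < e ->
  exists G : set E,
    [/\ open G, (open_capacity G < e%:E)%E & {within ~` G, continuous u}].

Definition offdiag : set (E * E) := [set z | z.1 <> z.2].

(* [J] and [N] matter only off the diagonal: [J] stands for a measure on
   [offdiag], and [N x] for a measure on [[set~ x]].
   [jump_section] and [jump_kernel] say that J(dx,dy) = N(x,dy) m(dx). *)
Record pure_jump (J : {measure set (E * E) -> \bar R}) (N : R.-ker E ~> E)
    : Prop := {
  jump_radon : radon_on offdiag measurable J ;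
  jump_sym : forall C : set (E * E), measurable C -> C `<=` offdiag ->
    J [set z | C (z.2, z.1)] = J C ;
  jump_form : forall u v, D u -> D v ->
    quasi_continuous u -> quasi_continuous v ->
    (a u v)%:E = ((2^-1)%:E * \int[J]_(z in offdiag)
      ((u z.2 - u z.1) * (v z.2 - v z.1))%:E)%E ;
  jump_section : forall C : set (E * E), measurable C -> C `<=` offdiag ->
    measurable_fun [set: E] (fun x => N x (xsection C x)) ;
  jump_kernel : forall C : set (E * E), measurable C -> C `<=` offdiag ->
    J C = (\int[m]_x N x (xsection C x))%E
}.

End dirichlet_form.

Definition carre_du_champ (N : R.-ker E ~> E) u (x : E) : \bar R :=
  ((2^-1)%:E * \int[N x]_(y in [set~ x]) ((u y - u x) ^+ 2)%:E)%E.

Section process.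
Context {dO : measure_display} {Omega : measurableType dO}.

(* The cemetery is [None]: it is isolated when [E] is compact and the point at
   infinity otherwise. Times are real numbers, of which only the nonnegative
   ones are used. *)
Local Notation Edelta := (one_point_compactification E).
Context (P : Edelta -> probability Omega R) (X : R -> Omega -> Edelta).

(* X extended to the time +oo by the cemetery. *)
Definition Xbar (t : \bar R) (w : Omega) : Edelta :=
  if t is r%:E then X r w else None.

Section filtration.
Context (F : R -> set_system Omega).

Definition stopping_time (sigma : Omega -> \bar R) :=
  (forall w, 0 <= sigma w)%E /\
  (forall t : R, 0 <= t -> F t [set w | (sigma w <= t%:E)%E]).

Definition stopped_algebra (sigma : Omega -> \bar R) : set_system Omega :=
  [set L | measurable L /\
    forall t : R, 0 <= t -> F t (L `&` [set w | (sigma w <= t%:E)%E])].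

(* The Borel sets of [Edelta] are generated by those of [E], so that only
   events [X t \in B] with [B] Borel in [E] are considered.
   [hunt_strong_markov] is P_z(X_{sigma+s} \in B | F_sigma) =
   P_{X_sigma}(X_s \in B), the conditional probability being unfolded; it
   contains the simple Markov property (constant sigma), and its form under
   each [P z] gives the one under each initial law. *)
Record hunt_axioms : Prop := {
  hunt_sigma_algebra : forall t : R, 0 <= t -> sigma_algebra [set: Omega] (F t) ;
  hunt_sub : forall t : R, 0 <= t -> F t `<=` measurable ;
  hunt_nondecreasing : forall s t : R, 0 <= s -> s <= t -> F s `<=` F t ;
  hunt_filtration_right : forall t : R, 0 <= t ->
    \bigcap_(s in [set s : R | t < s]) F s `<=` F t ;
  hunt_adapted : forall (t : R) (B : set E), 0 <= t -> measurable B ->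
    F t (X t @^-1` (Some @` B)) ;
  hunt_transition : forall (t : R) (B : set E), 0 <= t -> measurable B ->
    measurable_fun [set: E] (fun x => P (Some x) (X t @^-1` (Some @` B))) ;
  hunt_normal : forall z : Edelta, P z (X 0 @^-1` [set z]) = 1%E ;
  hunt_cemetery : forall t : R, 0 <= t -> P None (X t @^-1` [set None]) = 1%E ;
  hunt_absorbing : forall (s t : R) (w : Omega), 0 <= s -> s <= t ->
    X s w = None -> X t w = None ;
  hunt_shift : exists theta : R -> Omega -> Omega,
    forall (s t : R) (w : Omega), 0 <= s -> 0 <= t ->
    X s (theta t w) = X (s + t) w ;
  hunt_right_continuous : forall (t : R) (w : Omega), 0 <= t ->
    X s w @[s --> t^'+] --> X t w ;
  hunt_left_limit : forall (t : R) (w : Omega), 0 < t ->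
    cvg (X s w @[s --> t^'-]) ;
  hunt_strong_markov : forall (z : Edelta) (sigma : Omega -> \bar R) (s : R)
      (B : set E) (L : set Omega), stopping_time sigma -> 0 <= s ->
    measurable B -> stopped_algebra sigma L ->
    P z (L `&` [set w | (Some @` B) (Xbar (sigma w + s%:E)%E w)]) =
    (\int[P z]_(w in L) P (Xbar (sigma w) w) (X s @^-1` (Some @` B)))%E ;
  hunt_quasi_left_continuous : forall (z : Edelta)
      (sigma_ : nat -> Omega -> \bar R), (forall n, stopping_time (sigma_ n)) ->
    (forall w, {homo sigma_^~ w : i j / (i <= j)%N >-> (i <= j)%E}) ->
    let sigma w := ereal_sup (range (sigma_^~ w)) in
    {ae P z, forall w, (sigma w < +oo)%E ->
      Xbar (sigma_ n w) w @[n --> \oo] --> Xbar (sigma w) w}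
}.

End filtration.

Definition hunt_process := exists F, hunt_axioms F.

Definition Pt (t : R) (g : E -> \bar R) (x : E) : \bar R :=
  (\int[P (Some x)]_w (if X t w is Some y then g y else 0))%E.

(* Real-valued version of [Pt]; for f in L^p(m) the points x where
   E_x |f (X t)| is infinite, and the value here is junk, are m-negligible. *)
Definition PtR (t : R) u (x : E) : R := fine (Pt t (EFin \o u) x).

Definition symmetric_process m := forall (t : R) (f g : E -> \bar R), 0 < t ->
  measurable_fun [set: E] f -> measurable_fun [set: E] g ->
  (forall x, 0 <= f x)%E -> (forall x, 0 <= g x)%E ->
  (\int[m]_x (Pt t f x * g x) = \int[m]_x (f x * Pt t g x))%E.

Definition approx_form m (t : R) u v : R :=
  t^-1 * inner m (u \- PtR t u) v.

(* (D, a) is the Dirichlet form of the transition semigroup of X on L^2(m):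
   D = {u : lim_{t -> 0} t^-1 (u - P_t u, u) < oo} and
   a(u, v) = lim_{t -> 0} t^-1 (u - P_t u, v); by symmetry of [Pt] the first
   limit is monotone, hence finite if and only if it exists in [R]. *)
Definition associated_form m (D : set (E -> R))
    (a : (E -> R) -> (E -> R) -> R) :=
  (forall u, u \in Lfun m 2%:E ->
    (D u <-> cvg (approx_form m t u u @[t --> (0 : R)^'+]))) /\
  (forall u v, D u -> D v ->
    approx_form m t u v @[t --> (0 : R)^'+] --> a u v).

Definition conservative m := forall t : R, 0 < t ->
  {ae m, forall x, Pt t (cst 1%E) x = 1%E}.

Definition square_function (N : R.-ker E ~> E) u (x : E) : \bar R :=
  ((\int[lebesgue_measure]_(t in `[0%R, +oo[)
      Pt t (carre_du_champ N (PtR t u)) x) `^ 2^-1)%E.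

End process.
End state_space.

(* Main.v *)
(* A Bellman function argument. Put q = p / 2. There is a function B(x, y),
   convex in (x ^ 2, y), whose supporting affine functions have slope at least
   y / q in x ^ 2, and which is bounded, if q > 1, by a multiple of
   |x| ^ p + y ^ q', q' being conjugate to q (if q = 1, take x ^ 2 and y <= 1).
   Jensen's inequality for P_h then gives
     P_h B(u, v) >= B(P_h u, P_h v) + q^-1 P_h v (P_h (u ^ 2) - (P_h u) ^ 2),
   so that the integral of B(P_t f, P_t g) decreases in t. As h tends to 0, the
   quantity h^-1 \int P_h v (P_h (u ^ 2) - (P_h u) ^ 2) dm tends to
   2 a(u, u v) - a(v, u ^ 2) = 2 \int v Gamma[u] dm, by the jump representation
   of the form. Hence, W being the square of the square function,
     2 \int g W dm = 2 \int_0^oo \int P_t g Gamma[P_t f] dm dt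
       <= q \int B(f, g) dm,
   first for bounded square-integrable f, then for all f by Fatou's lemma.
   Choosing g as a multiple of W ^ (q - 1), truncated so that all integrals are
   finite, the part of the right-hand side that contains g is absorbed in the
   left-hand side. *)

From HB Require Import structures.
Require Import Defs.
From mathcomp Require Import all_boot all_order all_algebra.
From mathcomp Require Import all_classical all_reals all_analysis measurable_realfun.
From mathcomp Require Import ring lra.

Set Implicit Arguments.
Unset Strict Implicit.
Unset Printing Implicit Defensive.
Import Order.TTheory GRing.Theory Num.Theory.
Import numFieldNormedType.Exports.

Local Open Scope classical_set_scope.
Local Open Scope ring_scope.

(** * The Bellman function *)

(** Three obstacles shape the proof. The jump representation of the form is given for
    quasi-continuous functions, and [P_t f] is not known to be one; the representation is first
    extended to the whole domain by approximation from [Cc]. The kernel [N] may fail to be s-finite,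
    so that Gamma[P_t f] may fail to be measurable; it is replaced by zero on an m-null set where
    pieces of [N] have infinite mass, and what stays non-measurable is handled by lower integrals.
    No regularity in t of the integral of B(P_t f, P_t g) is at hand; the inequality for a step h is
    averaged over t, and only then does h tend to 0, by Fatou's lemma. The weight is g = c0 s^(q-1),
    s being a truncation of W. The constant c0 makes the g-part of q B at most c0 s^q, while 2 g W
    is at least 2 c0 s^q: half of the left-hand side remains after absorption. Conservativeness
    enters through P_h 1 = 1 and the invariance of m, which turn the integrated squared increments
    of u under P_h into the approximating form, with no killing term. *)

Section bellman_function.
Context {R : realType}.

(** Convexity is encoded by almost touching minorants, affine in (x^2, y), which is the form in
    which Jensen's inequality is applied. The signs of the coefficients serve sub-Markovian kernels:
    [al, be >= 0] keep the non-constant part nonnegative, and [- de] can only grow when mass is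
    lost. The bound [M] is there for q = 1, where B is x^2 with slope 1, which dominates y only for
    y <= 1. *)
Record bellman (M c : R) (B : R -> R -> \bar R) : Prop := {
  bellman_measurable : measurable_fun [set: R * R] (fun z => B z.1 z.2) ;
  bellman_ge0 : forall x y, 0 <= y -> (0 <= B x y)%E ;
  bellman_minorant : forall x y e : R, 0 <= y <= M -> 0 < e ->
    exists al be de : R, [/\ [/\ 0 <= al, 0 <= be & 0 <= de], c * y <= al,
      (B x y <= (al * x ^+ 2 + be * y - de + e)%:E)%E &
      forall x' y', 0 <= y' -> ((al * x' ^+ 2 + be * y' - de)%:E <= B x' y')%E]
}.

Section exponent_gt1.
Variable (q : R).
Hypothesis q1 : 1 < q.

Let q0 : 0 < q. Proof. exact: lt_trans q1. Qed.
Let r0 : 0 < q - 1. Proof. by rewrite subr_gt0. Qed.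

(** For fixed [g] this is affine in (x^2, y). At a maximizing [g > 0] the derivative in [g]
    vanishes, which forces q g^(q-1) >= y: this is the required lower bound y / q on the slope. *)
Definition bellman_affine (g x y : R) : R :=
  g `^ (q - 1) * x ^+ 2 + g * y - g `^ q.

(* Only rational [g] are used, to make the supremum measurable. *)
Definition nat_to_nneg (n : nat) : R :=
  if unpickle n is Some r then `|ratr (r : rat)| else 0.

Definition bellman_sup (x y : R) : \bar R :=
  esups (fun n => (bellman_affine (nat_to_nneg n) x y)%:E) 0.

Lemma nat_to_nneg_ge0 n : 0 <= nat_to_nneg n.
Proof. by rewrite /nat_to_nneg; case: unpickle. Qed.

Lemma bellman_affine_continuous (x y g : R) : 0 < g ->
  {for g, continuous (fun g => bellman_affine g x y)}.
Proof.
move=> g0; have c (s : R) : {for g, continuous (fun g : R => g `^ s)}.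
  apply/differentiable_continuous/derivable1_diffP/derivable_powR.
  by rewrite in_itv/= g0.
apply: cvgB; last exact: c.
apply: cvgD; apply: cvgM; [exact: c|exact: cvg_cst|exact: cvg_id|exact: cvg_cst].
Qed.

Lemma bellman_affine_le_sup (x y g : R) : 0 <= g ->
  ((bellman_affine g x y)%:E <= bellman_sup x y)%E.
Proof.
(* Continuity in [g] is available at positive points only; 0 is itself rational. *)
rewrite le_eqVlt => /predU1P[<-|g0].
  apply: ereal_sup_ubound; exists (pickle (0 : rat)) => //=.
  by rewrite /nat_to_nneg pickleK raddf0 normr0.
apply/lee_addgt0Pr => e e0.
have /cvgrPdist_lt/(_ _ e0)/nbhs_ballP[d /= d0 H] :=
  @bellman_affine_continuous x y _ g0.
have [r /itvP rg] := @rat_in_itvoo R g (g + d) ltac:(by rewrite ltrDl).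
have := H (ratr r); rewrite /ball/= => /(_ _)/= Hr.
have rgg : g < ratr r by rewrite rg.
have rgd : ratr r < g + d by rewrite rg.
apply: (@le_trans _ _ ((bellman_affine (ratr r) x y)%:E + e%:E))%E.
  rewrite -EFinD lee_fin -lerBlDl ltW// (le_lt_trans (ler_norm _))// Hr//.
  by rewrite ltr0_norm ?subr_lt0// opprB ltrBlDl.
rewrite leeD2r//; apply: ereal_sup_ubound; exists (pickle r) => //=.
by rewrite /nat_to_nneg pickleK ger0_norm// ltW// (lt_trans g0).
Qed.

Let conj : (q / (q - 1))^-1 + q^-1 = 1.
Proof. by rewrite invf_div; field; rewrite gt_eqF. Qed.

Let powRK (g : R) : (g `^ (q - 1)) `^ (q / (q - 1)) = g `^ q.
Proof. by rewrite -powRrM; congr (_ `^ _); field; rewrite gt_eqF. Qed.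

(** Young's inequality for g^(q-1) * x^2 and for g * y. The two powers of g that appear have weights
    (q-1)/q and 1/q, so that together they cancel - g^q. *)
Lemma bellman_affine_young (g x y : R) : 0 <= g -> 0 <= y ->
  bellman_affine g x y <= (x ^+ 2) `^ q / q + (q - 1) / q * y `^ (q / (q - 1)).
Proof.
move=> g0 y0; rewrite /bellman_affine.
have qq0 : 0 < q / (q - 1) by rewrite divr_gt0.
have := conjugate_powR (powR_ge0 g (q - 1)) (sqr_ge0 x) qq0 q0 conj.
have := conjugate_powR y0 g0 qq0 q0 conj.
rewrite powRK invf_div.
set a := g `^ q; set b := y `^ _; set s := _ `^ (q - 1).
have -> : (q - 1) / q = 1 - q^-1 by field; rewrite gt_eqF.
rewrite !mulrBr !mulr1 (mulrC y g); lra.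
Qed.

(* Below the threshold [(y / q) `^ (q - 1)^-1] the affine functions increase
   with [g], so that almost maximizing ones have a large slope [g `^ (q - 1)]. *)
Lemma bellman_affine_threshold (g x y : R) : 0 <= g -> 0 <= y ->
  g <= (y / q) `^ (q - 1)^-1 ->
  bellman_affine g x y <= bellman_affine ((y / q) `^ (q - 1)^-1) x y.
Proof.
move=> g0 y0; set G := (y / q) `^ _ => gG.
have yq0 : 0 <= y / q by rewrite divr_ge0 // ltW.
have Gq : G `^ (q - 1) = y / q by rewrite -powRrM mulVf ?gt_eqF// powRr1.
have G0 : 0 <= G by exact: powR_ge0.
have GG : G `^ q = G * (y / q) by rewrite -Gq mulr_powRB1.
have qq0 : 0 < q / (q - 1) by rewrite divr_gt0.
(* Young's inequality for g * G^(q-1) = g * (y / q): it says that g y - g^q is at most its value at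
   G, its maximum. *)
have := conjugate_powR g0 (powR_ge0 G (q - 1)) q0 qq0 ltac:(by rewrite addrC).
rewrite powRK invf_div.
rewrite /bellman_affine GG Gq; set a := g `^ q => H.
have : g `^ (q - 1) * x ^+ 2 <= y / q * x ^+ 2.
  by rewrite ler_wpM2r ?sqr_ge0// -Gq ge0_ler_powR ?nnegrE// ltW.
have : q * (g * (y / q)) <= q * (a / q + G * (y / q) * ((q - 1) / q)).
  by rewrite ler_wpM2l// ltW.
have -> : q * (g * (y / q)) = g * y by field; rewrite gt_eqF.
have -> : q * (a / q + G * (y / q) * ((q - 1) / q)) = a + G * y - G * (y / q).
  by field; rewrite gt_eqF.
lra.
Qed.

Lemma bellman_sup_young (x y : R) : 0 <= y ->
  (bellman_sup x y <= ((x ^+ 2) `^ q / q + (q - 1) / q * y `^ (q / (q - 1)))%:E)%E.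
Proof.
move=> y0; apply: ge_ereal_sup => _ [n _ <-]; rewrite lee_fin.
by apply: bellman_affine_young => //; exact: nat_to_nneg_ge0.
Qed.

Lemma bellman_bellman_sup M : bellman M q^-1 bellman_sup.
Proof.
split.
- apply: measurable_fun_esups => n; apply/measurable_EFinP.
  apply: measurable_funB => //; apply: measurable_funD.
    apply: measurable_funM => //; apply: measurable_funX.
    exact: measurable_fst.
  by apply: measurable_funM => //; exact: measurable_snd.
- move=> x y _; apply: le_trans (bellman_affine_le_sup x y (lexx 0)).
  by rewrite /bellman_affine !powR0 ?gt_eqF// !mul0r addr0 subr0.
- move=> x y e /andP[y0 _] e0.
  have fB : bellman_sup x y \is a fin_num.
    rewrite fin_numE; apply/andP; split.
      rewrite gt_eqF// (lt_le_trans _ (bellman_affine_le_sup x y (lexx 0)))//.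
      by rewrite ltNyr.
    by rewrite lt_eqF// (le_lt_trans (bellman_sup_young x y0))// ltry.
  have [_ [n _ <-] Hn] := ub_ereal_sup_adherent e0 fB.
  pose G := (y / q) `^ (q - 1)^-1.
  (* Raising an almost maximizing parameter to the threshold does not decrease the affine function,
     and it secures the slope. *)
  pose g := Num.max G (nat_to_nneg n).
  have g0 : 0 <= g by rewrite le_max powR_ge0.
  exists (g `^ (q - 1)), g, (g `^ q); split.
  + by rewrite !powR_ge0.
  + have -> : q^-1 * y = G `^ (q - 1).
      have yq0 : 0 <= y / q by rewrite divr_ge0// ltW.
      by rewrite /G -powRrM mulVf ?gt_eqF// powRr1// mulrC.
    rewrite ge0_ler_powR ?(ltW r0) ?nnegrE//; first exact: powR_ge0.
    by rewrite le_max lexx.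
  + rewrite EFinD -leeBlDr//; apply: (le_trans (ltW Hn)); rewrite lee_fin.
    rewrite -/(bellman_affine g x y) /g maxEle; case: ifPn => [//|].
    rewrite -ltNge => /ltW; exact: bellman_affine_threshold (nat_to_nneg_ge0 n) y0.
  + by move=> x' y' _; exact: bellman_affine_le_sup.
Qed.

End exponent_gt1.

Lemma bellman_sqr : bellman 1 1 (fun x _ => (x ^+ 2)%:E).
Proof.
split.
- by apply/measurable_EFinP/measurable_funX; exact: measurable_fst.
- by move=> x y _; rewrite lee_fin sqr_ge0.
- move=> x y e /andP[y0 y1] e0; exists 1, 0, 0; split => //.
  + by rewrite mul1r.
  + by rewrite lee_fin mul1r mul0r addr0 subr0 lerDl ltW.
  + by move=> x' y' _; rewrite lee_fin mul1r mul0r addr0 subr0.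
Qed.

(** The second variable is the test function c0 s^(q-1), for values s of W truncated at [n], or 0
    where the test function is cut off by an indicator; hence the last clause. [B] and [M] may
    depend on the truncation, but [c0] and [K] may not. *)
Definition bellman_family (q c0 K : R) := forall n : R, 0 <= n ->
  exists B M, [/\ bellman M q^-1 B,
    forall s, 0 <= s <= n -> 0 <= c0 * s `^ (q - 1) <= M,
    0 <= M,
    forall x s, 0 <= s ->
      (q%:E * B x (c0 * s `^ (q - 1)%R)%R <=
        (K * (x ^+ 2) `^ q + c0 * s `^ q)%:E)%E &
    forall x, (q%:E * B x 0%R <= (K * (x ^+ 2) `^ q)%:E)%E].

Lemma bellman_exists (q : R) : 1 <= q ->
  exists c0 K : R, [/\ 0 < c0, 0 < K & bellman_family q c0 K].
Proof.
rewrite le_eqVlt => /predU1P[<-|q1].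
  exists 1, 1; split => // n n0; exists (fun x _ => (x ^+ 2)%:E), 1.
  rewrite invr1 subrr; split; first exact: bellman_sqr.
  - by move=> s _; rewrite powRr0 mul1r ler01 lexx.
  - by [].
  - move=> x s s0; rewrite -EFinM lee_fin !mul1r !powRr1 ?sqr_ge0//.
    by rewrite lerDl.
  - by move=> x; rewrite -EFinM lee_fin !mul1r !powRr1 ?sqr_ge0.
have q0 : 0 < q := lt_trans ltr01 q1.
have r0 : 0 < q - 1 by rewrite subr_gt0.
(* The solution of (q - 1) c0^(q/(q-1)) = c0: the term in y of the upper bound becomes exactly c0
   s^q. *)
pose c0 := (q - 1)^-1 `^ (q - 1).
have c00 : 0 < c0 by rewrite powR_gt0// invr_gt0.
exists c0, 1; split => // n n0; exists (bellman_sup q), (c0 * n `^ (q - 1)).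
have bd x y : 0 <= y -> (q%:E * bellman_sup q x y <=
    ((x ^+ 2) `^ q + (q - 1) * y `^ (q / (q - 1)))%:E)%E.
  move=> y0.
  have -> : (x ^+ 2) `^ q + (q - 1) * y `^ (q / (q - 1)) =
     q * ((x ^+ 2) `^ q / q + (q - 1) / q * y `^ (q / (q - 1))).
    by field; rewrite gt_eqF.
  rewrite EFinM lee_pmul2l//.
  exact: bellman_sup_young.
split; first exact: bellman_bellman_sup.
- move=> s /andP[s0 sn]; rewrite mulr_ge0 ?powR_ge0// ler_pM2l//.
  by rewrite ge0_ler_powR ?nnegrE// ltW.
- by rewrite mulr_ge0// powR_ge0.
- move=> x s s0; apply: (le_trans (bd x _ _)); first by rewrite mulr_ge0 ?powR_ge0.
  rewrite lee_fin mul1r lerD2l powRM ?powR_ge0//.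
  have powRK (g : R) : (g `^ (q - 1)) `^ (q / (q - 1)) = g `^ q.
    by rewrite -powRrM; congr (_ `^ _); field; rewrite gt_eqF.
  rewrite !powRK mulrA ler_wpM2r ?powR_ge0//.
  have -> : (q - 1)^-1 `^ q = (q - 1)^-1 * (q - 1)^-1 `^ (q - 1).
    by rewrite mulr_powRB1// invr_ge0 ltW.
  by rewrite mulrA divff ?gt_eqF// mul1r.
- move=> x; apply: (le_trans (bd x 0 (lexx _))).
  by rewrite powR0 ?mulr0 ?addr0 ?mul1r// gt_eqF// divr_gt0.
Qed.

End bellman_function.

(** * Difference quotients of nonincreasing midpoint convex functions *)

Section midpoint_convex.
Context {R : realType}.

(** Slopes of chords from 0 increase along a convex sequence. It is applied to samples of t -> (P_t
    u, u), for which the semigroup yields midpoint convexity and monotonicity directly, but not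
    continuity. *)
Lemma convex_seq_slope (u : nat -> R) (j n : nat) :
  (forall i, 2 * u i.+1 <= u i + u i.+2) -> (0 < j <= n)%N ->
  (u j - u 0) / j%:R <= (u n - u 0) / n%:R.
Proof.
move=> cu.
have step i : i.+1%:R * (u i - u 0) <= i%:R * (u i.+1 - u 0).
  elim: i => [|i IH]; first by rewrite subrr mulr0 mul0r.
  have := cu i.
  have : 0 <= i.+1%:R :> R by [].
  move: IH; rewrite -!natr1; set x := i%:R; nra.
case/andP=> j0; elim: n => [|n IH]; first by case: j j0.
rewrite leq_eqVlt => /predU1P[->//|]; rewrite ltnS => jn.
apply: (le_trans (IH jn)).
have n0 : 0 < n%:R :> R by rewrite ltr0n (leq_trans j0).
by rewrite ler_pdivrMr// mulrAC ler_pdivlMr// mulrC [leRHS]mulrC step.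
Qed.

Variable phi : R -> R.
Hypothesis phi_nonincr : forall s t, 0 <= s -> s <= t -> phi t <= phi s.
Hypothesis phi_midconvex : forall s t, 0 <= s -> 0 <= t ->
  2 * phi ((s + t) / 2) <= phi s + phi t.

(* Midpoint convexity bounds the slopes at the commensurable points
   [c + j k / n]; monotonicity fills the gaps as [n] grows. *)
Lemma midconvex_slope c h k : 0 <= c -> 0 < h -> h <= k ->
  (phi c - phi (c + k)) / k <= (phi c - phi (c + h)) / h.
Proof.
move=> c0 h0 hk; have k0 : 0 < k by apply: lt_le_trans hk.
pose D := phi c - phi (c + k).
have D0 : 0 <= D by rewrite subr_ge0 phi_nonincr// lerDl ltW.
have H n : (0 < n)%N -> h / k * D <= phi c - phi (c + h) + D / n%:R.
  move=> n0; have nr0 : 0 < n%:R :> R by rewrite ltr0n.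
  have hk0 : 0 <= h / k * n%:R by rewrite !mulr_ge0// ?ltW// invr_gt0.
  (* The largest grid point j k / n not beyond h; rounding down costs at most D / n. *)
  pose j := Num.truncn (h / k * n%:R).
  have /andP[jl jr] : j%:R <= h / k * n%:R < j.+1%:R by exact: truncn_itv.
  have jn : (j <= n)%N.
    rewrite -(ler_nat R) (le_trans jl)// ler_piMl ?ler0n//.
    by rewrite ler_pdivrMr// mul1r.
  have cj : phi (c + h) <= phi (c + j%:R * (k / n%:R)).
    apply: phi_nonincr; first by rewrite addr_ge0// mulr_ge0// divr_ge0// ltW.
    rewrite lerD2l mulrA ler_pdivrMr// -ler_pdivlMr//.
    by rewrite mulrAC.
  have H1 : j%:R / n%:R * D <= phi c - phi (c + j%:R * (k / n%:R)).
    have [->|j0] := posnP j; first by rewrite !mul0r addr0 subrr.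
    pose u i := phi (c + i%:R * (k / n%:R)).
    have cu i : 2 * u i.+1 <= u i + u i.+2.
      have kn0 : 0 <= k / n%:R by apply: divr_ge0 => //; exact: ltW.
      have ci l : 0 <= c + l%:R * (k / n%:R) by rewrite addr_ge0// mulr_ge0.
      have := phi_midconvex (ci i) (ci i.+2).
      congr (2 * phi _ <= _); rewrite -!natr1; field; lra.
    have := @convex_seq_slope u j n cu.
    rewrite /u mul0r addr0 j0 jn (_ : n%:R * _ = k); last first.
      by field; rewrite gt_eqF.
    have jr0 : 0 < j%:R :> R by rewrite ltr0n.
    move=> /(_ isT); rewrite ler_pdivrMr//.
    have -> : (phi (c + k) - phi c) / n%:R * j%:R = - (j%:R / n%:R * D).
      by rewrite /D; ring.
    lra.
  have : (h / k - n%:R^-1) * D <= j%:R / n%:R * D.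
    by rewrite ler_wpM2r// lerBlDr -{2}[n%:R^-1]mul1r -mulrDl natr1 ler_pdivlMr// ltW.
  move: cj H1; rewrite mulrBl (mulrC n%:R^-1); lra.
have : h / k * D <= phi c - phi (c + h).
  apply/ler_addgt0Pl => e e0.
  pose n := (Num.truncn (D / e)).+1.
  apply: (le_trans (H n isT)); rewrite addrC lerD2r.
  rewrite ler_pdivrMr ?ltr0n// mulrC -ler_pdivrMr// ltW//.
  have /andP[_] : (Num.truncn (D / e))%:R <= D / e < n%:R.
    by apply: truncn_itv; rewrite divr_ge0// ltW.
  by [].
move=> HH; rewrite -/D ler_pdivlMr// (le_trans _ HH)//.
by rewrite mulrAC (mulrC D) mulrAC.
Qed.

(** The chord slopes over [0, c] and [0, c + h] are compared. Away from 0 the difference quotients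
    are thus bounded uniformly in h, even where those at 0 are not. *)
Lemma midconvex_slope_bound c h : 0 < c -> 0 < h ->
  (phi c - phi (c + h)) / h <= (phi 0 - phi c) / c.
Proof.
move=> c0 h0; have := @midconvex_slope 0 c (c + h) (lexx _) c0 ltac:(by rewrite lerDl ltW).
have ch0 : 0 < c + h by rewrite addr_gt0.
rewrite !add0r ler_pdivrMr// ler_pdivrMr//; set s := _ / c.
have -> : phi c = phi 0 - c * s by rewrite /s; field; rewrite gt_eqF.
lra.
Qed.

Lemma midconvex_slope_cvg c M : 0 <= c ->
  (forall h, 0 < h -> (phi c - phi (c + h)) / h <= M) ->
  cvg ((phi c - phi (c + h)) / h @[h --> (0 : R)^'+]).
Proof.
move=> c0 hM; apply: nonincreasing_at_right_is_cvgr.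
  near=> x => s t; rewrite !in_itv/= => /andP[s0 _] /andP[t0 _] st.
  exact: midconvex_slope.
near=> x; exists M => _ [s /= + <-]; rewrite in_itv/= => /andP[s0 _].
exact: hM.
Unshelve. all: by end_near. Qed.

End midpoint_convex.

(** * Lower and iterated integrals *)

Section lower_integral.
Local Open Scope ereal_scope.
Context d (T : measurableType d) (R : realType) (mu : {measure set T -> \bar R}).
Import HBNNSimple.

(* The smaller function need not be measurable: its integral is then a lower
   integral. *)
Lemma le_lower_integral (N : set T) (f g : T -> \bar R) :
  measurable N -> mu N = 0 -> (forall x, 0 <= f x) -> (forall x, 0 <= g x) ->
  measurable_fun setT g -> (forall x, ~ N x -> f x <= g x) ->
  \int[mu]_x f x <= \int[mu]_x g x.
Proof.
move=> mN N0 f0 g0 mg fg.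
rewrite (ge0_integralTE mu f0); apply: ge_ereal_sup => _ [h /= hf <-].
have := integral_nnsfun mu measurableT h; rewrite patch_setT => <-.
apply: ae_ge0_le_integral => //.
- by move=> x _; rewrite lee_fin.
- exact/measurable_EFinP.
exists N; split => // x /= /not_implyP[_ H]; apply: contrapT => Nx; apply: H.
exact: le_trans (hf x) (fg x Nx).
Qed.

Lemma le_lower_integralT (f g : T -> \bar R) :
  (forall x, 0 <= f x) -> (forall x, f x <= g x) ->
  \int[mu]_x f x <= \int[mu]_x g x.
Proof.
move=> f0 fg; have g0 x : 0 <= g x by exact: le_trans (fg x).
rewrite !ge0_integralTE//; apply: ereal_sup_le => _ [h /= hf <-].
by exists h => //= x; exact: le_trans (hf x) (fg x).
Qed.

End lower_integral.

Section shift.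
Context {R : realType}.
Variable h : R.

Definition shift (t : measurableTypeR R) : measurableTypeR R := (t : R) + h.

Lemma measurable_shift : measurable_fun setT shift.
Proof. exact: (@measurable_funD _ (measurableTypeR R) R setT id (cst h)). Qed.

HB.instance Definition _ := isMeasurableFun.Build _ _ _ _ _ measurable_shift.

Lemma lebesgue_measure_shift (A : set (measurableTypeR R)) : measurable A ->
  pushforward lebesgue_measure shift A = lebesgue_measure A.
Proof.
move=> mA; apply/esym/lebesgue_measure_unique => //= _ [[a b]] _ <-.
rewrite /pushforward/= (_ : _ @^-1` _ = `](a - h)%R, (b - h)%R]%classic); last first.
  by apply/seteqP; split => x /=; rewrite !in_itv/= /shift ltrBlDr lerBrDr.
rewrite [RHS]lebesgue_measure_itv [LHS]lebesgue_measure_itv/= !lte_fin ltrD2r.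
by case: ifPn => // _; rewrite -!EFinB; congr (_%:E); ring.
Qed.

Lemma ge0_integral_shift (a b : R) (f : R -> \bar R) :
  measurable_fun setT f -> (forall t, 0 <= f t)%E ->
  (\int[lebesgue_measure]_(t in `]a, b]) f (t + h)%R =
   \int[lebesgue_measure]_(t in `](a + h)%R, (b + h)%R]) f t)%E.
Proof.
move=> mf f0.
have -> : `]a, b]%classic = shift @^-1` `](a + h)%R, (b + h)%R].
  by apply/seteqP; split => x /=; rewrite /shift !in_itv/= ltrD2r lerD2r.
rewrite -[LHS](@ge0_integral_pushforward _ _ _ _ _ _ measurable_shift lebesgue_measure _ f)//;
  last exact: measurable_funS mf.
apply: eq_measure_integral => A mA _; exact: lebesgue_measure_shift.
Qed.

End shift.

Section tonelli.
Local Open Scope ereal_scope.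
Context d (T : measurableType d) (R : realType) (m : {measure set T -> \bar R}).
Hypothesis sf : sigma_finite setT m.

Let m' : set T -> \bar R := m.
HB.instance Definition _ := Measure.on m'.
HB.instance Definition _ := Measure_isSigmaFinite.Build _ _ _ m' sf.

Variables (D : set R) (f : R * T -> \bar R).
Hypotheses (mD : measurable D) (f0 : forall z, 0 <= f z).
Hypothesis mf : measurable_fun setT f.

Let g (z : R * T) := f z * (\1_D z.1)%:E.

Let mg : measurable_fun setT g.
Proof.
apply: emeasurable_funM => //; apply/measurable_EFinP.
by apply: measurableT_comp => //; exact: measurable_indic.
Qed.

Let g0 z : 0 <= g z. Proof. by rewrite mule_ge0// lee_fin. Qed.

Let integral_g x : \int[lebesgue_measure]_t g (t, x) =
  \int[lebesgue_measure]_(t in D) f (t, x).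
Proof.
rewrite [RHS]integral_mkcond; apply: eq_integral => t _.
rewrite /g/= patchE indicE; case: ifPn => _; by rewrite ?mule1 ?mule0.
Qed.

Lemma measurable_fun_integral_sigma_finite :
  measurable_fun setT (fun t => \int[m]_x f (t, x)).
Proof. exact: (@measurable_fun_fubini_tonelli_F _ _ _ _ _ m' f mf f0). Qed.

Lemma measurable_fun_integral_lebesgue :
  measurable_fun setT (fun x => \int[lebesgue_measure]_(t in D) f (t, x)).
Proof.
under eq_fun do rewrite -integral_g.
exact: (@measurable_fun_fubini_tonelli_G _ _ _ _ _ lebesgue_measure g mg g0).
Qed.

Lemma sigma_finite_tonelli :
  \int[lebesgue_measure]_(t in D) \int[m]_x f (t, x) =
  \int[m]_x \int[lebesgue_measure]_(t in D) f (t, x).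
Proof.
have := @fubini_tonelli _ _ _ _ _ lebesgue_measure m' g mg g0.
under [X in _ = X -> _]eq_integral do rewrite integral_g.
move=> <-; rewrite [LHS]integral_mkcond; apply: eq_integral => t _.
rewrite /g/= patchE indicE; case: ifPn => _.
  by apply: eq_integral => x _; rewrite mule1.
by rewrite integral0_eq// => x _; rewrite mule0.
Qed.

End tonelli.

Section mpushforward.
Context d d' (T1 : measurableType d) (T2 : measurableType d') (R : realType).
Variables (m : {measure set T1 -> \bar R}) (f : T1 -> T2).

Definition mpushforward (mf : measurable_fun setT f) : set T2 -> \bar R :=
  pushforward m f.

HB.instance Definition _ (mf : measurable_fun setT f) :=
  Measure.copy (mpushforward mf)
    (measure_function_pushforward__canonical__measure_function_Measure m mf).

End mpushforward.

Section restricted_integral.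
Local Open Scope ereal_scope.
Context d (T : measurableType d) (R : realType) (mu : {measure set T -> \bar R}).
Variables (D : set T) (mD : measurable D).
Import HBNNSimple.

Lemma ge0_integral_mrestr (f : T -> \bar R) : (forall x, 0 <= f x) ->
  measurable_fun setT f ->
  \int[mrestr mu mD]_x f x = \int[mu]_(x in D) f x.
Proof.
move=> f0 mf; have mDC := measurableC mD.
rewrite (ge0_negligible_integral mDC measurableT)//; last first.
  by rewrite /= /mrestr setICl.
rewrite setTD setCK; apply: eq_measure_integral => A mA AD.
by rewrite /= /mrestr setIidl.
Qed.

End restricted_integral.

Section mixture.
Local Open Scope ereal_scope.
Context d1 d2 (X : measurableType d1) (Y : measurableType d2) (R : realType).
Variables (m : {measure set X -> \bar R}) (K : {measure set Y -> \bar R}).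
Variable l : X -> {measure set Y -> \bar R}.
Hypothesis ml : forall C, measurable C -> measurable_fun setT (l ^~ C).
Hypothesis Kl : forall C, measurable C -> K C = \int[m]_x l x C.
Import HBNNSimple.

(** Simple functions and monotone convergence suffice, without any finiteness of [l], because the
    integrand does not depend on the mixing variable. *)
Lemma ge0_integral_mixture (f : Y -> \bar R) : (forall y, 0 <= f y) ->
  measurable_fun setT f -> \int[K]_y f y = \int[m]_x \int[l x]_y f y.
Proof.
move=> f0 mf; pose f_ := nnsfun_approx measurableT mf.
have f_f y : (EFin \o f_^~ y) n @[n --> \oo] --> f y.
  exact: cvg_nnsfun_approx.
have lim_ (nu : {measure set Y -> \bar R}) :
    \int[nu]_y f y = limn (fun n => \int[nu]_y (f_ n y)%:E).
  rewrite -monotone_convergence//.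
  - by apply: eq_integral => x _; apply/esym/cvg_lim => //; exact: f_f.
  - by move=> n; exact/measurable_EFinP.
  - by move=> n x _; rewrite lee_fin.
  - by move=> x _ i j ij; rewrite lee_fin; exact/lefP/nd_nnsfun_approx.
have sE (nu : {measure set Y -> \bar R}) n : \int[nu]_y (f_ n y)%:E =
    \sum_(r \in range (f_ n)) r%:E * nu (f_ n @^-1` [set r]).
  by rewrite integral_nnsfun// patch_setT sintegralE.
rewrite lim_.
transitivity (limn (fun n => \int[m]_x \int[l x]_y (f_ n y)%:E)).
  congr (limn _); apply/funext => n; rewrite sE.
  under [RHS]eq_integral do rewrite sE.
  rewrite ge0_integral_fsum//.
  - apply: eq_fsbigr => r; rewrite inE => -[z _ <-].
    by rewrite Kl// ge0_integralZl// ?lee_fin//; exact: ml.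
  - by move=> r; apply: measurable_funeM; exact: ml.
  - move=> r x _; have [r0|r0] := leP 0%R r; first by rewrite mule_ge0.
    by rewrite preimage_nnfun0// measure0 mule0.
rewrite -monotone_convergence//.
- by apply: eq_integral => x _; rewrite lim_.
- move=> n; under eq_fun do rewrite sE.
  by apply: emeasurable_fsum => // r; apply: measurable_funeM; exact: ml.
- by move=> n x _; apply: integral_ge0 => y _; rewrite lee_fin.
- move=> x _ i j ij; apply: ge0_le_integral => //.
  + by move=> y _; rewrite lee_fin.
  + exact/measurable_EFinP.
  + exact/measurable_EFinP.
  + by move=> y _; rewrite lee_fin; exact/lefP/nd_nnsfun_approx.
Qed.

End mixture.

Section disintegration.
Local Open Scope ereal_scope.
Context d1 d2 (X : measurableType d1) (Y : measurableType d2) (R : realType).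
Variables (m : {measure set X -> \bar R}) (K : {measure set (X * Y) -> \bar R}).
Variable l : X -> {measure set Y -> \bar R}.
Hypothesis ml : forall C, measurable C ->
  measurable_fun setT (fun x => l x (xsection C x)).
Hypothesis Kl : forall C, measurable C -> K C = \int[m]_x l x (xsection C x).

Import HBNNSimple.

Variable f : X * Y -> \bar R.
Hypotheses (f0 : forall z, 0 <= f z) (mf : measurable_fun setT f).

(** Pushing [l x] forward to the slice above x makes the integrand independent of the mixing
    variable, so that [ge0_integral_mixture] applies to kernels that need not be s-finite. *)
Lemma ge0_integral_disintegration :
  \int[K]_z f z = \int[m]_x \int[l x]_y f (x, y).
Proof.
have mpair x : measurable_fun setT (pair x : Y -> X * Y) by [].
pose l' x : {measure set (X * Y) -> \bar R} := mpushforward (l x) (mpair x).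
have l'E x C : l' x C = l x (xsection C x).
  by congr (l x _); apply/seteqP; split => y; rewrite /xsection/= inE.
rewrite (@ge0_integral_mixture _ _ _ _ _ m K l')//.
- apply: eq_integral => x _; rewrite [LHS]ge0_integral_pushforward//.
- by move=> C mC; under eq_fun do rewrite l'E; exact: ml.
- by move=> C mC; under eq_integral do rewrite l'E; exact: Kl.
Qed.

End disintegration.

(** * Markov semigroups and their forms *)

Section markov_semigroup.
Local Open Scope ereal_scope.
Context d (E : measurableType d) (R : realType) (m : {measure set E -> \bar R}).

(** The mass is at most 1 at every point but equal to 1 only almost everywhere: pointwise estimates
    rest on the former, integrated identities on the latter. *)
Record markov_semigroup (p : R -> E -> {measure set E -> \bar R}) : Prop := {
  ms_le1 : forall t x, p t x setT <= 1 ;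
  ms_measurable : forall B, measurable B ->
    measurable_fun [set: R * E] (fun z => p z.1 z.2 B) ;
  ms_add : forall (s t : R) x B, (0 <= s)%R -> (0 <= t)%R -> measurable B ->
    p (t + s)%R x B = \int[p t x]_y p s y B ;
  ms_0 : forall x B, measurable B -> p 0%R x B = \d_x B ;
  ms_sym : forall (t : R) (f g : E -> \bar R), (0 < t)%R ->
    measurable_fun setT f -> measurable_fun setT g ->
    (forall x, 0 <= f x) -> (forall x, 0 <= g x) ->
    \int[m]_x (\int[p t x]_y f y * g x) = \int[m]_x (f x * \int[p t x]_y g y) ;
  ms_conservative : forall t : R, (0 < t)%R ->
    {ae m, forall x, p t x setT = 1} }.

Variable p : R -> E -> {measure set E -> \bar R}.
Hypothesis H : markov_semigroup p.

Definition Pe (t : R) (f : E -> \bar R) (x : E) : \bar R := \int[p t x]_y f y.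
Definition Pr (t : R) (u : E -> R) (x : E) : R := fine (Pe t (EFin \o u) x).

Lemma Pe_ge0 t f x : (forall y, 0 <= f y) -> 0 <= Pe t f x.
Proof. by move=> f0; apply: integral_ge0. Qed.

(** The time of the semigroup and the function it acts on may both vary with t: [tau] constant
    serves P_h (P_t f), and [tau] the identity serves P_t Gamma[P_t f]. *)
Lemma measurable_Pe_joint (tau : R -> R) (f : R * E -> \bar R) :
  measurable_fun setT tau -> (forall z, 0 <= f z) -> measurable_fun setT f ->
  measurable_fun setT (fun z : R * E => Pe (tau z.1) (fun y => f (z.1, y)) z.2).
Proof.
move=> mtau f0 mf.
pose k (z : R * E) := p (tau z.1) z.2.
have mk B : measurable B -> measurable_fun setT (k ^~ B).
  move=> mB; have mg : measurable_fun setT (fun z : R * E => (tau z.1, z.2)).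
    apply: measurable_fun_pair; last exact: measurable_snd.
    by apply: measurableT_comp => //; exact: measurable_fst.
  exact: (measurableT_comp (ms_measurable H mB) mg).
pose K1 := isKernel.Build _ _ _ _ _ k mk.
pose k1 : R.-ker _ ~> _ := HB.pack k K1.
have k1le : ereal_sup [set k1 z setT | z in setT] <= 1.
  by apply: ge_ereal_sup => _ [z _ <-]; exact: ms_le1.
pose k2 : R.-spker _ ~> _ :=
  HB.pack k K1 (Kernel_isSubProbability.Build _ _ _ _ _ k1 k1le).
have := @measurable_fun_integral_finite_kernel _ _ (R * E)%type E R
  (fun w => f (w.1.1, w.2)) k2 (fun w => f0 _).
apply; apply: measurableT_comp => //.
apply: measurable_fun_pair => //.
by apply: measurableT_comp => //; exact: measurable_fst.
Qed.

Lemma measurable_Pr_joint (tau : R -> R) (u : R * E -> R) :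
  measurable_fun setT tau -> measurable_fun setT u ->
  measurable_fun setT (fun z : R * E => Pr (tau z.1) (fun y => u (z.1, y)) z.2).
Proof.
move=> mtau mu; have mu' : measurable_fun setT (EFin \o u) by exact/measurable_EFinP.
apply: (@measurableT_comp _ _ _ _ _ _ fine setT
  (fun z : R * E => Pe (tau z.1) (fun y => (u (z.1, y))%:E) z.2)).
  exact: fine_measurable.
rewrite /Pe; under eq_fun do rewrite integralE.
apply: emeasurable_funB.
- have := measurable_Pe_joint mtau (fun z => funepos_ge0 _ z) (measurable_funepos mu').
  rewrite /Pe; under eq_fun do under eq_integral do rewrite funeposE.
  by under [X in _ -> measurable_fun _ X]eq_fun do
    under eq_integral do rewrite funeposE.
- have := measurable_Pe_joint mtau (fun z => funeneg_ge0 _ z) (measurable_funeneg mu').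
  rewrite /Pe; under eq_fun do under eq_integral do rewrite funenegE.
  by under [X in _ -> measurable_fun _ X]eq_fun do
    under eq_integral do rewrite funenegE.
Qed.

Lemma measurable_Pe_time (f : E -> \bar R) : (forall x, 0 <= f x) ->
  measurable_fun setT f ->
  measurable_fun setT (fun z : R * E => Pe z.1 f z.2).
Proof.
move=> f0 mf; apply: (measurable_Pe_joint (tau := id) (f := fun z => f z.2)) => //.
by apply: measurableT_comp => //; exact: measurable_snd.
Qed.

Lemma measurable_Pe t (f : E -> \bar R) : (forall x, 0 <= f x) ->
  measurable_fun setT f -> measurable_fun setT (Pe t f).
Proof.
by move=> f0 mf; exact: (measurable_fun_pair2 t (measurable_Pe_time f0 mf)).
Qed.

Lemma Pe_add s t f x : (0 <= s)%R -> (0 <= t)%R -> (forall x, 0 <= f x) ->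
  measurable_fun setT f -> Pe (t + s) f x = Pe t (Pe s f) x.
Proof.
move=> s0 t0 f0 mf; apply: ge0_integral_mixture => //.
- by move=> C mC; exact: (measurable_fun_pair2 s (ms_measurable H mC)).
- by move=> C mC; exact: ms_add.
Qed.

Lemma le_Pe t f g x : (forall y, 0 <= f y) -> measurable_fun setT f ->
  measurable_fun setT g -> (forall y, f y <= g y) -> Pe t f x <= Pe t g x.
Proof. by move=> f0 mf mg fg; apply: ge0_le_integral. Qed.

Lemma measurable_Pe_signed (f : E -> \bar R) : measurable_fun setT f ->
  measurable_fun setT (fun z : R * E => Pe z.1 f z.2).
Proof.
move=> mf; rewrite /Pe; under eq_fun do rewrite integralE.
by apply: emeasurable_funB; apply: measurable_Pe_time => //;
  [exact: measurable_funepos|exact: measurable_funeneg].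
Qed.

Lemma measurable_Pr_time (u : E -> R) : measurable_fun setT u ->
  measurable_fun setT (fun z : R * E => Pr z.1 u z.2).
Proof.
move=> /measurable_EFinP/measurable_Pe_signed.
exact: (measurableT_comp (fine_measurable measurableT)).
Qed.

Lemma measurable_Pr t (u : E -> R) : measurable_fun setT u ->
  measurable_fun setT (Pr t u).
Proof.
by move=> mu; exact: (measurable_fun_pair2 t (measurable_Pr_time mu)).
Qed.

Lemma ms_fin_num t x B : measurable B -> p t x B \is a fin_num.
Proof.
move=> mB; rewrite ge0_fin_numE// (@le_lt_trans _ _ 1)// ?ltry//.
by apply: le_trans (ms_le1 H t x); rewrite le_measure ?inE.
Qed.

Definition bmf (u : E -> R) :=
  measurable_fun setT u /\ exists M : R, forall x, (`|u x| <= M)%R.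

Lemma bmf_integrable t x u : bmf u -> (p t x).-integrable setT (EFin \o u).
Proof.
move=> [mu [M uM]]; apply/integrableP; split; first exact/measurable_EFinP.
apply: (@le_lt_trans _ _ (\int[p t x]_y (cst `|M|%:E y))).
  apply: ge0_le_integral => //.
    exact/measurable_EFinP/measurableT_comp.
  by move=> y _; rewrite lee_fin (le_trans (uM y))// ler_norm.
by rewrite integral_cst// lte_mul_pinfty// ?lee_fin// -ge0_fin_numE ?ms_fin_num.
Qed.

Lemma EFin_Pr t x u : bmf u -> (Pr t u x)%:E = Pe t (EFin \o u) x.
Proof. by move=> bu; rewrite fineK// integrable_fin_num// bmf_integrable. Qed.

Lemma bmf_cst c : bmf (cst c).
Proof. by split => //; exists `|c|%R. Qed.

Lemma bmfD u v : bmf u -> bmf v -> bmf (fun x => u x + v x)%R.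
Proof.
move=> [mu [M uM]] [mv [N vN]]; split; first exact: measurable_funD.
by exists (M + N)%R => x; rewrite (le_trans (ler_normD _ _))// lerD.
Qed.

Lemma bmfM u v : bmf u -> bmf v -> bmf (fun x => u x * v x)%R.
Proof.
move=> [mu [M uM]] [mv [N vN]]; split; first exact: measurable_funM.
by exists (M * N)%R => x; rewrite normrM ler_pM.
Qed.

Lemma bmfZ c u : bmf u -> bmf (fun x => c * u x)%R.
Proof. exact/bmfM/bmf_cst. Qed.

Lemma bmfN u : bmf u -> bmf (fun x => - u x)%R.
Proof. by move=> /(bmfZ (-1)%R); under eq_fun do rewrite mulN1r. Qed.

Lemma bmfB u v : bmf u -> bmf v -> bmf (fun x => u x - v x)%R.
Proof. by move=> bu /bmfN; exact: bmfD. Qed.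

Lemma bmfX u : bmf u -> bmf (fun x => u x ^+ 2)%R.
Proof. by move=> bu; exact: bmfM. Qed.

Lemma PrD t x u v : bmf u -> bmf v ->
  Pr t (fun x => u x + v x)%R x = (Pr t u x + Pr t v x)%R.
Proof.
move=> bu bv; apply: EFin_inj; rewrite EFinD !EFin_Pr//; last exact: bmfD.
by rewrite -integralD_EFin//; exact: bmf_integrable.
Qed.

Lemma PrZ t x c u : bmf u -> Pr t (fun x => c * u x)%R x = (c * Pr t u x)%R.
Proof.
move=> bu; apply: EFin_inj; rewrite EFinM !EFin_Pr//; last exact: bmfZ.
by rewrite -integralZl//; exact: bmf_integrable.
Qed.

Lemma PrN t x u : bmf u -> Pr t (fun x => - u x)%R x = (- Pr t u x)%R.
Proof.
by move=> bu; rewrite -mulN1r -PrZ//; congr Pr; apply/funext => y; rewrite mulN1r.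
Qed.

Lemma PrB t x u v : bmf u -> bmf v ->
  Pr t (fun x => u x - v x)%R x = (Pr t u x - Pr t v x)%R.
Proof. by move=> bu bv; rewrite PrD ?PrN//; exact: bmfN. Qed.

Lemma le_Pr t x u v : bmf u -> bmf v -> (forall y, u y <= v y)%R ->
  (Pr t u x <= Pr t v x)%R.
Proof.
move=> bu bv uv; rewrite -lee_fin !EFin_Pr//; apply: le_integral => //.
- exact: bmf_integrable.
- exact: bmf_integrable.
- by move=> y _; rewrite lee_fin.
Qed.

Lemma Pr_cst t x c : Pr t (cst c) x = (c * fine (p t x setT))%R.
Proof.
apply: EFin_inj; rewrite EFin_Pr; last exact: bmf_cst.
rewrite /Pe (_ : EFin \o cst c = cst c%:E)// integral_cst// EFinM fineK//.
exact: ms_fin_num.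
Qed.

Lemma ms_fine_le1 t x : (0 <= fine (p t x setT) <= 1)%R.
Proof. by rewrite -!lee_fin fineK ?ms_fin_num// measure_ge0 ms_le1. Qed.

Lemma Pr_ge0 t x (u : E -> R) : (forall y, 0 <= u y)%R -> (0 <= Pr t u x)%R.
Proof. by move=> u0; rewrite fine_ge0//; apply: integral_ge0 => y _; rewrite lee_fin. Qed.

Lemma Pr_bound t x (u : E -> R) (M : R) : measurable_fun setT u -> (forall y, `|u y| <= M)%R ->
  (`|Pr t u x| <= M)%R.
Proof.
move=> mu uM; have bu : bmf u by split => //; exists M.
have M0 : (0 <= M)%R by exact: le_trans (uM x).
have /andP[q0 q1] := ms_fine_le1 t x.
rewrite ler_norml; apply/andP; split.
  apply: (@le_trans _ _ (- M * fine (p t x setT))%R).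
    by rewrite mulNr lerN2 ler_piMr.
  rewrite -Pr_cst; apply: le_Pr => //; first exact: bmf_cst.
  by move=> y /=; have := uM y; rewrite ler_norml => /andP[].
apply: (@le_trans _ _ (M * fine (p t x setT))%R); last by rewrite ler_piMr.
rewrite -Pr_cst; apply: le_Pr => //; first exact: bmf_cst.
by move=> y /=; have := uM y; rewrite ler_norml => /andP[].
Qed.

Lemma bmf_Pr t u : bmf u -> bmf (Pr t u).
Proof.
move=> [mu [M uM]]; split; first exact: measurable_Pr.
by exists M => x; exact: Pr_bound.
Qed.

Lemma Pr_add s t x u : (0 <= s)%R -> (0 <= t)%R -> bmf u ->
  Pr (t + s) u x = Pr t (Pr s u) x.
Proof.
move=> s0 t0 bu; have [mu [M uM]] := bu.
(* [Pe_add] is about nonnegative functions; [u + M] and the constant [M] are such, and their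
   difference is [u]. *)
pose w y : R := (u y + M)%R.
have bw : bmf w by apply: bmfD => //; exact: bmf_cst.
have w0 y : (0 <= w y)%R.
  by rewrite /w -lerBlDr sub0r; have := uM y; rewrite ler_norml => /andP[].
have M0 : (0 <= M)%R by exact: le_trans (uM x).
have add v : bmf v -> (forall y, 0 <= v y)%R -> Pr (t + s) v x = Pr t (Pr s v) x.
  move=> bv v0; apply: EFin_inj; rewrite !EFin_Pr//; last exact: bmf_Pr.
  rewrite Pe_add//; last by case: bv => mv _; exact/measurable_EFinP.
  by congr Pe; apply/funext => y /=; rewrite EFin_Pr.
have bM := bmf_cst M.
have := add w bw w0; rewrite PrD// (_ : Pr s w = fun y => (Pr s u y + Pr s (cst M) y)%R); last first.
  by apply/funext => y; rewrite PrD.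
rewrite PrD//; [|exact: bmf_Pr..].
by rewrite -(add (cst M) bM)// => /addIr.
Qed.

(** Expand P_t ((u - c)^2) >= 0 with c = P_t u (x); mass at most 1 makes the contribution of c^2 at
    most c^2. *)
Lemma Pr_sqr t x u : bmf u -> (Pr t u x ^+ 2 <= Pr t (fun y => u y ^+ 2) x)%R.
Proof.
move=> bu; set c := Pr t u x.
have bu2 := bmfX bu; have bcu := bmfZ (- (2 * c))%R bu.
have bc := bmf_cst (c ^+ 2)%R.
have : (0 <= Pr t (fun y => (u y ^+ 2 + - (2 * c) * u y) + c ^+ 2) x)%R.
  apply: Pr_ge0 => y.
  by have := sqr_ge0 (u y - c)%R; congr (_ <= _)%R; ring.
rewrite (@PrD t x (fun y => u y ^+ 2 + - (2 * c) * u y)%R (cst (c ^+ 2)%R))//; last exact: bmfD.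
rewrite PrD// PrZ// -/c Pr_cst.
have /andP[q0 q1] := ms_fine_le1 t x.
have : (c ^+ 2 * fine (p t x setT) <= c ^+ 2)%R by rewrite ler_piMr ?sqr_ge0.
lra.
Qed.

Lemma Pr_0 x u : bmf u -> Pr 0 u x = u x.
Proof.
move=> bu; rewrite /Pr /Pe (eq_measure_integral \d_x); last first.
  by move=> A mA _; exact: ms_0.
rewrite integral_dirac// ?diracT ?mul1e//.
by case: bu => mu _; exact/measurable_EFinP.
Qed.

End markov_semigroup.

(** * Square-integrable functions, and the semigroup acting on the bounded ones *)

Section inner_product.
Context d (R : realType) (E : borelMetricType d R) (m : {measure set E -> \bar R}).
Local Notation L2 := (Lfun m 2%:E).

Lemma Lfun2P (u : E -> R) : u \in L2 <->
  measurable_fun setT u /\ (\int[m]_x (u x ^+ 2)%:E < +oo)%E.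
Proof.
have E2 : (\int[m]_x (`|(u x)%:E| `^ 2) = \int[m]_x (u x ^+ 2)%:E)%E.
  by apply: eq_integral => x _; rewrite /= powR_mulrn// real_normK ?num_real.
rewrite inE/=; split.
- move=> /andP[/[!inE]/= mu]; rewrite /finite_norm unlock E2 => Hu; split => //.
  by apply: lty_poweRy Hu; rewrite invr_neq0.
- move=> [mu Hu]; apply/andP; split; rewrite inE//= /finite_norm unlock E2.
  exact: poweR_lty.
Qed.

Lemma Lfun2_measurable (u : E -> R) : u \in L2 -> measurable_fun setT u.
Proof. by case/Lfun2P. Qed.

Lemma Lfun2_integrableM (u v : E -> R) : u \in L2 -> v \in L2 ->
  m.-integrable setT (EFin \o (fun x => u x * v x)).
Proof. by move=> u2 v2; apply/Lfun1_integrable; exact: Lfun2_mul_Lfun1. Qed.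

Lemma EFin_inner (u v : E -> R) : u \in L2 -> v \in L2 ->
  (inner m u v)%:E = (\int[m]_x (u x * v x)%:E)%E.
Proof.
move=> u2 v2; rewrite fineK// integrable_fin_num//.
exact: Lfun2_integrableM.
Qed.

Lemma Lfun2D (u v : E -> R) : u \in L2 -> v \in L2 ->
  (fun x => u x + v x) \in L2.
Proof.
have h : (1 <= 2%:E :> \bar R)%E by rewrite lee_fin ler1n.
by move=> u2 v2; have := Lfun_addr_closed m h => -[_ /(_ _ _ u2 v2)].
Qed.

Lemma Lfun2Z (c : R) (u : E -> R) : u \in L2 -> (fun x => c * u x) \in L2.
Proof.
move=> /Lfun2P[mu u2]; apply/Lfun2P; split; first exact: measurable_funM.
under eq_integral do rewrite exprMn EFinM.
rewrite ge0_integralZl//; last 3 first.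
- exact/measurable_EFinP/measurable_funX.
- by move=> x _; rewrite lee_fin sqr_ge0.
- by rewrite lee_fin sqr_ge0.
by rewrite lte_mul_pinfty// lee_fin sqr_ge0.
Qed.

Lemma Lfun2N (u : E -> R) : u \in L2 -> (fun x => - u x) \in L2.
Proof. by move=> /(Lfun2Z (-1)); under eq_fun do rewrite mulN1r. Qed.

Lemma Lfun2B (u v : E -> R) : u \in L2 -> v \in L2 ->
  (fun x => u x - v x) \in L2.
Proof. by move=> u2 /Lfun2N; exact: Lfun2D. Qed.

Lemma Lfun2_bounded (u v : E -> R) (M : R) : u \in L2 ->
  measurable_fun setT v -> (forall x, `|v x| <= M * `|u x|) -> v \in L2.
Proof.
move=> u2 mv vu; apply/Lfun2P; split => //.
have /Lfun2P[_ Mu2] := Lfun2Z M u2; apply: le_lt_trans Mu2.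
have mu := Lfun2_measurable u2.
apply: ge0_le_integral => //.
- by move=> x _; rewrite lee_fin sqr_ge0.
- exact/measurable_EFinP/measurable_funX.
- exact/measurable_EFinP/measurable_funX/measurable_funM.
- move=> x _; rewrite lee_fin -real_normK ?num_real// -[leRHS]real_normK ?num_real//.
  rewrite ler_sqr ?nnegrE// (le_trans (vu x))// normrM ler_wpM2r//.
  exact: ler_norm.
Qed.

Lemma innerC (u v : E -> R) : inner m u v = inner m v u.
Proof. by apply: eq_Rintegral => x _; rewrite mulrC. Qed.

Lemma inner0l (u : E -> R) : inner m (cst 0) u = 0.
Proof.
rewrite /inner /Rintegral; under eq_integral do rewrite mul0r.
by rewrite integral0.
Qed.

Lemma innerDl (u v w : E -> R) : u \in L2 -> v \in L2 -> w \in L2 ->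
  inner m (fun x => u x + v x) w = inner m u w + inner m v w.
Proof.
move=> u2 v2 w2; rewrite /inner -RintegralD//; [|exact: Lfun2_integrableM..].
by apply: eq_Rintegral => x _; rewrite mulrDl.
Qed.

Lemma innerZl c (u v : E -> R) : u \in L2 -> v \in L2 ->
  inner m (fun x => c * u x) v = c * inner m u v.
Proof.
move=> u2 v2; rewrite /inner -RintegralZl//; last exact: Lfun2_integrableM.
by apply: eq_Rintegral => x _; rewrite mulrA.
Qed.

Lemma innerZr c (u v : E -> R) : u \in L2 -> v \in L2 ->
  inner m u (fun x => c * v x) = c * inner m u v.
Proof. by move=> u2 v2; rewrite innerC innerZl// innerC. Qed.

Lemma innerNl (u v : E -> R) : u \in L2 -> v \in L2 ->
  inner m (fun x => - u x) v = - inner m u v.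
Proof.
move=> u2 v2; rewrite -mulN1r -innerZl//.
by apply: eq_Rintegral => x _; rewrite mulN1r.
Qed.

Lemma innerBl (u v w : E -> R) : u \in L2 -> v \in L2 -> w \in L2 ->
  inner m (fun x => u x - v x) w = inner m u w - inner m v w.
Proof. by move=> u2 v2 w2; rewrite innerDl ?innerNl//; exact: Lfun2N. Qed.

Lemma innerBr (u v w : E -> R) : u \in L2 -> v \in L2 -> w \in L2 ->
  inner m w (fun x => u x - v x) = inner m w u - inner m w v.
Proof. by move=> u2 v2 w2; rewrite innerC innerBl// !(innerC w). Qed.

Lemma inner_sqrB (u v : E -> R) : u \in L2 -> v \in L2 ->
  inner m (fun x => u x - v x) (fun x => u x - v x) =
  inner m u u - 2 * inner m u v + inner m v v.
Proof.
move=> u2 v2; have uv2 := Lfun2B u2 v2.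
rewrite (innerBl u2 v2 uv2) (innerBr u2 v2 u2) (innerBr u2 v2 v2) (innerC v u).
move: (inner m u u) (inner m u v) (inner m v v) => x y z; ring.
Qed.

Lemma inner_ge0 (u : E -> R) : 0 <= inner m u u.
Proof. by apply: Rintegral_ge0 => x _; rewrite -expr2 sqr_ge0. Qed.

Lemma EFin_inner_sqr (u : E -> R) : u \in L2 ->
  (inner m u u)%:E = (\int[m]_x (u x ^+ 2)%:E)%E.
Proof. by move=> u2; rewrite EFin_inner//; apply: eq_integral => x _; rewrite expr2. Qed.

End inner_product.

Section l2_semigroup.
Context d (R : realType) (E : borelMetricType d R) (m : {measure set E -> \bar R}).
Variable p : R -> E -> {measure set E -> \bar R}.
Hypothesis H : markov_semigroup m p.
Local Notation L2 := (Lfun m 2%:E).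

(** On this class [Pr] is linear at every point and not only almost everywhere. The class is stable
    under products and under the semigroup, which the algebra around Gamma requires. *)
Definition bL2 (u : E -> R) := bmf u /\ u \in L2.

Lemma bL2B u v : bL2 u -> bL2 v -> bL2 (fun x => u x - v x).
Proof. by move=> [bu u2] [bv v2]; split; [exact: bmfB|exact: Lfun2B]. Qed.

Lemma bL2M u v : bL2 u -> bL2 v -> bL2 (fun x => u x * v x).
Proof.
move=> [bu u2] [bv v2]; split; first exact: bmfM.
have [mu _] := bu; have [mv [M vM]] := bv.
apply: (@Lfun2_bounded _ _ _ _ u _ M) => //; first exact: measurable_funM.
by move=> x; rewrite normrM mulrC ler_wpM2r.
Qed.

Lemma integral_Pe_le t (f : E -> \bar R) : 0 < t -> (forall x, 0 <= f x)%E ->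
  measurable_fun setT f -> (\int[m]_x Pe p t f x <= \int[m]_x f x)%E.
Proof.
move=> t0 f0 mf; have := ms_sym H t0 mf (measurable_cst (1%E : \bar R)) f0 (fun=> lee01).
under eq_integral do rewrite mule1.
move=> ->; apply: ge0_le_integral => //.
- by move=> x _; rewrite mule_ge0//; apply: integral_ge0.
- apply: emeasurable_funM => //; exact: (measurable_Pe H).
- move=> x _; rewrite (integral_cst (p t x) measurableT 1)// mul1e.
  by rewrite -[leRHS]mule1 lee_wpmul2l// (ms_le1 H).
Qed.

(** Invariance of [m]: symmetry tested against the constant 1, with conservativeness. *)
Lemma integral_Pe t (f : E -> \bar R) : 0 < t -> (forall x, 0 <= f x)%E ->
  measurable_fun setT f -> (\int[m]_x Pe p t f x = \int[m]_x f x)%E.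
Proof.
move=> t0 f0 mf; have := ms_sym H t0 mf (measurable_cst (1%E : \bar R)) f0 (fun=> lee01).
under eq_integral do rewrite mule1.
move=> ->; apply: ae_eq_integral => //.
- apply: emeasurable_funM => //; exact: (measurable_Pe H).
- apply: filterS (ms_conservative H t0) => x Hx _.
  by rewrite (integral_cst (p t x) measurableT 1)// mul1e Hx mule1.
Qed.

Lemma bL2_Pr t u : 0 <= t -> bL2 u -> bL2 (Pr p t u).
Proof.
rewrite le_eqVlt => /predU1P[<-|t0] [bu u2].
  have -> : Pr p 0 u = u by apply/funext => x; rewrite (Pr_0 H _ bu).
  by split.
split; first exact: (bmf_Pr H); apply/Lfun2P; split.
  by case: bu => mu _; exact: (measurable_Pr H).
have /Lfun2P[mu] := u2; apply: le_lt_trans.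
apply: (@le_trans _ _ (\int[m]_x Pe p t (fun x => (u x ^+ 2)%:E) x)%E).
  apply: ge0_le_integral => //.
  - by move=> x _; rewrite lee_fin sqr_ge0.
  - exact/measurable_EFinP/measurable_funX/(measurable_Pr H).
  - apply: (measurable_Pe H); first by move=> x; rewrite lee_fin sqr_ge0.
    exact/measurable_EFinP/measurable_funX.
  - move=> x _; rewrite (_ : (fun _ => _) = EFin \o (fun x => u x ^+ 2))//.
    by rewrite -(EFin_Pr H) ?lee_fin ?(Pr_sqr H)//; exact: bmfX.
apply: integral_Pe_le => //; first by move=> x; rewrite lee_fin sqr_ge0.
exact/measurable_EFinP/measurable_funX.
Qed.

Let inner_Pr_ge0 t u v : 0 < t -> bL2 u -> bL2 v ->
  (forall x, 0 <= u x) -> (forall x, 0 <= v x) ->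
  inner m (Pr p t u) v = inner m u (Pr p t v).
Proof.
move=> t0 bu bv u0 v0; have [bu' u2] := bu; have [bv' v2] := bv.
have [mu _] := bu'; have [mv _] := bv'.
have bPu := bL2_Pr (ltW t0) bu; have bPv := bL2_Pr (ltW t0) bv.
apply: EFin_inj; rewrite !EFin_inner//; [|exact: bPv.2|exact: bPu.2].
under eq_integral do rewrite EFinM (EFin_Pr H)//.
under [RHS]eq_integral do rewrite EFinM (EFin_Pr H)//.
by apply: (ms_sym H) => //; exact/measurable_EFinP.
Qed.

Lemma inner_Pr t u v : 0 <= t -> bL2 u -> bL2 v ->
  inner m (Pr p t u) v = inner m u (Pr p t v).
Proof.
rewrite le_eqVlt => /predU1P[<-|t0] bu bv.
  have P0 w : bL2 w -> Pr p 0 w = w.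
    by move=> [bw _]; apply/funext => x; rewrite (Pr_0 H _ bw).
  by rewrite !P0.
(* Symmetry is given for nonnegative functions; w is written as |w| - (|w| - w). *)
have ps (w : E -> R) : bL2 w -> exists w1 w2 : E -> R, [/\ bL2 w1, bL2 w2,
    forall x, 0 <= w1 x, forall x, 0 <= w2 x & w = fun x => w1 x - w2 x].
  move=> bw; have [[mw [M wM]] w2] := bw.
  exists (fun x => `|w x|), (fun x => `|w x| - w x).
  have bnw : bL2 (fun x => `|w x|).
    have mnw : measurable_fun setT (fun x => `|w x|) by exact: measurableT_comp.
    split; first by split => //; exists M => x; rewrite normr_id.
    by apply: (@Lfun2_bounded _ _ _ _ w _ 1) => // x; rewrite normr_id mul1r.
  split => //; first exact: bL2B.
  - by move=> x; rewrite subr_ge0 ler_norm.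
  - by apply/funext => x; rewrite opprB addrC subrK.
have [u1 [u2 [bu1 bu2 u10 u20 ->]]] := ps u bu.
have [v1 [v2 [bv1 bv2 v10 v20 ->]]] := ps v bv.
have PB (w1 w2 : E -> R) : bL2 w1 -> bL2 w2 ->
    Pr p t (fun x => w1 x - w2 x) = fun x => Pr p t w1 x - Pr p t w2 x.
  by move=> [bw1 _] [bw2 _]; apply/funext => x; rewrite (PrB H).
rewrite !PB//.
have [_ ?] := bu1; have [_ ?] := bu2; have [_ ?] := bv1; have [_ ?] := bv2.
have [_ ?] := bL2_Pr (ltW t0) bu1; have [_ ?] := bL2_Pr (ltW t0) bu2.
have [_ ?] := bL2_Pr (ltW t0) bv1; have [_ ?] := bL2_Pr (ltW t0) bv2.
rewrite !innerBl ?innerBr//; try exact: Lfun2B.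
by rewrite !inner_Pr_ge0.
Qed.

End l2_semigroup.

Lemma cvg_at_right0_scale (R : realType) (c : R) : 0 < c ->
  c * h @[h --> (0 : R)^'+] --> (0 : R)^'+.
Proof.
move=> c0 A [e /= e0 eA]; exists (e / c) => /=; first by rewrite divr_gt0.
move=> h /=; rewrite sub0r normrN => he h0.
apply: eA => /=; last by rewrite mulr_gt0.
by rewrite sub0r normrN normrM (gtr0_norm c0) mulrC -ltr_pdivlMr.
Qed.

(** * The approximating forms h^-1 (u - P_h u, v) *)

Section form_of_semigroup.
Local Opaque Pr inner.
Context d (R : realType) (E : borelMetricType d R) (m : {measure set E -> \bar R}).
Variable p : R -> E -> {measure set E -> \bar R}.
Hypothesis H : markov_semigroup m p.
Local Notation L2 := (Lfun m 2%:E).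

Definition approx (h : R) (u v : E -> R) : R :=
  h^-1 * inner m (fun x => u x - Pr p h u x) v.

Lemma inner_Pr_add s t u : 0 <= s -> 0 <= t -> bL2 m u ->
  inner m (Pr p (s + t) u) u = inner m (Pr p s u) (Pr p t u).
Proof.
move=> s0 t0 bu; have bt := bL2_Pr H t0 bu.
rewrite (_ : Pr p (s + t) u = Pr p s (Pr p t u)).
  by rewrite (inner_Pr H s0 bt bu) innerC.
by apply/funext => x; rewrite (Pr_add H _ t0 s0 bu.1).
Qed.

Let inner_Pr_half u s : 0 <= s -> bL2 m u ->
  inner m (Pr p s u) u = inner m (Pr p (s / 2) u) (Pr p (s / 2) u).
Proof.
move=> s0 bu; have s20 : 0 <= s / 2 by rewrite divr_ge0.
by rewrite -(inner_Pr_add s20 s20 bu) -splitr.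
Qed.

(** Since (P_(s+t) u, u) = (P_s u, P_t u), this is the nonnegativity of the squared norm of P_(s/2)
    u - P_(t/2) u. *)
Lemma inner_Pr_midconvex u : bL2 m u -> forall s t, 0 <= s -> 0 <= t ->
  2 * inner m (Pr p ((s + t) / 2) u) u <=
    inner m (Pr p s u) u + inner m (Pr p t u) u.
Proof.
move=> bu s t s0 t0; have s20 : 0 <= s / 2 by rewrite divr_ge0.
have t20 : 0 <= t / 2 by rewrite divr_ge0.
have [_ bs] := bL2_Pr H s20 bu; have [_ bt] := bL2_Pr H t20 bu.
rewrite (inner_Pr_half s0 bu) (inner_Pr_half t0 bu) (mulrDl s t) (inner_Pr_add s20 t20 bu).
have := inner_ge0 m (fun x => Pr p (s / 2) u x - Pr p (t / 2) u x).
rewrite (inner_sqrB bs bt).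
move: (inner m (Pr p (s / 2) u) (Pr p (s / 2) u)).
move: (inner m (Pr p (s / 2) u) (Pr p (t / 2) u)).
move: (inner m (Pr p (t / 2) u) (Pr p (t / 2) u)).
move=> x y z; lra.
Qed.

Lemma inner_Pr_contract t u : 0 <= t -> bL2 m u ->
  inner m (Pr p t u) (Pr p t u) <= inner m u u.
Proof.
rewrite le_eqVlt => /predU1P[<-|t0] bu.
  by have -> : Pr p 0 u = u by apply/funext => x; rewrite (Pr_0 H _ bu.1).
have [[mu [M uM]] u2] := bu; have [bP P2] := bL2_Pr H (ltW t0) bu.
have [mP _] := bP.
rewrite -lee_fin !EFin_inner_sqr//.
apply: (@le_trans _ _ (\int[m]_x Pe p t (fun x => (u x ^+ 2)%:E) x)%E).
  apply: ge0_le_integral => //.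
  - by move=> x _; rewrite lee_fin sqr_ge0.
  - exact/measurable_EFinP/measurable_funX.
  - apply: (measurable_Pe H); first by move=> x; rewrite lee_fin sqr_ge0.
    exact/measurable_EFinP/measurable_funX.
  - move=> x _; rewrite (_ : (fun _ => _) = EFin \o (fun x => u x ^+ 2))//.
    have bu' := bu.1.
    by rewrite -(EFin_Pr H) ?lee_fin ?(Pr_sqr H)//; exact: bmfX.
apply: (integral_Pe_le H) => //; first by move=> x; rewrite lee_fin sqr_ge0.
exact/measurable_EFinP/measurable_funX.
Qed.

Lemma inner_Pr_nonincreasing u : bL2 m u -> forall s t, 0 <= s -> s <= t ->
  inner m (Pr p t u) u <= inner m (Pr p s u) u.
Proof.
move=> bu s t s0 st; have t0 := le_trans s0 st.
rewrite (inner_Pr_half s0 bu) (inner_Pr_half t0 bu).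
have s20 : 0 <= s / 2 by rewrite divr_ge0.
have -> : Pr p (t / 2) u = Pr p ((t - s) / 2) (Pr p (s / 2) u).
  have ts : 0 <= (t - s) / 2 by rewrite divr_ge0// subr_ge0.
  apply/funext => x; rewrite -(Pr_add H _ s20 ts bu.1).
  by congr (Pr p _ u x); field.
apply: inner_Pr_contract; first by rewrite divr_ge0// subr_ge0.
exact: (bL2_Pr H).
Qed.

Lemma approxE h u : 0 <= h -> bL2 m u ->
  approx h u u = (inner m (Pr p 0 u) u - inner m (Pr p (0 + h) u) u) / h.
Proof.
move=> h0 bu; have bP := bL2_Pr H h0 bu.
rewrite /approx mulrC; congr (_ / h); rewrite innerBl ?add0r//; [|by case: bu|by case: bP|by case: bu].
by congr (inner m _ _ - _); apply/funext => x; rewrite (Pr_0 H _ bu.1).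
Qed.

Lemma approx_nonincreasing h k u : 0 < h -> h <= k -> bL2 m u ->
  approx k u u <= approx h u u.
Proof.
move=> h0 hk bu; have k0 := lt_le_trans h0 hk.
rewrite !approxE ?(ltW h0) ?(ltW k0)//.
apply: (midconvex_slope (phi := fun s => inner m (Pr p s u) u)) => //.
- by move=> s t; exact: inner_Pr_nonincreasing.
- by move=> s t; exact: inner_Pr_midconvex.
Qed.

(** Expand the square, using that the squared norm of P_h u is (P_2h u, u). For u in the domain both
    terms on the right tend to 2 a(u, u); hence the squared norm of u - P_h u is o(h), which is what
    makes second-order errors negligible. *)
Lemma approx_sqr h u : 0 < h -> bL2 m u ->
  h^-1 * inner m (fun x => u x - Pr p h u x) (fun x => u x - Pr p h u x) =
  2 * approx h u u - 2 * approx (2 * h) u u.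
Proof.
move=> h0 bu; have [_ u2] := bu; have [_ P2] := bL2_Pr H (ltW h0) bu.
have h20 : 0 < 2 * h by rewrite mulr_gt0.
have [_ PP2] := bL2_Pr H (ltW h20) bu.
rewrite /approx (inner_sqrB u2 P2) (innerBl u2 P2 u2) (innerBl u2 PP2 u2).
rewrite -(inner_Pr_add (ltW h0) (ltW h0) bu) (_ : h + h = 2 * h); last by ring.
rewrite (innerC _ u (Pr p h u)).
move: (inner m u u) (inner m (Pr p h u) u) (inner m (Pr p (2 * h) u) u) => x y z.
by field; rewrite gt_eqF.
Qed.

(* Its integral is [2 h approx h u u]. *)
Definition fluct h u x := Pr p h (fun y => (u y - u x) ^+ 2) x.

Lemma fluctE h u x : bmf u -> fluct h u x =
  Pr p h (fun y => u y ^+ 2) x - 2 * u x * Pr p h u x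
  + u x ^+ 2 * fine (p h x setT).
Proof.
move=> bu; have bu2 := bmfX bu; have bu1 := bmfZ (2 * u x) bu.
have bB := bmfB bu2 bu1; have bc := bmf_cst E (u x ^+ 2).
rewrite -(Pr_cst H) -(PrZ H _ _ _ bu) -(PrB H _ _ bu2 bu1) -(PrD H _ _ bB bc).
by rewrite /fluct; congr (Pr p h _ x); apply/funext => y /=; ring.
Qed.

(** In the expansion [fluctE], conservativeness replaces the mass by 1 and gives P_h (u^2) the same
    integral as u^2; what is left is 2 (u - P_h u, u). *)
Lemma integral_fluct h u : 0 < h -> bL2 m u ->
  (\int[m]_x (fluct h u x)%:E = (2 * h * approx h u u)%:E)%E.
Proof.
move=> h0 bu; have [bu' u2] := bu; have [mu _] := bu'.
have [bP P2] := bL2_Pr H (ltW h0) bu; have mP := bP.1.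
have mP2 := (bmf_Pr H h (bmfX bu')).1.
have iP : m.-integrable setT (EFin \o (Pr p h (fun y => u y ^+ 2))).
  apply/integrableP; split; first exact/measurable_EFinP.
  have -> : (\int[m]_x `|(EFin \o Pr p h (fun y => u y ^+ 2)%R) x| =
      \int[m]_x (Pe p h (fun y => (u y ^+ 2)%:E) x))%E.
    apply: eq_integral => x _ /=; rewrite ger0_norm ?Pr_ge0//.
      by rewrite (EFin_Pr H)//; exact: bmfX.
    by move=> y; exact: sqr_ge0.
  rewrite (integral_Pe H)//; last 2 first.
  - by move=> x; rewrite lee_fin sqr_ge0.
  - exact/measurable_EFinP/measurable_funX.
  by case/Lfun2P : u2.
have iu : m.-integrable setT (EFin \o (fun x => u x ^+ 2)).
  exact: Lfun2_integrable_sqr.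
have iuP : m.-integrable setT (EFin \o (fun x => 2 * (u x * Pr p h u x))).
  have := integrableZl measurableT 2 (Lfun2_integrableM u2 P2).
  by apply: eq_integrable => //.
have -> : (\int[m]_x (fluct h u x)%:E = \int[m]_x
    (Pr p h (fun y => u y ^+ 2)%R x - 2 * (u x * Pr p h u x) + u x ^+ 2)%:E)%E.
  have mF : measurable_fun setT (fluct h u).
    have -> : fluct h u = fun x => Pr p h (fun y => u y ^+ 2) x -
        2 * u x * Pr p h u x + u x ^+ 2 * fine (p h x setT).
      by apply/funext => x; rewrite fluctE.
    apply: measurable_funD.
      apply: measurable_funB => //; apply: measurable_funM => //.
      exact: measurable_funM.
    apply: measurable_funM; first exact: measurable_funX.
    apply: (measurableT_comp (fine_measurable measurableT)).
    exact: (measurable_fun_pair2 h (ms_measurable H measurableT)).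
  apply: ae_eq_integral => //.
  - exact/measurable_EFinP.
  - apply/measurable_EFinP/measurable_funD; last exact: measurable_funX.
    apply: measurable_funB => //; apply: measurable_funM => //.
    exact: measurable_funM.
  - apply: filterS (ms_conservative H h0) => x Hx _; rewrite fluctE// Hx/=.
    by congr (_%:E); ring.
have uu : (\int[m]_x (Pr p h (fun y => u y ^+ 2) x) = \int[m]_x (u x ^+ 2))%R.
  rewrite /Rintegral; congr fine.
  transitivity (\int[m]_x Pe p h (fun y => (u y ^+ 2)%:E) x)%E.
    by apply: eq_integral => x _; rewrite (EFin_Pr H _ _ (bmfX bu')).
  apply: (integral_Pe H h0) => //; first by move=> x; rewrite /= lee_fin sqr_ge0.
  exact/measurable_EFinP/measurable_funX.
rewrite -[LHS]fineK; last first.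
  apply: integrable_fin_num => //; rewrite (_ : (fun _ => _) =
     (EFin \o Pr p h (fun y => u y ^+ 2)%R) \- (EFin \o (fun x => 2 * (u x * Pr p h u x))%R)
     \+ (EFin \o (fun x => u x ^+ 2)%R))%E//.
  by apply: integrableD => //; exact: integrableB.
congr (_%:E).
rewrite -[fine _]/(\int[m]_x (Pr p h (fun y => u y ^+ 2)%R x - 2 * (u x * Pr p h u x) + u x ^+ 2))%R.
rewrite RintegralD//; last first.
  rewrite (_ : _ \o _ =
     (EFin \o Pr p h (fun y => u y ^+ 2)%R) \- (EFin \o (fun x => 2 * (u x * Pr p h u x))%R))%E//.
  exact: integrableB.
rewrite RintegralB// RintegralZl//; last exact: Lfun2_integrableM.
rewrite uu /approx innerBl//.
have -> : (\int[m]_x (u x ^+ 2) = inner m u u)%R by apply: eq_Rintegral => x _; rewrite expr2.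
rewrite -[(\int[m]_x (u x * Pr p h u x))%R]/(inner m u (Pr p h u)) (innerC _ (Pr p h u)).
field; rewrite gt_eqF//.
Qed.

(** A bound on squared increments: u(y) v(y) - u(x) v(x) = u(y) (v(y) - v(x)) + v(x) (u(y) - u(x)),
    squared, averaged by P_h and integrated. The approximating form is recovered from [fluct]. *)
Lemma approx_mul h u v M N : 0 < h -> bL2 m u -> bL2 m v ->
  (forall x, `|u x| <= M) -> (forall x, `|v x| <= N) ->
  approx h (fun x => u x * v x) (fun x => u x * v x) <=
    2 * M ^+ 2 * approx h v v + 2 * N ^+ 2 * approx h u u.
Proof.
move=> h0 bu bv uM vN; have buv := bL2M bu bv.
have [bu' _] := bu; have [bv' _] := bv.
have fl w : bL2 m w -> measurable_fun setT (fluct h w).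
  move=> [bw w2]; have [mw _] := bw.
  have -> : fluct h w = fun x => Pr p h (fun y => w y ^+ 2) x -
      2 * w x * Pr p h w x + w x ^+ 2 * fine (p h x setT).
    by apply/funext => x; rewrite fluctE.
  apply: measurable_funD.
    apply: measurable_funB; first exact: (bmf_Pr H h (bmfX bw)).1.
    by apply: measurable_funM; [exact: measurable_funM|exact: (bmf_Pr H h bw).1].
  apply: measurable_funM; first exact: measurable_funX.
  apply: (measurableT_comp (fine_measurable measurableT)).
  exact: (measurable_fun_pair2 h (ms_measurable H measurableT)).
have fl0 w x : 0 <= fluct h w x by apply: Pr_ge0 => y; exact: sqr_ge0.
have bB (w : E -> R) c : bmf w -> bmf (fun y => (w y - c) ^+ 2).
  by move=> bw; apply: bmfX; apply: bmfB => //; exact: bmf_cst.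
have : (\int[m]_x (fluct h (fun x => u x * v x)%R x)%:E <=
   \int[m]_x ((2 * M ^+ 2)%:E * (fluct h v x)%:E + (2 * N ^+ 2)%:E * (fluct h u x)%:E))%E.
  apply: ge0_le_integral => //.
  - by move=> x _; rewrite lee_fin.
  - exact/measurable_EFinP/fl.
  - by apply: emeasurable_funD; apply: measurable_funeM; apply/measurable_EFinP/fl.
  - move=> x _; rewrite -!EFinM -EFinD lee_fin /fluct.
    have bfu := bB u (u x) bu'; have bfv := bB v (v x) bv'.
    have bfuv := bB _ (u x * v x) (bmfM bu' bv').
    have bMv := bmfZ (2 * M ^+ 2) bfv; have bNu := bmfZ (2 * N ^+ 2) bfu.
    rewrite -(PrZ H h x _ bfv) -(PrZ H h x _ bfu) -(PrD H h x bMv bNu).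
    apply: (le_Pr H h x bfuv (bmfD bMv bNu)) => y.
      have -> : u y * v y - u x * v x = u y * (v y - v x) + v x * (u y - u x) by ring.
      have hu : u y ^+ 2 <= M ^+ 2 by rewrite -real_normK ?num_real// lerXn2r ?nnegrE ?(le_trans _ (uM y)).
      have hv : v x ^+ 2 <= N ^+ 2 by rewrite -real_normK ?num_real// lerXn2r ?nnegrE ?(le_trans _ (vN x)).
      have := ler_wpM2r (sqr_ge0 (v y - v x)) hu.
      have := ler_wpM2r (sqr_ge0 (u y - u x)) hv.
      have := sqr_ge0 (u y * (v y - v x) - v x * (u y - u x)).
      set A := v y - v x; set B := u y - u x; nra.
have M0 : (0 <= (2 * M ^+ 2)%:E)%E by rewrite lee_fin mulr_ge0// sqr_ge0.
have N0 : (0 <= (2 * N ^+ 2)%:E)%E by rewrite lee_fin mulr_ge0// sqr_ge0.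
rewrite ge0_integralD//; last 4 first.
- by move=> x _; apply: mule_ge0 => //; rewrite lee_fin.
- by apply: measurable_funeM; apply/measurable_EFinP/fl.
- by move=> x _; apply: mule_ge0 => //; rewrite lee_fin.
- by apply: measurable_funeM; apply/measurable_EFinP/fl.
have IZ w c : bL2 m w -> (0 <= c%:E)%E -> (\int[m]_x (c%:E * (fluct h w x)%:E) =
    c%:E * \int[m]_x (fluct h w x)%:E)%E.
  move=> bw c0; apply: ge0_integralZl => //; first exact/measurable_EFinP/fl.
  by move=> x _; rewrite lee_fin.
rewrite (IZ _ _ bv M0) (IZ _ _ bu N0).
rewrite !integral_fluct// -!EFinM -EFinD lee_fin => Hle.
have h20 : 0 < 2 * h by rewrite mulr_gt0.
rewrite -(ler_pM2l h20); apply: (le_trans Hle).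
by rewrite le_eqVlt; apply/orP; left; apply/eqP; ring.
Qed.

End form_of_semigroup.

Lemma cvg_mulrl (R : realType) (T : Type) (F : set_system T) {FF : Filter F}
    (c l : R) (f : T -> R) :
  f x @[x --> F] --> l -> c * f x @[x --> F] --> c * l.
Proof. by move=> fl; apply: cvgM => //; exact: cvg_cst. Qed.
Arguments cvg_mulrl {R T F FF} c {l f}.

Lemma cvg_near_eq (T : Type) (U : topologicalType) (F : set_system T)
    {FF : Filter F} (f g : T -> U) (l : U) :
  {near F, f =1 g} -> f x @[x --> F] --> l -> g x @[x --> F] --> l.
Proof.
move=> fg fl; apply: (cvg_trans _ fl); apply: near_eq_cvg.
by apply: filterS fg => x ->.
Qed.

(** * The domain of the form, and the limit from which Gamma arises *)

Section domain_of_form.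
Local Opaque Pr inner.
Context d (R : realType) (E : borelMetricType d R) (m : {measure set E -> \bar R}).
Variable p : R -> E -> {measure set E -> \bar R}.
Hypothesis H : markov_semigroup m p.
Variables (D : set (E -> R)) (a : (E -> R) -> (E -> R) -> R).
Hypothesis D_cvg : forall u, bL2 m u ->
  (D u <-> cvg (approx m p h u u @[h --> (0 : R)^'+])).
Hypothesis a_lim : forall u v, D u -> D v ->
  approx m p h u v @[h --> (0 : R)^'+] --> a u v.

(** A uniform bound is enough since the approximating forms increase as h decreases to 0. *)
Lemma domain_of_bound C u : bL2 m u ->
  (forall h, 0 < h -> approx m p h u u <= C) -> D u.
Proof.
move=> bu uC; apply/(D_cvg bu).
have : cvg ((inner m (Pr p 0 u) u - inner m (Pr p (0 + h) u) u) / h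
    @[h --> (0 : R)^'+]).
  apply: (@midconvex_slope_cvg _ (fun s => inner m (Pr p s u) u)
    (inner_Pr_nonincreasing H bu) (inner_Pr_midconvex H bu) 0 C (lexx 0)).
  by move=> h h0; have := uC h h0; rewrite (approxE H (ltW h0) bu).
move=> /cvg_ex[l cl]; apply/cvg_ex; exists l; apply: cvg_trans cl.
by apply: near_eq_cvg; near=> h; rewrite (approxE H _ bu).
Unshelve. all: by end_near. Qed.

Lemma approx_le_form u h : bL2 m u -> D u -> 0 < h -> approx m p h u u <= a u u.
Proof.
move=> bu Du h0; apply: (cvgr_to_ge (a_lim Du Du)).
near=> k; apply: (approx_nonincreasing H) => //.
by near: k; exact: nbhs_right_le.
Unshelve. all: by end_near. Qed.

(** By symmetry the approximating form of P_t u is the difference quotient at 2t, with step h, of s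
    -> (P_s u, u); convexity bounds it by the quotient over [0, 2t]. *)
Lemma domain_Pr u t : bL2 m u -> 0 < t -> D (Pr p t u).
Proof.
move=> bu t0; have bP := bL2_Pr H (ltW t0) bu.
have t20 : 0 < t + t by rewrite addr_gt0.
apply: (@domain_of_bound ((inner m (Pr p 0 u) u - inner m (Pr p (t + t) u) u) / (t + t))) => //.
move=> h h0.
have := @midconvex_slope_bound _ (fun s => inner m (Pr p s u) u)
  (inner_Pr_nonincreasing H bu) (inner_Pr_midconvex H bu) (t + t) h t20 h0.
apply: le_trans; rewrite (approxE H (ltW h0) bP) add0r.
have -> : Pr p 0 (Pr p t u) = Pr p t u by apply/funext => x; rewrite (Pr_0 H _ bP.1).
rewrite (inner_Pr_add H (ltW t0) (ltW t0) bu).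
have -> : inner m (Pr p (t + t + h) u) u = inner m (Pr p h (Pr p t u)) (Pr p t u).
  have ht : 0 <= t + h by rewrite addr_ge0// ltW.
  rewrite (_ : t + t + h = (t + h) + t); last by ring.
  rewrite (inner_Pr_add H ht (ltW t0) bu); congr (inner m _ _).
  by apply/funext => x; rewrite addrC (Pr_add H _ (ltW t0) (ltW h0) bu.1).
exact: lexx.
Qed.

Lemma domainM u v : bL2 m u -> bL2 m v -> D u -> D v -> D (fun x => u x * v x).
Proof.
move=> bu bv Du Dv; have [[_ [M uM]] _] := bu; have [[_ [N vN]] _] := bv.
apply: (@domain_of_bound (2 * M ^+ 2 * a v v + 2 * N ^+ 2 * a u u)).
  exact: bL2M.
move=> h h0; apply: (le_trans (approx_mul H h0 bu bv uM vN)).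
have av := approx_le_form bv Dv h0; have au := approx_le_form bu Du h0.
by apply: lerD; apply: ler_wpM2l => //; apply: mulr_ge0 => //; exact: sqr_ge0.
Qed.

Lemma approx_sqr_cvg0 u : bL2 m u -> D u ->
  h^-1 * inner m (fun x => u x - Pr p h u x) (fun x => u x - Pr p h u x)
    @[h --> (0 : R)^'+] --> (0 : R).
Proof.
move=> bu Du; have c1 := a_lim Du Du.
have c2 : approx m p (2 * h) u u @[h --> (0 : R)^'+] --> a u u.
  by apply: (cvg_comp _ _ (@cvg_at_right0_scale R 2 _) c1).
have c3 : 2 * approx m p h u u - 2 * approx m p (2 * h) u u
    @[h --> (0 : R)^'+] --> (0 : R).
  by rewrite -[X in _ --> X](subrr (2 * a u u)); exact: (cvgB (cvg_mulrl 2 c1) (cvg_mulrl 2 c2)).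
apply: (cvg_near_eq _ c3); near=> h.
have h0 : 0 < h by near: h; exact: nbhs_right_gt.
by rewrite (approx_sqr H h0 bu).
Unshelve. all: by end_near. Qed.

(** Serves to bound the error terms of [gamma_cvg], in which two factors are of the form u - P_h u
    and the third is bounded. *)
Lemma inner_absM (M : R) (f g k : E -> R) : f \in Lfun m 2%:E ->
  g \in Lfun m 2%:E -> measurable_fun setT k -> (forall x, `|k x| <= M) ->
  `|inner m f (fun x => k x * g x)| <= M / 2 * (inner m f f + inner m g g).
Proof.
Local Transparent inner.
move=> f2 g2 mk kM.
have kg2 : (fun x => k x * g x) \in Lfun m 2%:E.
  apply: (Lfun2_bounded (M := M) g2).
    by apply: measurable_funM => //; exact: (Lfun2_measurable g2).
  by move=> x; rewrite normrM ler_wpM2r.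
have i1 := Lfun2_integrableM f2 kg2.
have iff := Lfun2_integrableM f2 f2; have igg := Lfun2_integrableM g2 g2.
have iD : m.-integrable setT (EFin \o (fun x => f x * f x + g x * g x)).
  exact: (integrableD measurableT iff igg).
rewrite /inner; apply: (le_trans (le_normr_Rintegral measurableT i1)).
rewrite -RintegralD// -RintegralZl//; apply: le_Rintegral => //.
- exact: (integrable_norm i1).
- exact: (integrableZl measurableT (M / 2) iD).
move=> x _; rewrite !normrM mulrCA.
have M0 : 0 <= M by exact: le_trans (kM x).
apply: (@le_trans _ _ (M * (`|f x| * `|g x|))); first by rewrite ler_wpM2r ?mulr_ge0.
rewrite -mulrA ler_wpM2l// -!expr2 -(real_normK (num_real (f x))) -(real_normK (num_real (g x))).
have := sqr_ge0 (`|f x| - `|g x|); set A := `|f x|; set B := `|g x|; nra.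
Qed.

(** Put w = u - P_h u and z = v - P_h v. Symmetry turns (P_h v, P_h (u^2)) into (P_2h v, u^2), and
    u^2 - (P_h u)^2 = 2 u w - w^2. Collecting the terms of first order gives [main]; what remains, 2
    (z, u w) + (P_h v, w^2), is quadratic in w and z, and [approx_sqr_cvg0] makes it o(h). *)
Lemma gamma_cvg u v : bL2 m u -> bL2 m v -> D u -> D v ->
  h^-1 * inner m (Pr p h v)
    (fun x => Pr p h (fun y => u y ^+ 2) x - Pr p h u x ^+ 2)
    @[h --> (0 : R)^'+] -->
  2 * a u (fun x => u x * v x) - a v (fun x => u x ^+ 2).
Proof.
move=> bu bv Du Dv.
have Duu : D (fun x => u x ^+ 2) by exact: domainM.
have Duv := domainM bu bv Du Dv.
have buu : bL2 m (fun x => u x ^+ 2) by exact: (bL2M bu bu).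
have buv := bL2M bu bv.
have [[mu [M uM]] u2] := bu; have [[mv [N vN]] v2] := bv.
pose sq w h := h^-1 * inner m (fun x => w x - Pr p h w x) (fun x => w x - Pr p h w x).
pose main h := approx m p h v (fun x => u x ^+ 2)
   - 2 * approx m p (2 * h) v (fun x => u x ^+ 2)
   + 2 * approx m p h u (fun x => u x * v x).
pose err h := M * (sq v h + sq u h) + N * sq u h.
have cmain : main h @[h --> (0 : R)^'+] -->
    2 * a u (fun x => u x * v x) - a v (fun x => u x ^+ 2).
  have -> : 2 * a u (fun x => u x * v x) - a v (fun x => u x ^+ 2) =
    a v (fun x => u x ^+ 2) - 2 * a v (fun x => u x ^+ 2) +
    2 * a u (fun x => u x * v x) by ring.
  have c2 : approx m p (2 * h) v (fun x => u x ^+ 2) @[h --> (0 : R)^'+] -->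
      a v (fun x => u x ^+ 2).
    by apply: (cvg_comp _ _ (@cvg_at_right0_scale R 2 _) (a_lim Dv Duu)).
  apply: cvgD; last exact: (cvg_mulrl 2 (a_lim Du Duv)).
  apply: cvgB; first exact: a_lim.
  exact: (cvg_mulrl 2 c2).
have cerr : err h @[h --> (0 : R)^'+] --> (0 : R).
  have cu : sq u h @[h --> (0 : R)^'+] --> (0 : R) by exact: approx_sqr_cvg0.
  have cv : sq v h @[h --> (0 : R)^'+] --> (0 : R) by exact: approx_sqr_cvg0.
  rewrite -[X in _ --> X](_ : M * (0 + 0) + N * 0 = 0); last by ring.
  exact: (cvgD (cvg_mulrl M (cvgD cv cu)) (cvg_mulrl N cu)).
apply: (@squeeze_cvgr _ _ _ _ (fun h => main h - err h) (fun h => main h + err h)); last 2 first.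
- by rewrite -[X in _ --> X]subr0; exact: cvgB.
- by rewrite -[X in _ --> X]addr0; exact: cvgD.
near=> h.
have h0 : 0 < h by near: h; exact: nbhs_right_gt.
have h20 : 0 < 2 * h by rewrite mulr_gt0.
have bPu := bL2_Pr H (ltW h0) bu; have bPv := bL2_Pr H (ltW h0) bv.
have bPPv := bL2_Pr H (ltW h20) bv.
have bPuu := bL2_Pr H (ltW h0) buu.
have bPu2 : bL2 m (fun x => Pr p h u x ^+ 2) by exact: (bL2M bPu bPu).
pose w x := u x - Pr p h u x; pose z x := v x - Pr p h v x.
have bw : bL2 m w by exact: bL2B.
have bz : bL2 m z by exact: bL2B.
have buw := bL2M bu bw; have bww := bL2M bw bw.
have e1 : inner m (Pr p h v) (Pr p h (fun y => u y ^+ 2)) =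
    inner m (Pr p (2 * h) v) (fun y => u y ^+ 2).
  rewrite -(inner_Pr H (ltW h0) bPv buu); congr (inner m _ _).
  apply/funext => x; rewrite (_ : 2 * h = h + h); last by ring.
  by rewrite (Pr_add H _ (ltW h0) (ltW h0) bv.1).
have e2 : inner m (Pr p h v) (fun x => u x ^+ 2) - inner m (Pr p h v) (fun x => Pr p h u x ^+ 2) =
    2 * inner m (Pr p h v) (fun x => u x * w x) - inner m (Pr p h v) (fun x => w x * w x).
  rewrite -(innerBr buu.2 bPu2.2 bPv.2) -(innerZr 2 bPv.2 buw.2).
  rewrite -(innerBr (Lfun2Z 2 buw.2) bww.2 bPv.2); congr (inner m _ _).
  by apply/funext => x; rewrite /w; ring.
have e3 : inner m (Pr p h v) (fun x => u x * w x) =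
    inner m w (fun x => u x * v x) - inner m z (fun x => u x * w x).
  have -> : inner m w (fun x => u x * v x) = inner m v (fun x => u x * w x).
    by apply: eq_Rintegral => x _; ring.
  rewrite -(innerBl v2 bz.2 buw.2); congr (inner m _ _).
  by apply/funext => x; rewrite /z; ring.
have bd1 := @inner_absM M z w u bz.2 bw.2 mu uM.
have bd2 := @inner_absM N w w (Pr p h v) bw.2 bw.2 bPv.1.1 (fun x => Pr_bound H h x mv vN).
have e4 : inner m (Pr p h v) (fun x => w x * w x) = inner m w (fun x => Pr p h v x * w x).
  by apply: eq_Rintegral => x _; ring.
have LE : h^-1 * inner m (Pr p h v)
    (fun x => Pr p h (fun y => u y ^+ 2) x - Pr p h u x ^+ 2) =
   main h - h^-1 * (2 * inner m z (fun x => u x * w x) + inner m w (fun x => Pr p h v x * w x)).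
  rewrite (innerBr bPuu.2 bPu2.2 bPv.2) e1 /main /approx -/w.
  rewrite (innerBl v2 bPv.2 buu.2) (innerBl v2 bPPv.2 buu.2).
  move: e2; rewrite e3 e4.
  move: (inner m (Pr p h v) _) (inner m (Pr p h v) _) (inner m w _) (inner m z _) (inner m w _)
   (inner m (Pr p (2 * h) v) _) (inner m v _) => A1 A2 A3 A4 A5 A6 A7 e2.
  have -> : A1 = A2 - (2 * (A5 - A4) - A3) by rewrite -e2; ring.
  by field; rewrite gt_eqF.
rewrite LE /err /sq -/w -/z.
have hi0 : 0 <= h^-1 by rewrite invr_ge0 ltW.
move: bd1 bd2; rewrite !ler_norml => /andP[b1 b2] /andP[b3 b4].
move: (inner m z (fun x => u x * w x)) (inner m w _) (inner m z z) (inner m w w) b1 b2 b3 b4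
 => A1 A2 A3 A4 b1 b2 b3 b4.
have b5 : 2 * A1 + A2 <= M * (A3 + A4) + N * A4.
  have : M / 2 * (A3 + A4) = (M * (A3 + A4)) / 2 by ring.
  have : N / 2 * (A4 + A4) = N * A4 by field.
  lra.
have b6 : - (M * (A3 + A4) + N * A4) <= 2 * A1 + A2.
  have : M / 2 * (A3 + A4) = (M * (A3 + A4)) / 2 by ring.
  have : N / 2 * (A4 + A4) = N * A4 by field.
  lra.
have -> : M * (h^-1 * A3 + h^-1 * A4) + N * (h^-1 * A4) = h^-1 * (M * (A3 + A4) + N * A4) by ring.
by rewrite lerD2l lerN2 ler_wpM2l//= lerD2l -mulrN ler_wpM2l// lerNl.
Unshelve. all: by end_near. Qed.

End domain_of_form.

(** * Variants of Fatou's lemma and almost everywhere convergence *)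

Section convergence_of_integrals.
Context d (T : measurableType d) (R : realType) (mu : {measure set T -> \bar R}).

Lemma limn_einf_le (u : (\bar R)^nat) (c : R^nat) (l : R) :
  (forall n, (u n <= (c n)%:E)%E) -> c n @[n --> \oo] --> l ->
  (limn_einf u <= l%:E)%E.
Proof.
move=> uc cl; apply/lee_addgt0Pr => e e0.
rewrite limn_einf_lim; apply: lime_le; first exact: is_cvg_einfs.
have [n0 _ Hn0] : \forall n \near \oo, c n <= l + e.
  by apply: (cvgr_le _ cl); rewrite ltrDl.
near=> n; apply: (@le_trans _ _ (u (maxn n n0))).
  by apply: ereal_inf_lbound; exists (maxn n n0) => //=; exact: leq_maxl.
apply: (le_trans (uc _)); rewrite -EFinD lee_fin.
by apply: Hn0 => /=; exact: leq_maxr.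
Unshelve. all: by end_near. Qed.

Lemma fatou_ae (D N : set T) (f : (T -> \bar R)^nat) (g : T -> \bar R) :
  measurable D -> measurable N -> mu N = 0%E ->
  (forall n, measurable_fun D (f n)) -> (forall n x, (0 <= f n x)%E) ->
  measurable_fun D g -> (forall x, (0 <= g x)%E) ->
  (forall x, D x -> ~ N x -> (g x <= limn_einf (f ^~ x))%E) ->
  (\int[mu]_(x in D) g x <= limn_einf (fun n => \int[mu]_(x in D) f n x))%E.
Proof.
move=> mD mN N0 mf f0 mg g0 gf.
rewrite (ge0_negligible_integral mN mD)//.
have mDN : measurable (D `\` N) by exact: measurableD.
have mfDN n : measurable_fun (D `\` N) (f n) by apply: measurable_funS (mf n).
have -> : (fun n => \int[mu]_(x in D) f n x)%E = fun n => (\int[mu]_(x in D `\` N) f n x)%E.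
  by apply/funext => n; rewrite (ge0_negligible_integral mN mD).
apply: (le_trans _ (@fatou _ _ _ mu _ mDN f mfDN (fun n x _ => f0 n x))).
apply: ge0_le_integral => //.
- exact: measurable_funS mg.
- under eq_fun do rewrite -[limn_einf _]oppeK -limn_esupN.
  apply: measurableT_comp => //; apply: measurable_fun_limn_esup => n.
  exact: measurableT_comp.
- by move=> x [Dx Nx]; exact: gf.
Qed.

Lemma fatou_le (D N : set T) (f : (T -> \bar R)^nat) (g : T -> \bar R)
    (c : R^nat) (l : R) :
  measurable D -> measurable N -> mu N = 0%E ->
  (forall n, measurable_fun D (f n)) -> (forall n x, (0 <= f n x)%E) ->
  measurable_fun D g -> (forall x, (0 <= g x)%E) ->
  (forall x, D x -> ~ N x -> (g x <= limn_einf (f ^~ x))%E) ->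
  (forall n, (\int[mu]_(x in D) f n x <= (c n)%:E)%E) ->
  c n @[n --> \oo] --> l ->
  (\int[mu]_(x in D) g x <= l%:E)%E.
Proof.
move=> mD mN N0 mf f0 mg g0 gf fc cl.
apply: (le_trans (fatou_ae mD mN N0 mf f0 mg g0 gf)).
exact: limn_einf_le cl.
Qed.

(** The sum of the series has integral at most 2, so it is finite almost everywhere and its terms
    tend to 0 there. *)
Lemma ae_cvg0_of_summable (g : (T -> R)^nat) :
  (forall n, measurable_fun setT (g n)) -> (forall n x, 0 <= g n x) ->
  (forall n, (\int[mu]_x (g n x)%:E <= ((1 / 2) ^+ n)%:E)%E) ->
  {ae mu, forall x, g n x @[n --> \oo] --> 0}.
Proof.
move=> mg g0 gn.
pose S x := (\sum_(n <oo) (g n x)%:E)%E.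
have S0 x : (0 <= S x)%E by apply: nneseries_ge0 => n _ _; rewrite lee_fin.
have iS : mu.-integrable setT S.
  apply/integrableP; split.
    apply: ge0_emeasurable_sum => //; first by move=> n x _ _; rewrite lee_fin.
    by move=> n _; exact/measurable_EFinP.
  under eq_integral do rewrite gee0_abs//.
  rewrite integral_nneseries//; last 2 first.
  - by move=> n; exact/measurable_EFinP.
  - by move=> n x _; rewrite lee_fin.
  apply: (@le_lt_trans _ _ (\sum_(n <oo) ((1 / 2) ^+ n)%:E)%E).
    apply: lee_nneseries => [n _ _|n _]; last exact: gn.
    by apply: integral_ge0 => x _; rewrite lee_fin.
  apply: (@le_lt_trans _ _ 2%:E); last exact: ltry.
  apply: lime_le; first by apply: is_cvg_nneseries => n _ _; rewrite lee_fin exprn_ge0// divr_ge0.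
  apply: nearW => n; rewrite sumEFin lee_fin.
  suff -> : \sum_(0 <= i < n) (1 / 2) ^+ i = 2 - 2 * (1 / 2) ^+ n :> R.
    by rewrite gerBl mulr_ge0// exprn_ge0// divr_ge0.
  elim: n => [|n IH]; first by rewrite big_nil expr0 mulr1 subrr.
  by rewrite big_nat_recr//= IH exprS; field.
have := integrable_ae measurableT iS; apply: filterS => x /(_ Logic.I) Sx.
apply: cvg_series_cvg_0; apply/cvg_ex; exists (fine (S x)).
have : (\sum_(0 <= k < n) (g k x)%:E)%E @[n --> \oo] --> S x.
  by apply: is_cvg_nneseries => n _ _; rewrite lee_fin.
rewrite -{1}(fineK Sx) => /fine_cvgP[_]; apply: cvg_trans; apply: near_eq_cvg.
by apply: nearW => n; rewrite /series/= sumEFin.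
Qed.

End convergence_of_integrals.

(** * The jump representation of the form *)

Section jump_form.
Local Opaque inner.
Context d (R : realType) (E : borelMetricType d R) (m : {measure set E -> \bar R}).
Variables (D : set (E -> R)) (a : (E -> R) -> (E -> R) -> R).
Hypotheses (aD : dirichlet_form m D a) (aR : regular_form m D a).
Variables (J : {measure set (E * E) -> \bar R}) (N : R.-ker E ~> E).
Hypothesis aJ : pure_jump m D a J N.
Hypothesis moff : measurable (@offdiag d R E).
Hypothesis mset1 : forall x : E, measurable [set x].
Local Notation L2 := (Lfun m 2%:E).
Local Notation off := (@offdiag d R E).

(** The disintegration over [m] handles the first coordinate, and the symmetry of [J] the second.
    Convergence m-almost everywhere thus yields convergence of increments J-almost everywhere. *)
Lemma jump_null (Z : set E) : measurable Z -> m Z = 0%E ->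
  J (off `&` [set z | Z z.1 \/ Z z.2]) = 0%E.
Proof.
move=> mZ Z0.
have m1 : measurable (off `&` (Z `*` setT)).
  by apply: measurableI => //; exact: measurableX.
have m2 : measurable (off `&` (setT `*` Z)).
  by apply: measurableI => //; exact: measurableX.
have J1 : J (off `&` (Z `*` setT)) = 0%E.
  rewrite (jump_kernel aJ)//; apply/eqP; rewrite eq_le; apply/andP; split; last first.
    exact: integral_ge0.
  have := @le_lower_integral _ _ _ m Z
    (fun x => N x (xsection (off `&` (Z `*` setT)) x)) (cst 0%E) mZ Z0.
  rewrite integral0; apply => //= x Zx.
  rewrite (_ : xsection _ x = set0) ?measure0//.
  by rewrite -subset0 => y; rewrite /xsection/= inE => -[_ [/Zx]].
have J2 : J (off `&` (setT `*` Z)) = 0%E.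
  rewrite -J1 -(jump_sym aJ m1)//; congr (J _); apply/seteqP; split => -[x y]/=.
    by move=> [/= xy [_ Zy]]; split => //=; exact/nesym.
  by move=> [/= xy [Zy _]]; split => //=; exact/nesym.
have l1 : (J (off `&` (Z `*` setT)) <= 0)%E by rewrite J1.
have l2 : (J (off `&` (setT `*` Z)) <= 0)%E by rewrite J2.
have JU := le_trans (measureU2 J m1 m2) (leeD l1 l2).
rewrite adde0 -setIUr in JU.
apply/eqP; rewrite eq_le measure_ge0 andbT; apply: le_trans JU.
rewrite le_eqVlt; apply/orP; left; apply/eqP; congr (J _); congr (_ `&` _).
by apply/seteqP; split => z /=; tauto.
Qed.

Lemma df_add u v : D u -> D v -> D (fun x => u x + v x).
Proof.
move=> Du Dv; rewrite (_ : (fun x => u x + v x) = fun x => 1 * u x + v x).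
  exact: (df_lin aD).
by apply/funext => x; rewrite mul1r.
Qed.

Lemma df_sub u v : D u -> D v -> D (fun x => u x - v x).
Proof.
move=> Du Dv; rewrite (_ : (fun x => u x - v x) = fun x => -1 * v x + u x).
  exact: (df_lin aD).
by apply/funext => x; rewrite mulN1r addrC.
Qed.

Lemma form_addl u v w : D u -> D v -> D w ->
  a (fun x => u x + v x) w = a u w + a v w.
Proof.
move=> Du Dv Dw; rewrite -[a u w]mul1r -(df_bilin aD)//.
by congr a; apply/funext => x; rewrite mul1r.
Qed.

Lemma form_subl u v w : D u -> D v -> D w ->
  a (fun x => u x - v x) w = a u w - a v w.
Proof.
move=> Du Dv Dw; rewrite addrC -[- a v w]mulN1r -(df_bilin aD)//.
by congr a; apply/funext => x; rewrite mulN1r addrC.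
Qed.

Lemma form_sqrD u v : D u -> D v ->
  a (fun x => u x + v x) (fun x => u x + v x) = a u u + 2 * a u v + a v v.
Proof.
move=> Du Dv; have Duv := df_add Du Dv; rewrite (form_addl Du Dv Duv).
rewrite (df_sym aD Du Duv) (df_sym aD Dv Duv) (form_addl Du Dv Du) (form_addl Du Dv Dv).
rewrite (df_sym aD Dv Du); ring.
Qed.

Lemma form_sqrB u v : D u -> D v ->
  a (fun x => u x - v x) (fun x => u x - v x) = a u u - 2 * a u v + a v v.
Proof.
move=> Du Dv; have Duv := df_sub Du Dv; rewrite (form_subl Du Dv Duv).
rewrite (df_sym aD Du Duv) (df_sym aD Dv Duv) (form_subl Du Dv Du) (form_subl Du Dv Dv).
rewrite (df_sym aD Dv Du); ring.
Qed.

Definition jump_diff (u : E -> R) (z : E * E) : R := u z.2 - u z.1.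

Lemma measurable_jump_diff u : measurable_fun setT u ->
  measurable_fun setT (jump_diff u).
Proof.
by move=> mu; apply: measurable_funB; apply: measurableT_comp.
Qed.

Definition energy (u : E -> R) : \bar R :=
  (\int[J]_(z in off) (jump_diff u z ^+ 2)%:E)%E.

Lemma form_Cc u : D u -> Cc u -> energy u = (2 * a u u)%:E.
Proof.
move=> Du [cu _].
have qu : quasi_continuous m D a u.
  move=> e e0; exists set0; split; first exact: open0.
  - apply: (@le_lt_trans _ _ 0%E); last by rewrite lte_fin.
    apply: ereal_inf_lbound; exists (cst 0).
      by split; [exact: (df_zero aD)|exact: aeW].
    rewrite /form1; congr (_%:E).
    have -> : a (cst 0) (cst 0) = 0.
      have D0 := df_zero aD; have := form_addl D0 D0 D0.
      rewrite (_ : (fun x => cst 0 x + cst 0 x) = cst 0); first lra.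
      by apply/funext => x /=; rewrite addr0.
    by rewrite add0r inner0l.
  - by rewrite setC0; apply/continuous_subspaceT.
have := jump_form aJ Du Du qu qu.
rewrite EFinM => ->; rewrite muleA -EFinM divff// mul1e.
by apply: eq_integral => z _; rewrite /jump_diff expr2.
Qed.

Lemma df_approx w (e : R) : D w -> 0 < e ->
  exists2 v, D v /\ Cc v & form1 m a (fun x => w x - v x) (fun x => w x - v x) < e.
Proof. by move=> Dw e0; have [v [Dv Cv] ?] := regular_domain aR Dw e0; exists v. Qed.

Let half n : 0 < (1 / 2 : R) ^+ n. Proof. by rewrite exprn_gt0// divr_gt0. Qed.

(** Extends half of the jump representation from [Cc] to functions of the domain that are not
    assumed quasi-continuous. The approximants are chosen with errors 2^-n, so that they converge
    almost everywhere, and Fatou's lemma for [J] applies by [jump_null]. *)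
Lemma energy_le w : D w -> (energy w <= (2 * a w w)%:E)%E.
Proof.
move=> Dw.
have [wn Hw] := choice (fun n => let: ex_intro2 v Dv Hv := df_approx Dw (half n) in
   ex_intro (fun v => (D v /\ Cc v) /\ form1 m a (fun x => w x - v x) (fun x => w x - v x) < (1 / 2) ^+ n) v (conj Dv Hv)).
pose en n x := w x - wn n x.
have Den n : D (en n) by apply: df_sub => //; case: (Hw n) => -[].
have Dwn n : D (wn n) by case: (Hw n) => -[].
have en2 n := df_L2 aD (Den n).
have mw := Lfun2_measurable (df_L2 aD Dw).
have mwn n := Lfun2_measurable (df_L2 aD (Dwn n)).
have ae_le n : a (en n) (en n) <= (1 / 2) ^+ n.
  have [_] := Hw n; rewrite /form1 => /ltW; apply: le_trans.
  by rewrite lerDl inner_ge0.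
have ie_le n : inner m (en n) (en n) <= (1 / 2) ^+ n.
  have [_] := Hw n; rewrite /form1 => /ltW; apply: le_trans.
  by rewrite lerDr; exact: (df_ge0 aD (Den n)).
have : {ae m, forall x, en n x ^+ 2 @[n --> \oo] --> (0 : R)}.
  apply: ae_cvg0_of_summable => n.
  - by apply: measurable_funX; exact: Lfun2_measurable (en2 n).
  - by move=> x; exact: sqr_ge0.
  - by rewrite -EFin_inner_sqr// lee_fin.
move=> [Z [mZ Z0 HZ]].
have cw x : ~ Z x -> wn n x @[n --> \oo] --> w x.
  move=> Zx; have : en n x ^+ 2 @[n --> \oo] --> (0 : R).
    by apply: contrapT => h; apply: Zx; exact: HZ.
  move=> ex; have h : Num.sqrt (en n x ^+ 2) @[n --> \oo] --> Num.sqrt (0 : R).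
    by apply: continuous_cvg => //; exact: sqrt_continuous.
  apply/cvgrPdist_lt => e e0; move/cvgrPdist_lt : h => /(_ _ e0).
  apply: filterS => n; rewrite sqrtr0 sub0r normrN sqrtr_sqr normr_id.
  by rewrite /en.
(* Positivity of the form at e w + en gives - 2 a(w, en) <= e a(w, w) + a(en, en) / e, which bounds
   the form of the approximants w - en. *)
have am (e : R) : 0 < e -> (energy w <= (2 * ((1 + e) * a w w))%:E)%E.
  move=> e0.
  apply: (@fatou_le _ _ _ J off (off `&` [set z | Z z.1 \/ Z z.2])
    (fun n z => (jump_diff (wn n) z ^+ 2)%:E) _
    (fun n => 2 * ((1 + e) * a w w + (1 + e^-1) * (1 / 2) ^+ n))) => //.
  - have -> : off `&` [set z | Z z.1 \/ Z z.2] = off `&` ((Z `*` setT) `|` (setT `*` Z)).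
      by congr (_ `&` _); apply/seteqP; split => z /=; tauto.
    by apply: measurableI => //; apply: measurableU; exact: measurableX.
  - exact: jump_null.
  - move=> n; apply: measurable_funTS; apply/measurable_EFinP/measurable_funX.
    exact: measurable_jump_diff.
  - by move=> n z; rewrite lee_fin sqr_ge0.
  - apply: measurable_funTS; apply/measurable_EFinP/measurable_funX.
    exact: measurable_jump_diff.
  - by move=> z; rewrite lee_fin sqr_ge0.
  - move=> z oz nz.
    have Z1 : ~ Z z.1 by move=> ?; apply: nz; split => //; left.
    have Z2 : ~ Z z.2 by move=> ?; apply: nz; split => //; right.
    have c : (jump_diff (wn n) z ^+ 2)%:E @[n --> \oo] --> (jump_diff w z ^+ 2)%:E.
      apply: cvg_EFin; first exact: nearW.
      have c1 : jump_diff (wn n) z @[n --> \oo] --> jump_diff w z by exact: (cvgB (cw _ Z2) (cw _ Z1)).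
      exact: (cvgM c1 c1).
    by have [<- _] := cvg_limn_einf_sup c.
  - move=> n; have [[_ Cn] _] := Hw n; rewrite -/(energy (wn n)) form_Cc// lee_fin ler_pM2l//.
    have -> : wn n = fun x => w x - en n x by apply/funext => x; rewrite /en; ring.
    rewrite form_sqrB//.
    have Dk : D (fun x => e * w x + en n x) by exact: (df_lin aD).
    have k0 := df_ge0 aD Dk.
    move: k0; rewrite (df_bilin aD)// (df_sym aD Dw Dk) (df_sym aD (Den n) Dk) !(df_bilin aD)//.
    rewrite (df_sym aD (Den n) Dw) => k0.
    have := ae_le n; move: (a w w) (a w (en n)) (a (en n) (en n)) k0 => A B C k0 Ch.
    have : - (2 * B) <= e * A + e^-1 * C.
      rewrite -(ler_pM2l e0) mulrDr mulrA mulrA divff ?gt_eqF// mul1r; move: k0; lra.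
    have : e^-1 * C <= e^-1 * (1 / 2) ^+ n by rewrite ler_pM2l ?invr_gt0.
    lra.
  - have c0 : (1 + e^-1) * (1 / 2) ^+ n @[n --> \oo] --> (1 + e^-1) * 0.
      apply: cvg_mulrl.
      by apply: cvg_expr; rewrite ger0_norm ?divr_ge0// ltr_pdivrMr// mul1r ltr1n.
    rewrite -[X in _ --> X](_ : 2 * ((1 + e) * a w w + (1 + e^-1) * 0) = _).
      exact: (cvg_mulrl 2 (cvgD (cvg_cst _) c0)).
    by rewrite mulr0 addr0.
apply/lee_addgt0Pr => e e0.
have a0 := df_ge0 aD Dw.
have := am (e / (2 * (a w w + 1))); rewrite divr_gt0 ?mulr_gt0 ?ltr_wpDl// => /(_ isT).
move=> h; apply: (le_trans h); rewrite -EFinD lee_fin.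
have -> : 2 * ((1 + e / (2 * (a w w + 1))) * a w w) = 2 * a w w + e * (a w w / (a w w + 1)).
  by field; rewrite !gt_eqF// ?ltr_wpDl.
rewrite lerD2l; apply: ler_piMr; first exact: ltW.
by rewrite ler_pdivrMr ?ltr_wpDl// mul1r lerDl ler01.
Qed.

Let mdiff2 w : D w -> measurable_fun off (fun z => (jump_diff w z ^+ 2)%:E).
Proof.
move=> Dw; apply: measurable_funTS; apply/measurable_EFinP/measurable_funX.
by apply: measurable_jump_diff; exact: Lfun2_measurable (df_L2 aD Dw).
Qed.

Lemma energy_parallelogram u v : D u -> D v ->
  (energy (fun x => u x + v x)%R + energy (fun x => u x - v x)%R =
   2%:E * energy u + 2%:E * energy v)%E.
Proof.
move=> Du Dv; have mD w : D w -> measurable_fun off (fun z => (jump_diff w z ^+ 2)%:E) := @mdiff2 w.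
have g0 w z : (0 <= (jump_diff w z ^+ 2)%:E)%E by rewrite lee_fin sqr_ge0.
rewrite /energy -!ge0_integralZl//; [|exact: mD|exact: mD].
rewrite -!ge0_integralD//; last 6 first.
- by move=> z _; rewrite mule_ge0.
- by apply: measurable_funeM; exact: mD.
- by move=> z _; rewrite mule_ge0.
- by apply: measurable_funeM; exact: mD.
- by apply: mD; exact: df_add.
- by apply: mD; exact: df_sub.
apply: eq_integral => z _; rewrite -!EFinM -!EFinD; congr (_%:E).
rewrite /jump_diff; ring.
Qed.

(* [e w = 2 a w w - energy w] is nonnegative, satisfies the parallelogram law
   and vanishes on a dense set of functions. *)
Lemma energyE w : D w -> energy w = (2 * a w w)%:E.
Proof.
move=> Dw; have fin u : D u -> energy u \is a fin_num.
  move=> Du; rewrite ge0_fin_numE; last first.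
    by apply: integral_ge0 => z _; rewrite lee_fin sqr_ge0.
  by rewrite (le_lt_trans (energy_le Du))// ltry.
pose T u := fine (energy u).
have ET u : D u -> energy u = (T u)%:E by move=> Du; rewrite fineK// fin.
have Tle u : D u -> T u <= 2 * a u u.
  by move=> Du; rewrite -lee_fin -ET//; exact: energy_le.
rewrite ET//; congr (_%:E); apply/eqP; rewrite eq_le Tle//=.
apply/ler_addgt0Pr => e e0.
(* For r = w - v with v in [Cc], the two parallelogram laws, T v = 2 a(v, v), T (v - r) <= 2 a(v -
   r, v - r) and T r >= 0 give T w >= 2 a(w, w) - 4 a(r, r). *)
have e40 : 0 < e / 4 by rewrite divr_gt0.
have [v [Dv Cv] Hv] := df_approx Dw e40.
pose r x := w x - v x.
have Dr : D r by exact: df_sub.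
have ar : a r r <= e / 4.
  by move: Hv; rewrite /form1 => /ltW; apply: le_trans; rewrite lerDl inner_ge0.
have Tv : T v = 2 * a v v by rewrite /T form_Cc.
have := energy_parallelogram Dv Dr.
have Dp := df_add Dv Dr; have Dm := df_sub Dv Dr.
rewrite (ET _ Dp) (ET _ Dm) (ET _ Dv) (ET _ Dr) -!EFinM -!EFinD => -[].
have wE : (fun x => v x + r x) = w by apply/funext => x; rewrite /r; ring.
have ap := form_sqrD Dv Dr; have am := form_sqrB Dv Dr.
have := Tle _ Dm; rewrite wE in ap *.
have T0 : 0 <= T r by apply: fine_ge0; apply: integral_ge0 => z _; rewrite lee_fin sqr_ge0.
move: ap am; lra.
Qed.

Lemma jump_diff_integrable u v : D u -> D v ->
  J.-integrable off (fun z => (jump_diff u z * jump_diff v z)%:E).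
Proof.
move=> Du Dv.
have i2 w : D w -> J.-integrable off (fun z => (jump_diff w z ^+ 2)%:E).
  move=> Dw; apply/integrableP; split; first exact: mdiff2.
  rewrite (eq_integral (fun z => (jump_diff w z ^+ 2)%:E)); last first.
    by move=> z _; rewrite gee0_abs// lee_fin sqr_ge0.
  by rewrite -/(energy w) energyE// ltry.
have := integrableD moff (i2 _ Du) (i2 _ Dv); apply: le_integrable => //.
  apply: measurable_funTS; apply/measurable_EFinP/measurable_funM;
    by apply: measurable_jump_diff; apply: Lfun2_measurable; exact: (df_L2 aD).
move=> z _; rewrite -EFinD !abse_EFin.
rewrite /= lee_fin [leRHS]ger0_norm ?addr_ge0 ?sqr_ge0// normrM.
rewrite -(real_normK (num_real (jump_diff u z))) -(real_normK (num_real (jump_diff v z))).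
have := sqr_ge0 (`|jump_diff u z| - `|jump_diff v z|).
have : 0 <= `|jump_diff u z| * `|jump_diff v z| by rewrite mulr_ge0.
move: (`|jump_diff u z|) (`|jump_diff v z|) => A B; nra.
Qed.

Lemma formE u v : D u -> D v ->
  2 * a u v = (\int[J]_(z in off) (jump_diff u z * jump_diff v z))%R.
Proof.
move=> Du Dv; have Dp := df_add Du Dv.
have iu := jump_diff_integrable Du Du; have iv := jump_diff_integrable Dv Dv.
have iuv := jump_diff_integrable Du Dv.
have En w : D w -> (\int[J]_(z in off) (jump_diff w z * jump_diff w z))%R = 2 * a w w.
  move=> Dw.
  have E1 : (\int[J]_(z in off) (jump_diff w z * jump_diff w z)%:E = energy w)%E.
    by apply: eq_integral => z _; rewrite expr2.
  by rewrite /Rintegral E1 energyE.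
have := En _ Dp; rewrite (form_sqrD Du Dv).
have -> : (\int[J]_(z in off) (jump_diff (fun x => u x + v x) z * jump_diff (fun x => u x + v x) z))%R =
   (\int[J]_(z in off) ((jump_diff u z * jump_diff u z + 2 * (jump_diff u z * jump_diff v z))
     + jump_diff v z * jump_diff v z))%R.
  by apply: eq_Rintegral => z _; rewrite /jump_diff; ring.
have i2 := integrableZl moff 2 iuv.
rewrite RintegralD//; last exact: (integrableD moff iu i2).
rewrite RintegralD// RintegralZl// En// En//; lra.
Qed.

(* By symmetry of [J], the left-hand side is the integral of
   [(u y - u x)^2 v x]. *)
Lemma gamma_form u v : D u -> D v -> D (fun x => u x ^+ 2) ->
  D (fun x => u x * v x) -> (forall x, 0 <= v x) ->
  ((2 * a u (fun x => u x * v x) - a v (fun x => u x ^+ 2))%:E =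
   \int[m]_x ((v x)%:E * (2%:E * carre_du_champ N u x)))%E.
Proof.
move=> Du Dv Du2 Duv v0.
have mu := Lfun2_measurable (df_L2 aD Du).
have mv := Lfun2_measurable (df_L2 aD Dv).
have i1 := jump_diff_integrable Du Duv; have i2 := jump_diff_integrable Dv Du2.
pose g (z : E * E) := (jump_diff u z ^+ 2 * v z.1)%R.
pose g' (z : E * E) := (jump_diff u z ^+ 2 * v z.2)%R.
have mg : measurable_fun setT g.
  apply: measurable_funM; last by apply: measurableT_comp.
  by apply: measurable_funX; exact: measurable_jump_diff.
have mg' : measurable_fun setT g'.
  apply: measurable_funM; last by apply: measurableT_comp.
  by apply: measurable_funX; exact: measurable_jump_diff.
have g0 z : 0 <= g z by rewrite mulr_ge0 ?sqr_ge0.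
have g'0 z : 0 <= g' z by rewrite mulr_ge0 ?sqr_ge0.
have LE : ((2 * a u (fun x => u x * v x) - a v (fun x => u x ^+ 2))%:E =
    (2^-1)%:E * \int[J]_(z in off) ((g z)%:E + (g' z)%:E))%E.
  have -> : 2 * a u (fun x => u x * v x) - a v (fun x => u x ^+ 2) =
     2^-1 * (2 * (2 * a u (fun x => u x * v x)) - 2 * a v (fun x => u x ^+ 2)) by field.
  rewrite (formE Du Duv) (formE Dv Du2) EFinM; congr (_ * _)%E.
  have i11 := integrableZl moff 2 i1.
  rewrite -RintegralZl// -RintegralB//.
  rewrite fineK; last by apply: integrable_fin_num => //; exact: (integrableB moff i11 i2).
  (* The identity behind Gamma: 2 (u' - u) (u' v' - u v) - (v' - v) (u'^2 - u^2) = (u' - u)^2 (v +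
     v'), with primes for values at y. *)
  by apply: eq_integral => z _; rewrite -EFinD /g /g' /jump_diff; congr (_%:E); ring.
have swap : (\int[J]_(z in off) (g' z)%:E = \int[J]_(z in off) (g z)%:E)%E.
  have msw : measurable_fun setT (fun z : E * E => (z.2, z.1)) by exact: measurable_swap.
  have offE : off = (fun z : E * E => (z.2, z.1)) @^-1` off.
    by apply/seteqP; split => z /=; exact/nesym.
  have mge' : measurable_fun off (EFin \o g).
    by apply: measurable_funTS; exact/measurable_EFinP.
  have := @ge0_integral_pushforward _ _ _ _ _ _ msw J off (EFin \o g) moff mge'
    (fun z _ => g0 z).
  rewrite -offE => pf.
  transitivity (\int[J]_(z in off) ((EFin \o g) \o (fun z : E * E => (z.2, z.1))) z)%E.
    by apply: eq_integral => z _; rewrite /g /g' /jump_diff/=; congr (_%:E); ring.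
  rewrite -pf; apply: eq_measure_integral => A mA Ao; exact: (jump_sym aJ).
have mge : measurable_fun setT (EFin \o g) by exact/measurable_EFinP.
rewrite LE ge0_integralD//; last 4 first.
- by move=> z _; rewrite lee_fin.
- exact: measurable_funTS.
- by move=> z _; rewrite lee_fin.
- by apply: measurable_funTS; exact/measurable_EFinP.
rewrite swap -[X in (_ * (X + X))%E]mul1e -ge0_muleDl// muleA -EFinD -EFinM.
have -> : (2^-1 * (1 + 1) = 1 :> R)%R by field.
rewrite mul1e.
rewrite -(ge0_integral_mrestr J moff)//.
have mC (x : E) : measurable [set~ x] by exact: measurableC.
(* [J] and [N x] are meaningful off the diagonal only, so both are restricted before
   disintegrating. *)
pose l x := mrestr (N x) (mC x).
have xoff (C : set (E * E)) x : xsection C x `&` [set~ x] = xsection (C `&` off) x.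
  apply/seteqP; split => y; rewrite /xsection/= !inE/=; first by move=> [? /nesym].
  by move=> [? /nesym].
rewrite (@ge0_integral_disintegration _ _ _ _ _ m (mrestr J moff) l)//.
- apply: eq_integral => x _; rewrite ge0_integral_mrestr//; last 2 first.
  + by move=> y; rewrite lee_fin.
  + exact: (measurable_fun_pair2 x mge).
  rewrite /carre_du_champ (muleA 2%:E) -EFinM divff// mul1e.
  rewrite -ge0_integralZl//.
  + by apply: eq_integral => y _; rewrite -EFinM mulrC.
  + apply: measurable_funTS; apply/measurable_EFinP/measurable_funX.
    exact: measurable_funB.
  + by move=> y _; rewrite lee_fin sqr_ge0.
  + by rewrite lee_fin.
- move=> C mC'; under eq_fun do rewrite /l /= /mrestr xoff.
  by apply: (jump_section aJ); [exact: measurableI|exact: subIsetr].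
- move=> C mC'; rewrite /= /mrestr (jump_kernel aJ)//; [|exact: measurableI].
  by apply: eq_integral => x _; rewrite /l /= /mrestr xoff.
Qed.

End jump_form.

(** * Joint measurability of Gamma off a null set *)

Section jump_kernel_measurability.
Import HBNNSimple.
Context d (R : realType) (E : borelMetricType d R) (m : {measure set E -> \bar R}).
Variables (D : set (E -> R)) (a : (E -> R) -> (E -> R) -> R).
Variables (J : {measure set (E * E) -> \bar R}) (N : R.-ker E ~> E).
Hypothesis aJ : pure_jump m D a J N.
Hypothesis mset1 : forall x : E, measurable [set x].
Local Notation off := (@offdiag d R E).
Variable C : (set (E * E))^nat.
Hypotheses (mC : forall n, measurable (C n)) (C_off : \bigcup_n C n = off).
Hypothesis JC : forall n, (J (C n) < +oo)%E.

Let C' := seqDU C.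

Let mC' n : measurable (C' n). Proof. exact: seqDU_measurable. Qed.

Let C'off n : C' n `<=` off.
Proof.
rewrite -C_off => z; have : (\bigcup_n C' n) z -> (\bigcup_n C n) z.
  by rewrite -seqDU_bigcup_eq.
by move=> H Hz; apply: H; exists n.
Qed.

Let mass n x : \bar R := N x (xsection (C' n) x).

Let mmass n : measurable_fun setT (mass n).
Proof. exact: (jump_section aJ). Qed.

(* [N] is not assumed to be s-finite, so that integrals against it need not be
   measurable; they are off this [m]-null set. *)
Definition infinite_mass : set E := \bigcup_n [set x | mass n x = +oo%E].
Local Notation Z := infinite_mass.

Lemma measurable_infinite_mass : measurable Z.
Proof.
apply: bigcupT_measurable => n; rewrite -[X in measurable X]setTI.
exact: (mmass n measurableT (emeasurable_set1 +oo%E)).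
Qed.
Local Notation mZ := measurable_infinite_mass.

Lemma infinite_mass_null : m Z = 0%E.
Proof.
apply/negligibleP; first exact: mZ.
apply: negligible_bigcup => n.
have im : m.-integrable setT (mass n).
  apply/integrableP; split => //.
  under eq_integral do rewrite gee0_abs//.
  rewrite -(jump_kernel aJ)//; apply: le_lt_trans (JC n).
  by apply: le_measure; rewrite ?inE//; exact: subset_seqDU.
have := integrable_ae measurableT im; apply: negligibleS => x /= Hx.
by move=> /(_ Logic.I); rewrite Hx.
Qed.

Let Sn n x := xsection (C' n `&` (~` Z `*` setT)) x.
Let S x := xsection (off `&` (~` Z `*` setT)) x.

Let mZT : measurable (~` Z `*` [set: E]).
Proof. by apply: measurableX => //; apply: measurableC; exact: mZ. Qed.

Let moff : measurable off.
Proof. by rewrite -C_off; exact: bigcupT_measurable. Qed.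

Let mSn n x : measurable (Sn n x).
Proof. by apply: measurable_xsection; exact: measurableI. Qed.

Let mS x : measurable (S x).
Proof. by apply: measurable_xsection; exact: measurableI. Qed.

(** Measurability of sections requires a finite kernel. Restricted to [C' n] and switched off on
    [Z], the kernel has finite mass at every point; summing over the disjoint pieces then recovers
    [N] off [Z]. *)
Let measurable_piece n (A : set ((R * E) * E)) : measurable A ->
  measurable_fun setT (fun z : R * E => N z.2 (xsection A z `&` Sn n z.2)).
Proof.
move=> mA.
pose k (z : R * E) : {measure set E -> \bar R} := mrestr (N z.2) (mSn n z.2).
have mk U : measurable U -> measurable_fun setT (k ^~ U).
  move=> mU.
  have mD : measurable (C' n `&` (~` Z `*` U)).
    by apply: measurableI => //; apply: measurableX => //; apply: measurableC; exact: mZ.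
  have mks := jump_section aJ mD (subset_trans (@subIsetl _ _ _) (@C'off n)).
  have -> : k ^~ U = (fun x => N x (xsection (C' n `&` (~` Z `*` U)) x)) \o snd.
    apply/funext => z /=; rewrite /k /= /mrestr; congr (N z.2 _).
    by apply/seteqP; split => y; rewrite /Sn /xsection/= !inE/=; tauto.
  exact: (measurableT_comp mks measurable_snd).
pose K : R.-ker _ ~> _ := HB.pack k (isKernel.Build _ _ _ _ _ k mk).
have Kub z : exists M, forall X, measurable X -> (mrestr (K z) measurableT X < M%:E)%E.
  have kfin : (k z setT < +oo)%E.
    rewrite /k /= /mrestr setTI; have [Zz|nZz] := pselect (Z z.2).
      rewrite (_ : Sn _ _ = set0) ?measure0//.
      by rewrite -subset0 => y; rewrite /Sn /xsection/= inE => -[_ [/=]].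
    rewrite (@le_lt_trans _ _ (mass n z.2))//.
      apply: le_measure; rewrite ?inE//; first exact: measurable_xsection.
      by move=> y; rewrite /Sn /xsection/= !inE => -[].
    rewrite ltey; apply/eqP => h; apply: nZz; by exists n.
  exists (fine (k z setT) + 1) => X mX.
  rewrite EFinD fineK ?ge0_fin_numE// (@le_lt_trans _ _ (k z setT))//.
    by rewrite /mrestr setIT; apply: le_measure; rewrite ?inE.
  by rewrite lteDl ?lte01// ge0_fin_numE.
have [_ mphi] := measurable_prod_subset_xsection_kernel Kub mA.
have -> // : (fun z : R * E => N z.2 (xsection A z `&` Sn n z.2)) =
    fun z => mrestr (K z) measurableT (xsection A z).
by apply/funext => z; rewrite /mrestr setIT.
Qed.

Let measurable_section (A : set ((R * E) * E)) : measurable A ->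
  measurable_fun setT (fun z : R * E => N z.2 (xsection A z `&` S z.2)).
Proof.
move=> mA.
have -> : (fun z : R * E => N z.2 (xsection A z `&` S z.2)) =
    (fun z => \sum_(n <oo) N z.2 (xsection A z `&` Sn n z.2))%E.
  apply/funext => z; have mAz : measurable (xsection A z) by exact: measurable_xsection.
  rewrite -measure_semi_bigcup.
  - congr (N z.2 _); rewrite -setI_bigcupr; congr (_ `&` _).
    rewrite /S -C_off (seqDU_bigcup_eq C); apply/seteqP; split => y.
      rewrite /xsection/= inE => -[[n _ Cn] Zz].
      by exists n => //; rewrite /Sn /xsection/= inE.
    move=> [n _]; rewrite /Sn /xsection/= !inE => -[Cn Zz]; split => //.
    by exists n.
  - by move=> n; exact: measurableI.
  - apply/trivIsetP => i j _ _ ij; rewrite -subset0 => y [[_ h1] [_ h2]].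
    have /trivIsetP := @trivIset_seqDU _ C => /(_ i j Logic.I Logic.I ij).
    rewrite -subset0 => /(_ (z.2, y)); apply.
    by move: h1 h2; rewrite /Sn /xsection/= !inE => -[? _] [? _].
  - by apply: bigcupT_measurable => n; exact: measurableI.
by apply: ge0_emeasurable_sum => // n _; exact: measurable_piece.
Qed.

(** The function varies with a real parameter because it will be (t, x) -> P_t f (x), integrated in
    t. *)
Lemma measurable_carre_joint (u : R * E -> R) : measurable_fun setT u ->
  measurable_fun setT (fun z : R * E =>
    ((carre_du_champ N (fun y => u (z.1, y))) \_ (~` Z)) z.2).
Proof.
move=> mu.
pose l (z : R * E) := mrestr (N z.2) (mS z.2).
pose k (w : (R * E) * E) := ((u (w.1.1, w.2) - u w.1) ^+ 2)%:E.
have mk : measurable_fun setT k.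
  apply/measurable_EFinP/measurable_funX/measurable_funB.
    apply: measurableT_comp => //; apply: measurable_fun_pair => //.
    by apply: measurableT_comp => //; exact: measurable_fst.
  by apply: measurableT_comp => //; exact: measurable_fst.
have k0 w : (0 <= k w)%E by rewrite lee_fin sqr_ge0.
have -> : (fun z : R * E => ((carre_du_champ N (fun y => u (z.1, y))) \_ (~` Z)) z.2)
    = (fun z => (2^-1)%:E * \int[l z]_y k (z, y))%E.
  apply/funext => z; have mkz := measurable_fun_pair2 z mk.
  rewrite /l ge0_integral_mrestr//.
  rewrite patchE; case: ifPn.
    rewrite inE => nZz; rewrite /carre_du_champ; congr (_ * _)%E.
    have -> : S z.2 = [set~ z.2].
      apply/seteqP; split => y; rewrite /S /xsection/= inE/=.
        by move=> [/nesym].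
      by move=> /nesym ?.
    by apply: eq_integral => y _; rewrite /k/= -surjective_pairing.
  rewrite notin_setE => /contrapT Zz.
  have -> : S z.2 = set0.
    by rewrite -subset0 => y; rewrite /S /xsection/= inE => -[_ [/=]].
  by rewrite integral_set0 mule0.
apply: measurable_funeM.
pose k_ := nnsfun_approx measurableT mk.
apply: (@measurable_fun_xsection_integral _ _ _ _ _ k l k_).
- by move=> i j ij; exact/nd_nnsfun_approx.
- by move=> w; exact: cvg_nnsfun_approx.
- by move=> n r; exact: measurable_section.
Qed.

End jump_kernel_measurability.

(** * The Bellman function along the semigroup *)

Section bellman_semigroup.
Local Opaque Pr inner.
Context d (R : realType) (E : borelMetricType d R) (m : {measure set E -> \bar R}).
Hypothesis sf : sigma_finite setT m.
Variable p : R -> E -> {measure set E -> \bar R}.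
Hypothesis H : markov_semigroup m p.
Variables (M c : R) (B : R -> R -> \bar R).
Hypotheses (c0 : 0 < c) (HB : bellman M c B).

Lemma measurable_bellman d' (T : measurableType d') (u v : T -> R) :
  measurable_fun setT u -> measurable_fun setT v ->
  measurable_fun setT (fun x => B (u x) (v x)).
Proof.
move=> mu mv; have muv : measurable_fun setT (fun x => (u x, v x)).
  exact: measurable_fun_pair.
exact: (measurableT_comp (bellman_measurable HB) muv).
Qed.

Definition variance (h : R) (u : E -> R) (x : E) : R :=
  Pr p h (fun y => u y ^+ 2) x - Pr p h u x ^+ 2.

Lemma variance_ge0 h u x : bmf u -> 0 <= variance h u x.
Proof. by move=> bu; rewrite subr_ge0; exact: (Pr_sqr H). Qed.

(** Integrate against [p h x] the affine minorant that almost touches B at (P_h u (x), P_h v (x)).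
    It involves P_h (u^2) in place of (P_h u)^2, and the discrepancy is the variance times a slope
    of at least c P_h v. *)
Lemma bellman_step h u v x : bmf u -> bmf v -> (forall y, 0 <= v y <= M) ->
  (B (Pr p h u x) (Pr p h v x) + (c * (Pr p h v x * variance h u x))%:E <=
    Pe p h (fun y => B (u y) (v y)) x)%E.
Proof.
move=> bu bv vM.
have v0 y : 0 <= v y by have /andP[] := vM y.
have B0 y : (0 <= B (u y) (v y))%E by exact: (bellman_ge0 HB).
have mBuv : measurable_fun setT (fun y => B (u y) (v y)).
  by apply: measurable_bellman; [case: bu|case: bv].
have Pv0 : 0 <= Pr p h v x by exact: Pr_ge0.
have PvM : Pr p h v x <= M.
  have M0 : 0 <= M by have /andP[] := vM x; exact: le_trans.
  have := Pr_bound H h x bv.1 (M := M); rewrite ger0_norm//; apply => y.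
  by rewrite ger0_norm//; have /andP[] := vM y.
have V0 := variance_ge0 h x bu.
apply/lee_addgt0Pr => e e0.
have hyp : 0 <= Pr p h v x <= M by rewrite Pv0.
have [al [be [de [[al0 be0 de0] cal Ble Bge]]]] := bellman_minorant HB (Pr p h u x) hyp e0.
have bu2 := bmfX bu.
have bL : bmf (fun y => al * u y ^+ 2 + be * v y).
  by apply: bmfD; apply: bmfZ.
have L0 y : 0 <= al * u y ^+ 2 + be * v y.
  by rewrite addr_ge0// mulr_ge0// sqr_ge0.
have key : ((al * Pr p h (fun y => u y ^+ 2) x + be * Pr p h v x)%:E <=
    Pe p h (fun y => B (u y) (v y)) x + de%:E)%E.
  rewrite -(PrZ H h x al bu2) -(PrZ H h x be bv) -(PrD H h x (bmfZ al bu2) (bmfZ be bv)).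
  rewrite (EFin_Pr H h x bL).
  apply: (@le_trans _ _ (Pe p h (fun y => B (u y) (v y) + de%:E)%E x)).
    apply: (le_Pe p) => //.
    - by apply/measurable_EFinP; case: bL.
    - exact: emeasurable_funD.
    - by move=> y /=; rewrite -leeBlDr// -EFinB; exact: Bge.
  rewrite /Pe ge0_integralD// leeD2l//.
  rewrite (_ : (fun _ => de%:E) = cst de%:E)// integral_cst//.
  by rewrite -[leRHS]mule1 lee_wpmul2l// (ms_le1 H).
have cV : c * (Pr p h v x * variance h u x) <= al * variance h u x.
  by rewrite mulrA ler_wpM2r.
have := leeD Ble (lexx (c * (Pr p h v x * variance h u x))%:E).
move=> /le_trans; apply.
rewrite -leeBlDr// -!EFinD.
apply: (@le_trans _ _ ((al * Pr p h (fun y => u y ^+ 2) x + be * Pr p h v x) - de)%:E).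
  rewrite lee_fin; move: cV; move: (c * (Pr p h v x * variance h u x)) => k.
  rewrite /variance; move: (Pr p h (fun y => u y ^+ 2) x) (Pr p h u x ^+ 2).
  move: (be * Pr p h v x) => bv' A X; lra.
by rewrite EFinB leeBlDr.
Qed.

Variables (f g : E -> R).
Hypotheses (bf : bL2 m f) (bg : bL2 m g) (gM : forall x, 0 <= g x <= M).

Let Phi (t : R) : \bar R := (\int[m]_x B (Pr p t f x) (Pr p t g x))%E.

Let PgM t x : 0 <= Pr p t g x <= M.
Proof.
have M0 : 0 <= M by have /andP[] := gM x; exact: le_trans.
have g0 : 0 <= Pr p t g x by apply: Pr_ge0 => y; have /andP[] := gM y.
rewrite g0/=; have := Pr_bound H t x bg.1.1 (M := M); rewrite ger0_norm//; apply => y.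
by have /andP[gy0] := gM y; rewrite ger0_norm.
Qed.

Let Phi0 t : (0 <= Phi t)%E.
Proof. by apply: integral_ge0 => x _; apply: (bellman_ge0 HB); have /andP[] := PgM t x. Qed.

Definition step_gain (h t : R) : R := h^-1 *
  inner m (Pr p h (Pr p t g)) (variance h (Pr p t f)).

Let bvar h t : 0 <= h -> 0 <= t -> bL2 m (variance h (Pr p t f)).
Proof.
move=> h0 t0; have bP := bL2_Pr H t0 bf; have bPh := bL2_Pr H h0 bP.
apply: bL2B; last exact: (bL2M bPh bPh).
by apply: (bL2_Pr H h0); exact: (bL2M bP bP).
Qed.

Lemma EFin_step_gain h t : 0 < h -> 0 <= t -> (h * step_gain h t)%:E =
  (\int[m]_x (Pr p h (Pr p t g) x * variance h (Pr p t f) x)%:E)%E.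
Proof.
move=> h0 t0; rewrite /step_gain mulrA divff ?gt_eqF// mul1r EFin_inner//.
- exact: (bL2_Pr H (ltW h0) (bL2_Pr H t0 bg)).2.
- exact: (bvar (ltW h0) t0).2.
Qed.

Lemma step_gain_ge0 h t : 0 < h -> 0 <= t -> 0 <= step_gain h t.
Proof.
move=> h0 t0; rewrite -(pmulr_rge0 _ h0) -lee_fin EFin_step_gain//.
apply: integral_ge0 => x _; rewrite lee_fin mulr_ge0//.
  by apply: Pr_ge0 => y; have /andP[] := PgM t y.
by apply: variance_ge0; exact: (bL2_Pr H t0 bf).1.
Qed.

Let Phi_step h t : 0 < h -> 0 <= t ->
  (Phi (t + h) + (c * (h * step_gain h t))%:E <= Phi t)%E.
Proof.
move=> h0 t0; have [bPf _] := bL2_Pr H t0 bf; have [bPg _] := bL2_Pr H t0 bg.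
have mV : measurable_fun setT (variance h (Pr p t f)) by case: (bvar (ltW h0) t0) => -[].
have mPg : measurable_fun setT (Pr p h (Pr p t g)) := (bmf_Pr H h bPg).1.
have V0 x : 0 <= variance h (Pr p t f) x by exact: variance_ge0.
have P0 x : 0 <= Pr p h (Pr p t g) x.
  by apply: Pr_ge0 => y; have /andP[] := PgM t y.
rewrite EFinM EFin_step_gain// -ge0_integralZl//; last 3 first.
- by apply/measurable_EFinP; exact: measurable_funM.
- by move=> x _; rewrite lee_fin mulr_ge0.
- by rewrite lee_fin ltW.
have mG : measurable_fun setT (fun x =>
    (c%:E * (Pr p h (Pr p t g) x * variance h (Pr p t f) x)%:E)%E).
  by apply: measurable_funeM; apply/measurable_EFinP; exact: (measurable_funM mPg mV).
have PhiE : Phi (t + h) = (\int[m]_x B (Pr p h (Pr p t f) x) (Pr p h (Pr p t g) x))%E.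
  apply: eq_integral => x _; rewrite addrC.
  by rewrite (Pr_add H _ t0 (ltW h0) bf.1) (Pr_add H _ t0 (ltW h0) bg.1).
have mPf : measurable_fun setT (Pr p h (Pr p t f)) := (bmf_Pr H h bPf).1.
rewrite PhiE -ge0_integralD//; last 3 first.
- by move=> x _; exact: (bellman_ge0 HB).
- exact: measurable_bellman.
- by move=> x _; rewrite -EFinM lee_fin !mulr_ge0// ltW.
have mBt : measurable_fun setT (fun x => B (Pr p t f x) (Pr p t g x)).
  by apply: measurable_bellman; [case: bPf|case: bPg].
have B0 x : (0 <= B (Pr p t f x) (Pr p t g x))%E.
  by apply: (bellman_ge0 HB); have /andP[] := PgM t x.
rewrite -[leRHS](integral_Pe H h0 B0 mBt).
apply: ge0_le_integral => //.
- move=> x _; rewrite adde_ge0//; first exact: (bellman_ge0 HB).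
  by rewrite -EFinM lee_fin !mulr_ge0// ltW.
- apply: emeasurable_funD; first exact: measurable_bellman.
  exact: mG.
- exact: (measurable_Pe H).
- move=> x _; rewrite -EFinM; exact: bellman_step.
Qed.

Let Phi_le t : 0 < t -> (Phi t <= Phi 0)%E.
Proof.
move=> t0; have := Phi_step t0 (lexx 0); rewrite add0r; apply: le_trans.
by rewrite leeDl// lee_fin (mulr_ge0 (ltW c0))// (mulr_ge0 (ltW t0))// step_gain_ge0.
Qed.

Let mPhi : measurable_fun setT Phi.
Proof.
apply: (@measurable_fun_integral_sigma_finite _ _ _ _ sf
  (fun z : R * E => B (Pr p z.1 f z.2) (Pr p z.1 g z.2))).
- by move=> z; apply: (bellman_ge0 HB); have /andP[] := PgM z.1 z.2.
- apply: measurable_bellman; apply: (measurable_Pr_time H).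
    by case: bf => -[].
  by case: bg => -[].
Qed.

(** This is h times [step_gain], kept in the extended reals: it makes sense and is measurable in t
    on the whole line, with no integrability to check. *)
Let gain_integral (h t : R) : \bar R :=
  (\int[m]_x (Pr p h (Pr p t g) x * variance h (Pr p t f) x)%:E)%E.

Let gain_integral_ge0 h t : (0 <= gain_integral h t)%E.
Proof.
apply: integral_ge0 => x _; rewrite lee_fin mulr_ge0//.
  by apply: Pr_ge0 => y; have /andP[] := PgM t y.
by apply: variance_ge0; exact: (bmf_Pr H t bf.1).
Qed.

Let measurable_gain_integral h : measurable_fun setT (gain_integral h).
Proof.
have mf1 := measurable_Pr_time H bf.1.1; have mg1 := measurable_Pr_time H bg.1.1.
have mc : measurable_fun setT (fun _ : R => h) by exact: measurable_cst.
have m1 := measurable_Pr_joint H mc mg1.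
have m2 := measurable_Pr_joint H mc (measurable_funX 2 mf1).
have m3 := measurable_Pr_joint H mc mf1.
apply: (@measurable_fun_integral_sigma_finite _ _ _ _ sf (fun z : R * E =>
  (Pr p h (Pr p z.1 g) z.2 * variance h (Pr p z.1 f) z.2)%:E)).
- move=> z; rewrite lee_fin mulr_ge0//.
    by apply: Pr_ge0 => y; have /andP[] := PgM z.1 y.
  by apply: variance_ge0; exact: (bmf_Pr H _ bf.1).
- apply/measurable_EFinP/measurable_funM; first exact: m1.
  by apply: measurable_funB; [exact: m2|apply: measurable_funX; exact: m3].
Qed.

Let step_gainE h t : 0 < h -> 0 <= t ->
  (step_gain h t)%:E = ((h^-1)%:E * gain_integral h t)%E.
Proof.
move=> h0 t0; rewrite -[gain_integral h t](EFin_step_gain h0 t0) -EFinM.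
by rewrite mulrA mulVf ?mul1r// gt_eqF.
Qed.

Lemma measurable_step_gain h (D : set R) : 0 < h -> measurable D ->
  D `<=` [set t | 0 <= t] ->
  measurable_fun D (fun t => (step_gain h t)%:E).
Proof.
move=> h0 mD D0; have mg : measurable_fun D (fun t => (h^-1)%:E * gain_integral h t)%E.
  by apply: measurable_funTS; exact: measurable_funeM.
apply: eq_measurable_fun mg => t /set_mem Dt.
by rewrite step_gainE//; exact: D0.
Qed.

(** A telescoping in the mean: integrating [Phi_step] over ]0, T], the integrals of Phi over ]0, T]
    and ]h, T + h] differ by at most that over ]0, h], hence by at most h Phi(0). Finiteness of
    Phi(0) allows the cancellation. *)
Lemma integral_step_gain_le (h T : R) : 0 < h -> 0 < T ->
  (c%:E * \int[lebesgue_measure]_(t in `]0%R, T]) (step_gain h t)%:E <=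
    \int[m]_x B (f x) (g x))%E.
Proof.
move=> h0 T0.
have P0f : Pr p 0 f = f by apply/funext => x; rewrite (Pr_0 H _ bf.1).
have P0g : Pr p 0 g = g by apply/funext => x; rewrite (Pr_0 H _ bg.1).
rewrite -[X in (_ <= \int[m]_x B (X x) _)%E]P0f -[X in (_ <= \int[m]_x B _ (X x))%E]P0g.
rewrite -/(Phi 0).
have [->|] := eqVneq (Phi 0) +oo%E; first exact: leey.
rewrite -ltey => Phi0fin.
have Phifin t : 0 <= t -> Phi t \is a fin_num.
  rewrite le_eqVlt => /predU1P[<-|t0]; first by rewrite ge0_fin_numE.
  by rewrite ge0_fin_numE// (le_lt_trans (Phi_le t0)).
have leb (b : R) : 0 < b -> lebesgue_measure (`]0, b]%classic : set (measurableTypeR R)) = b%:E.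
  by move=> b0; rewrite lebesgue_measure_itv/= lte_fin b0 oppr0 addr0.
have D0 : `]0, T]%classic `<=` [set t | 0 <= t].
  by move=> t /=; rewrite in_itv/= => /andP[/ltW].
have mD : measurable `]0, T]%classic by exact: measurable_itv.
have mPhiD (D : set R) : measurable_fun D Phi by exact: measurable_funTS.
have mPhih (D : set R) : measurable_fun D (fun t => Phi (t + h)).
  by apply: measurable_funTS; apply: measurableT_comp => //; exact: measurable_funD.
have msg := measurable_step_gain h0 mD D0.
pose G : \bar R := (\int[lebesgue_measure]_(t in `]0%R, T]) (step_gain h t)%:E)%E.
pose I1 : \bar R := (\int[lebesgue_measure]_(t in `]0%R, T]) Phi (t + h))%E.
pose I0 : \bar R := (\int[lebesgue_measure]_(t in `]0%R, T]) Phi t)%E.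
have G0 : (0 <= G)%E.
  by apply: integral_ge0 => t /D0 t0; rewrite lee_fin step_gain_ge0.
have le1 : (I1 + (c * h)%:E * G <= I0)%E.
  rewrite /I0 /I1 /G -ge0_integralZl//; last 2 first.
  - by move=> t /D0 t0; rewrite lee_fin step_gain_ge0.
  - by rewrite lee_fin mulr_ge0// ltW.
  rewrite -ge0_integralD//; last 3 first.
  - exact: mPhih.
  - move=> t /D0 t0; rewrite -EFinM lee_fin.
    by rewrite (mulr_ge0 (mulr_ge0 (ltW c0) (ltW h0)))// step_gain_ge0.
  - exact: measurable_funeM.
  apply: ge0_le_integral => //.
  - move=> t /D0 t0; rewrite adde_ge0// -EFinM lee_fin.
    by rewrite (mulr_ge0 (mulr_ge0 (ltW c0) (ltW h0)))// step_gain_ge0.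
  - apply: emeasurable_funD; first exact: mPhih.
    by apply: (measurable_funeM (c * h)%:E); exact: msg.
  - exact: mPhiD.
  - by move=> t /D0 t0; rewrite -EFinM -mulrA; exact: Phi_step.
have le2 : (I0 <= h%:E * Phi 0 + I1)%E.
  have sub : `]0%R, T]%classic `<=` `]0, h]%classic `|` `]h, T + h]%classic.
    move=> t /=; rewrite !in_itv/= => /andP[t0 tT].
    have [th|th] := leP t h; [left|right]; first by rewrite t0.
    by rewrite (le_trans tT)// lerDl ltW.
  pose A1 : set (measurableTypeR R) := `]0, h]%classic.
  pose A2 : set (measurableTypeR R) := `]h, T + h]%classic.
  have m1 : measurable A1 by exact: measurable_itv.
  have m2 : measurable A2 by exact: measurable_itv.
  have mU : measurable (A1 `|` A2) by exact: measurableU.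
  have dU : [disjoint A1 & A2].
    apply/disj_setPS => t []; rewrite /A1 /A2/= !in_itv/= => /andP[_ th] /andP[ht _].
    by move: (lt_le_trans ht th); rewrite ltxx.
  have DU : (I0 <= \int[lebesgue_measure]_(t in A1 `|` A2) Phi t)%E.
    by apply: ge0_subset_integral => //; exact: mPhiD.
  have DE := @ge0_integral_setU _ _ _ lebesgue_measure A1 A2 m1 m2 Phi (mPhiD _)
    (fun t _ => Phi0 t) dU.
  rewrite DE in DU; apply: (le_trans DU).
  apply: leeD.
    apply: (@le_trans _ _ (\int[lebesgue_measure]_(t in `]0%R, h]) cst (Phi 0) t)%E).
      apply: ge0_le_integral => //; first exact: mPhiD.
      by move=> t; rewrite /A1/= in_itv/= => /andP[t0 _]; exact: Phi_le.
    rewrite (integral_cst lebesgue_measure m1) [X in (_ * X)%E](_ : _ = h%:E).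
      by rewrite muleC.
    exact: leb.
  by rewrite /I1 (ge0_integral_shift h 0 T mPhi Phi0) /A2 add0r.
have I1fin : I1 \is a fin_num.
  have I10 : (0 <= I1)%E by exact: integral_ge0.
  rewrite ge0_fin_numE//.
  apply: (@le_lt_trans _ _ (\int[lebesgue_measure]_(t in `]0%R, T]) cst (Phi 0) t)%E).
    apply: ge0_le_integral => //; first exact: mPhih.
    move=> t /D0 t0; apply: Phi_le.
    by rewrite (lt_le_trans h0)// lerDr.
  rewrite (integral_cst lebesgue_measure mD) [X in (_ * X)%E](_ : _ = T%:E).
    by apply: lte_mul_pinfty; rewrite ?ltry ?ge0_fin_numE.
  exact: leb.
have := le_trans le1 le2; rewrite addeC leeD2rE//.
rewrite mulrC EFinM -muleA lee_pmul2l//.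
Qed.

End bellman_semigroup.

Section bellman_energy.
Local Opaque Pr inner.
Context d (R : realType) (E : borelMetricType d R) (m : {measure set E -> \bar R}).
Hypothesis sf : sigma_finite setT m.
Variable p : R -> E -> {measure set E -> \bar R}.
Hypothesis H : markov_semigroup m p.
Variables (M c : R) (B : R -> R -> \bar R).
Hypotheses (c0 : 0 < c) (HB : bellman M c B).
Variables (f g : E -> R).
Hypotheses (bf : bL2 m f) (bg : bL2 m g) (gM : forall x, 0 <= g x <= M).

Local Notation D := (`]0%R, +oo[%classic : set (measurableTypeR R)).

Let D0 t : D t -> 0 < t. Proof. by rewrite /= in_itv/= andbT. Qed.

(** With h = 1 / (n+1) on the window ]0, n+1], a single use of Fatou's lemma takes both limits. [G]
    has only to be dominated by the limit of the gains, since it will be a measurable minorant of 2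
    Gamma[P_t f]. *)
Lemma integral_energy_le (G : R * E -> \bar R) :
  measurable_fun setT G -> (forall z, 0 <= G z)%E ->
  (forall t, 0 < t -> exists2 l : R,
    (\int[m]_x ((Pr p t g x)%:E * G (t, x)) <= l%:E)%E &
    step_gain m p f g h t @[h --> (0 : R)^'+] --> l) ->
  (c%:E * \int[lebesgue_measure]_(t in D) \int[m]_x ((Pr p t g x)%:E * G (t, x)) <=
    \int[m]_x B (f x) (g x))%E.
Proof.
move=> mG G0 Glim.
have Pg0 t x : 0 <= Pr p t g x by apply: Pr_ge0 => y; have /andP[] := gM y.
pose I t := (\int[m]_x ((Pr p t g x)%:E * G (t, x)))%E.
have I0 t : (0 <= I t)%E.
  by apply: integral_ge0 => x _; rewrite mule_ge0// lee_fin.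
have mI : measurable_fun (setT : set (measurableTypeR R)) I.
  apply: (@measurable_fun_integral_sigma_finite _ _ _ _ sf
    (fun z : R * E => ((Pr p z.1 g z.2)%:E * G z)%E)).
    by move=> z; rewrite mule_ge0// lee_fin.
  apply: emeasurable_funM => //; apply/measurable_EFinP.
  exact: (measurable_Pr_time H bg.1.1).
have mID : measurable_fun D I by exact: measurable_funTS.
have mD : measurable D by exact: measurable_itv.
rewrite -[X in (X <= _)%E]ge0_integralZl//; last 2 first.
- by move=> t _; exact: I0.
- by rewrite lee_fin ltW.
have [->|] := eqVneq (\int[m]_x B (f x) (g x))%E +oo%E; first exact: leey.
rewrite -ltey => Bfin.
have B0 : (0 <= \int[m]_x B (f x) (g x))%E.
  by apply: integral_ge0 => x _; apply: (bellman_ge0 HB); have /andP[] := gM x.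
have Bn : (\int[m]_x B (f x) (g x))%E \is a fin_num by rewrite ge0_fin_numE.
rewrite -(fineK Bn); set L := fine _.
pose h n : R := n.+1%:R^-1.
have h0 n : 0 < h n by rewrite invr_gt0.
pose K n : set (measurableTypeR R) := `]0, n.+1%:R]%classic.
have mK n : measurable (K n) by exact: measurable_itv.
have KD n : K n `<=` D.
  by move=> t; rewrite /K /= !in_itv/= andbT => /andP[].
pose F n : measurableTypeR R -> \bar R :=
  ((fun t => c%:E * (step_gain m p f g (h n) t)%:E)%E) \_ (K n).
have mg n : measurable_fun (K n) (fun t => (step_gain m p f g (h n) t)%:E).
  apply: (measurable_step_gain sf H bf bg gM (h0 n) (mK n)).
  by move=> t /KD /D0 /ltW.
have sg0 n t : K n t -> (0 <= (step_gain m p f g (h n) t)%:E)%E.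
  move=> /KD /D0 t0; rewrite lee_fin; exact: (step_gain_ge0 H bf bg gM (h0 n) (ltW t0)).
have F0 n t : (0 <= F n t)%E.
  apply: erestrict_ge0 => s Ks; apply: mule_ge0; first by rewrite lee_fin ltW.
  exact: sg0.
apply: (@fatou_le _ _ _ lebesgue_measure D set0 F (fun t => c%:E * I t)%E (cst L)) => //.
- move=> n; apply: measurable_funTS; apply/(measurable_restrictT _ (mK n)).
  exact: measurable_funeM.
- exact: measurable_funeM.
- by move=> t; rewrite mule_ge0// lee_fin ltW.
- move=> t /D0 t0 _; have [l lE lcvg] := Glim t t0.
  apply: (@le_trans _ _ (c * l)%:E).
    by rewrite EFinM; apply: lee_wpmul2l => //; rewrite lee_fin ltW.
  have cv : F ^~ t @ \oo --> (c * l)%:E.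
    apply: (@cvg_near_eq _ _ _ _ (fun n => (c * step_gain m p f g (h n) t)%:E)).
      near=> n; rewrite /F patchE ifT ?EFinM// inE /K /= in_itv/= t0/=.
      rewrite (le_trans (ltW (archi_boundP (ltW t0))))// ler_nat ltnW// ltnS.
      by near: n; exact: nbhs_infty_ge.
    apply: cvg_EFin; first exact: nearW.
    apply: cvg_mulrl; move/cvg_at_rightP : lcvg; apply; split; first exact: h0.
    exact: cvg_harmonic.
  by rewrite (cvg_limn_einf_sup cv).1.
- move=> n; rewrite /L fineK//.
  have nT : (0 : R) < n.+1%:R by [].
  have := integral_step_gain_le sf H c0 HB bf bg gM (h0 n) nT.
  apply: le_trans.
  rewrite /F -integral_mkcondr setIidr; last exact: KD.
  by rewrite (ge0_integralZl _ (mK n) (mg n) (sg0 n))// lee_fin ltW.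
- exact: cvg_cst.
Unshelve. all: by end_near. Qed.

End bellman_energy.

Section gamma_energy.
Local Opaque Pr inner.
Context d (R : realType) (E : borelMetricType d R) (m : {measure set E -> \bar R}).
Hypothesis sf : sigma_finite setT m.
Variables (D : set (E -> R)) (a : (E -> R) -> (E -> R) -> R).
Hypotheses (aD : dirichlet_form m D a) (aR : regular_form m D a).
Variables (J : {measure set (E * E) -> \bar R}) (N : R.-ker E ~> E).
Hypothesis aJ : pure_jump m D a J N.
Hypothesis mset1 : forall x : E, measurable [set x].
Variable C : (set (E * E))^nat.
Hypotheses (mC : forall n, measurable (C n)) (C_off : \bigcup_n C n = offdiag).
Hypothesis JC : forall n, (J (C n) < +oo)%E.
Variable p : R -> E -> {measure set E -> \bar R}.
Hypothesis H : markov_semigroup m p.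
Hypothesis D_cvg : forall u, bL2 m u ->
  (D u <-> cvg (approx m p h u u @[h --> (0 : R)^'+])).
Hypothesis a_lim : forall u v, D u -> D v ->
  approx m p h u v @[h --> (0 : R)^'+] --> a u v.

Local Notation Z := (infinite_mass N C).

(** Gamma[P_t u], set to 0 on [Z] to make it jointly measurable in (t, x). *)
Definition flow_gamma (u : E -> R) (t : R) (x : E) : \bar R :=
  ((carre_du_champ N (Pr p t u)) \_ (~` Z)) x.

Lemma carre_ge0 u x : (0 <= carre_du_champ N u x)%E.
Proof.
rewrite mule_ge0 ?lee_fin ?invr_ge0//.
by apply: integral_ge0 => y _; rewrite lee_fin sqr_ge0.
Qed.

Lemma flow_gamma_ge0 u t x : (0 <= flow_gamma u t x)%E.
Proof. by apply: erestrict_ge0 => y _; exact: carre_ge0. Qed.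

Lemma flow_gamma_le u t x : (flow_gamma u t x <= carre_du_champ N (Pr p t u) x)%E.
Proof. by rewrite /flow_gamma patchE; case: ifP => // _; exact: carre_ge0. Qed.

Lemma measurable_flow_gamma u : measurable_fun setT u ->
  measurable_fun setT (fun z : R * E => flow_gamma u z.1 z.2).
Proof.
move=> mu.
exact: (measurable_carre_joint aJ mC C_off (measurable_Pr_time H mu)).
Qed.

Variables (M c : R) (B : R -> R -> \bar R).
Hypotheses (c0 : 0 < c) (HB : bellman M c B).
Variables (f g : E -> R).
Hypotheses (bf : bL2 m f) (bg : bL2 m g) (gM : forall x, 0 <= g x <= M).

Lemma integral_flow_gamma_le :
  (c%:E * \int[lebesgue_measure]_(t in (`]0%R, +oo[%classic : set (measurableTypeR R)))
      \int[m]_x ((Pr p t g x)%:E * (2%:E * flow_gamma f t x)) <=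
    \int[m]_x B (f x) (g x))%E.
Proof.
have Pg0 t x : 0 <= Pr p t g x by apply: Pr_ge0 => y; have /andP[] := gM y.
apply: (integral_energy_le sf H c0 HB bf bg gM
  (G := fun z => (2%:E * flow_gamma f z.1 z.2)%E)).
- by apply: measurable_funeM; apply: measurable_flow_gamma; exact: bf.1.1.
- by move=> z; rewrite mule_ge0// ?flow_gamma_ge0.
- move=> t t0; pose u := Pr p t f; pose v := Pr p t g.
  have bu : bL2 m u := bL2_Pr H (ltW t0) bf.
  have bv : bL2 m v := bL2_Pr H (ltW t0) bg.
  have Du : D u := domain_Pr H D_cvg bf t0.
  have Dv : D v := domain_Pr H D_cvg bg t0.
  have Duv := domainM H D_cvg a_lim bu bv Du Dv.
  have Duu : D (fun x => u x ^+ 2).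
    rewrite (_ : (fun x => u x ^+ 2) = (fun x => u x * u x)).
      exact: (domainM H D_cvg a_lim bu bu Du Du).
    by apply/funext => x; rewrite expr2.
  have moff : measurable (@offdiag d R E) by rewrite -C_off; exact: bigcupT_measurable.
  exists (2 * a u (fun x => u x * v x) - a v (fun x => u x ^+ 2)).
    rewrite (gamma_form aD aR aJ moff mset1 Du Dv Duu Duv (Pg0 t)).
    (* The larger integrand contains [carre_du_champ] itself, which need not be measurable. *)
    apply: le_lower_integralT => [x|x].
    + by rewrite mule_ge0 ?lee_fin// mule_ge0// flow_gamma_ge0.
    + by rewrite lee_wpmul2l ?lee_fin// lee_wpmul2l// flow_gamma_le.
  exact: (gamma_cvg H D_cvg a_lim bu bv Du Dv).
Qed.

End gamma_energy.

(** * Passage from bounded square-integrable functions to their pointwise limits *)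

Section gamma_extension.
Local Opaque inner.
Context d (R : realType) (E : borelMetricType d R) (m : {measure set E -> \bar R}).
Hypothesis sf : sigma_finite setT m.
Variables (D : set (E -> R)) (a : (E -> R) -> (E -> R) -> R).
Hypotheses (aD : dirichlet_form m D a) (aR : regular_form m D a).
Variables (J : {measure set (E * E) -> \bar R}) (N : R.-ker E ~> E).
Hypothesis aJ : pure_jump m D a J N.
Hypothesis mset1 : forall x : E, measurable [set x].
Variable C : (set (E * E))^nat.
Hypotheses (mC : forall n, measurable (C n)) (C_off : \bigcup_n C n = offdiag).
Hypothesis JC : forall n, (J (C n) < +oo)%E.
Variable p : R -> E -> {measure set E -> \bar R}.
Hypothesis H : markov_semigroup m p.

Local Notation Z := (infinite_mass N C).
Local Notation Gam := (flow_gamma N C p).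

Lemma Pr_dominated_cvg (f : E -> R) (fn : (E -> R)^nat) t x :
  measurable_fun setT f -> (forall n, measurable_fun setT (fn n)) ->
  (forall n y, `|fn n y| <= `|f y|) ->
  (forall y, fn n y @[n --> \oo] --> f y) ->
  (Pe p t (fun y => `|f y|%:E) x < +oo)%E ->
  Pr p t (fn n) x @[n --> \oo] --> Pr p t f x.
Proof.
move=> mf mfn fnf fncvg fin.
have mef : measurable_fun setT (EFin \o f) by exact/measurable_EFinP.
have intf : (p t x).-integrable setT (EFin \o f).
  by apply/integrableP; split.
have := @dominated_convergence _ _ _ (p t x) setT measurableT
  (fun n => EFin \o fn n) (EFin \o f) (abse \o (EFin \o f)).
case=> //.
- by move=> n; exact/measurable_EFinP.
- by apply: aeW => y _ /=; apply: cvg_EFin; [exact: nearW|exact: fncvg].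
- exact: integrable_abse.
- by apply: aeW => y n _ /=; rewrite lee_fin.
move=> _ _ cv.
apply: fine_cvg; rewrite fineK//.
by apply: integrable_fin_num.
Qed.

(** A consequence of [jump_null]. It transfers m-almost everywhere convergence of P_t f_n to
    convergence N(x, dy)-almost everywhere off x, for almost every x. *)
Lemma kernel_null (A : set E) : measurable A -> m A = 0%E ->
  {ae m, forall x, N x (A `&` [set~ x]) = 0%E}.
Proof.
move=> mA A0.
have moff : measurable (@offdiag d R E) by rewrite -C_off; exact: bigcupT_measurable.
pose V : set (E * E) := offdiag `&` (setT `*` A).
have mV : measurable V by apply: measurableI => //; exact: measurableX.
have Voff : V `<=` offdiag by exact: subIsetl.
have JV : J V = 0%E.
  have JU := jump_null aJ moff mA A0.
  apply/eqP; rewrite eq_le measure_ge0 andbT -JU; apply: le_measure; rewrite ?inE//.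
    apply: measurableI => //.
    rewrite (_ : [set _ | _] = (A `*` setT) `|` (setT `*` A)).
      by apply: measurableU; exact: measurableX.
    by apply/seteqP; split => z /=; tauto.
  by apply: setIS => z [/= _ Az]; right.
have mN := jump_section aJ mV Voff.
have : ae_eq m setT (fun x => N x (xsection V x)) (cst 0%E).
  apply/(ae_eq_integral_abs m measurableT mN).
  by under eq_integral do rewrite gee0_abs//; rewrite -(jump_kernel aJ mV Voff).
apply: filterS => x /(_ Logic.I) /= xV0; rewrite -[RHS]xV0; congr (N x _).
apply/seteqP; split => y; rewrite /xsection/= inE/=.
  by move=> [Ay /nesym xy].
by move=> [/nesym xy [_ Ay]].
Qed.

(** Fatou's lemma for [N x]. The factor [k] stands inside the lower limit so as to be instantiated
    with 2 c P_t g (x), which depends on x. *)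
Lemma flow_gamma_lower_cvg (f : E -> R) (fn : (E -> R)^nat) t :
  measurable_fun setT f -> (forall n, measurable_fun setT (fn n)) ->
  (forall n y, `|fn n y| <= `|f y|) ->
  (forall y, fn n y @[n --> \oo] --> f y) ->
  {ae m, forall x, (Pe p t (fun y => `|f y|%:E) x < +oo)%E} ->
  {ae m, forall x, forall k : R, 0 <= k ->
    (k%:E * Gam f t x <= limn_einf (fun n => k%:E * Gam (fn n) t x))%E}.
Proof.
move=> mf mfn fnf fncvg [A [mA A0 nA]].
have Acvg y : ~ A y -> Pr p t (fn n) y @[n --> \oo] --> Pr p t f y.
  by move=> Ay; apply: Pr_dominated_cvg => //; apply: contrapT => /nA.
have mPr u : measurable_fun setT u -> measurable_fun setT (Pr p t u).
  exact: (measurable_Pr H).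
have aeA : {ae m, forall x, ~ A x}.
  by exists A; split => // x /= /contrapT.
apply: filterS2 (kernel_null mA A0) aeA => x NA Ax k k0.
have [Zx|Zx] := pselect (Z x).
  have G0 u : Gam u t x = 0%E.
    by rewrite /flow_gamma patchE ifF//; apply/negP; rewrite inE.
  rewrite G0 mule0 (_ : (fun _ => _) = cst 0%E); last by apply/funext => n; rewrite G0 mule0.
  by rewrite (cvg_limn_einf_sup (cvg_cst _)).1.
have GE u : measurable_fun setT u -> (k%:E * Gam u t x)%E =
    (\int[N x]_(y in [set~ x]) (k * 2^-1 * (Pr p t u y - Pr p t u x) ^+ 2)%:E)%E.
  move=> mu; rewrite /flow_gamma patchE ifT; last by rewrite inE.
  rewrite /carre_du_champ muleA -EFinM -ge0_integralZl//.
  - exact: measurableC.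
  - apply: measurable_funTS; apply/measurable_EFinP/measurable_funX.
    by apply: measurable_funB => //; exact: mPr.
  - by move=> y _; rewrite lee_fin sqr_ge0.
  - by rewrite lee_fin mulr_ge0// invr_ge0.
rewrite GE// (_ : (fun n => _) = (fun n => \int[N x]_(y in [set~ x])
    (k * 2^-1 * (Pr p t (fn n) y - Pr p t (fn n) x) ^+ 2)%:E)%E); last first.
  by apply/funext => n; rewrite GE.
have mq u : measurable_fun setT u -> measurable_fun [set~ x]
    (fun y => (k * 2^-1 * (Pr p t u y - Pr p t u x) ^+ 2)%:E).
  move=> mu; apply: measurable_funTS; apply/measurable_EFinP/measurable_funM => //.
  apply: measurable_funX.
  by apply: measurable_funB => //; exact: mPr.
have q0 u y : (0 <= (k * 2^-1 * (Pr p t u y - Pr p t u x) ^+ 2)%:E)%E.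
  by rewrite lee_fin mulr_ge0 ?sqr_ge0// mulr_ge0// invr_ge0.
apply: (@fatou_ae _ _ _ (N x) [set~ x] (A `&` [set~ x])) => //.
- exact: measurableC.
- by apply: measurableI => //; exact: measurableC.
- by move=> n; exact: mq.
- exact: mq.
- move=> y xy Ay; have {}Ay : ~ A y by move=> Ay'; apply: Ay.
  have cv : (k * 2^-1 * (Pr p t (fn n) y - Pr p t (fn n) x) ^+ 2)%:E @[n --> \oo] -->
      (k * 2^-1 * (Pr p t f y - Pr p t f x) ^+ 2)%:E.
    apply: cvg_EFin; first exact: nearW.
    apply: cvg_mulrl; rewrite expr2; under eq_fun do rewrite expr2.
    by apply: cvgM; apply: cvgB; exact: Acvg.
  by rewrite (cvg_limn_einf_sup cv).1.
Qed.

Hypothesis D_cvg : forall u, bL2 m u ->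
  (D u <-> cvg (approx m p h u u @[h --> (0 : R)^'+])).
Hypothesis a_lim : forall u v, D u -> D v ->
  approx m p h u v @[h --> (0 : R)^'+] --> a u v.
Variables (M c : R) (B : R -> R -> \bar R).
Hypotheses (c0 : 0 < c) (HB : bellman M c B).

(** The bound for each f_n passes to f by Fatou's lemma in t and, at fixed t, in x. The weight g
    stays fixed, so that it may be built from f. *)
Lemma integral_flow_gamma_lim_le (f g : E -> R) (fn : (E -> R)^nat) (L : R) :
  measurable_fun setT f -> (forall n, bL2 m (fn n)) ->
  (forall n y, `|fn n y| <= `|f y|) ->
  (forall y, fn n y @[n --> \oo] --> f y) ->
  (forall t, 0 < t -> {ae m, forall x, (Pe p t (fun y => `|f y|%:E) x < +oo)%E}) ->
  bL2 m g -> (forall x, 0 <= g x <= M) ->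
  (forall n, \int[m]_x B (fn n x) (g x) <= L%:E)%E ->
  (c%:E * \int[lebesgue_measure]_(t in (`]0%R, +oo[%classic : set (measurableTypeR R)))
      \int[m]_x ((Pr p t g x)%:E * (2%:E * Gam f t x)) <= L%:E)%E.
Proof.
move=> mf bfn fnf fncvg ffin bg gM BL.
have mfn n : measurable_fun setT (fn n) by exact: (bfn n).1.1.
have Pg0 t x : 0 <= Pr p t g x by apply: Pr_ge0 => y; have /andP[] := gM y.
pose I u t := (\int[m]_x ((Pr p t g x)%:E * (2%:E * Gam u t x)))%E.
have i0 u t x : (0 <= (Pr p t g x)%:E * (2%:E * Gam u t x))%E.
  by rewrite mule_ge0 ?lee_fin// mule_ge0// flow_gamma_ge0.
have mi u : measurable_fun setT u -> measurable_fun setT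
    (fun z : R * E => ((Pr p z.1 g z.2)%:E * (2%:E * Gam u z.1 z.2)))%E.
  move=> mu; apply: emeasurable_funM.
    by apply/measurable_EFinP; exact: (measurable_Pr_time H bg.1.1).
  apply: measurable_funeM; exact: (measurable_flow_gamma aJ mC C_off H).
have I0 u t : (0 <= I u t)%E by apply: integral_ge0.
have mI u : measurable_fun setT u -> measurable_fun (setT : set (measurableTypeR R)) (I u).
  move=> mu; apply: (@measurable_fun_integral_sigma_finite _ _ _ _ sf
    (fun z : R * E => ((Pr p z.1 g z.2)%:E * (2%:E * Gam u z.1 z.2))%E)) => //.
  exact: mi.
pose T : set (measurableTypeR R) := `]0, +oo[%classic.
have mT : measurable T by exact: measurable_itv.
rewrite -/(I f) -/T.
have mIT u : measurable_fun setT u -> measurable_fun T (I u).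
  by move=> mu; apply: measurable_funTS; exact: mI.
rewrite -ge0_integralZl//; last 3 first.
- exact: mIT.
- by move=> t _; exact: I0.
- by rewrite lee_fin ltW.
apply: (@fatou_le _ _ _ lebesgue_measure T set0 (fun n t => c%:E * I (fn n) t)%E
  (fun t => c%:E * I f t)%E (cst L)) => //.
- by move=> n; apply: measurable_funeM; exact: mIT.
- by move=> n t; apply: mule_ge0 => //; rewrite lee_fin ltW.
- by apply: measurable_funeM; exact: mIT.
- by move=> t; apply: mule_ge0 => //; rewrite lee_fin ltW.
- move=> t; rewrite /T/= in_itv/= andbT => t0 _.
  have [A [mA A0 nA]] := flow_gamma_lower_cvg mf mfn fnf fncvg (ffin t t0).
  have mx u : measurable_fun setT u -> measurable_fun setT
      (fun x => c%:E * ((Pr p t g x)%:E * (2%:E * Gam u t x)))%E.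
    by move=> mu; apply: measurable_funeM; exact: (measurable_fun_pair2 t (mi u mu)).
  have x0 u x : (0 <= c%:E * ((Pr p t g x)%:E * (2%:E * Gam u t x)))%E.
    by apply: mule_ge0 => //; rewrite lee_fin ltW.
  have cI u : measurable_fun setT u ->
      (c%:E * I u t = \int[m]_x (c%:E * ((Pr p t g x)%:E * (2%:E * Gam u t x))))%E.
    move=> mu; rewrite ge0_integralZl ?lee_fin ?ltW//.
    exact: (measurable_fun_pair2 t (mi u mu)).
  have cIn : (fun n => c%:E * I (fn n) t)%E = (fun n =>
      \int[m]_x (c%:E * ((Pr p t g x)%:E * (2%:E * Gam (fn n) t x))))%E.
    by apply/funext => n; exact: (cI _ (mfn n)).
  rewrite [leLHS](cI f mf) cIn.
  apply: (@fatou_ae _ _ _ m setT A) => //.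
  + by move=> n; exact: mx.
  + exact: mx.
  + move=> x _ Ax; have Hx : forall k : R, 0 <= k ->
        (k%:E * Gam f t x <= limn_einf (fun n => k%:E * Gam (fn n) t x))%E.
      by apply: contrapT => /nA.
    have k0 : 0 <= c * (Pr p t g x * 2) by rewrite (mulr_ge0 (ltW c0))// mulr_ge0.
    have := Hx _ k0.
    by rewrite !EFinM -!muleA; under [X in limn_einf X]eq_fun do rewrite -!muleA.
- move=> n; apply: le_trans (BL n).
  have -> : (\int[lebesgue_measure]_(t in T) (c%:E * I (fn n) t) =
      c%:E * \int[lebesgue_measure]_(t in T) I (fn n) t)%E.
    by apply: ge0_integralZl => //; [exact: mIT|rewrite lee_fin ltW].
  exact: (integral_flow_gamma_le sf aD aR aJ mset1 mC C_off H D_cvg a_lim c0 HB (bfn n) bg gM).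
- exact: cvg_cst.
Qed.

End gamma_extension.

Lemma sigma_finite_nondecreasing d (T : measurableType d) (R : realType)
    (m : {measure set T -> \bar R}) : sigma_finite setT m ->
  exists A : (set T)^nat, [/\ forall n, measurable (A n), forall n, (m (A n) < +oo)%E &
    forall x, \forall n \near \oo, A n x].
Proof.
move=> [F FT HF]; exists (fun n => \big[setU/set0]_(i < n) F i); split.
- by move=> n; apply: bigsetU_measurable => i _; exact: (HF i).1.
- elim=> [|n IH]; first by rewrite big_ord0 measure0.
  rewrite big_ord_recr/=.
  have mS : measurable (\big[setU/set0]_(i < n) F i).
    by apply: bigsetU_measurable => i _; exact: (HF i).1.
  apply: (le_lt_trans (measureU2 m mS (HF n).1)).
  by rewrite lte_add_pinfty// (HF n).2.
- move=> x; have : setT x by []. rewrite FT => -[k _ Fk].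
  exists k.+1 => // n /= kn; rewrite -bigcup_mkord; by exists k.
Qed.

Lemma bL2_indic d (R : realType) (E : borelMetricType d R)
    (m : {measure set E -> \bar R}) (u : E -> R) (A : set E) (M : R) :
  measurable_fun setT u -> measurable A -> (m A < +oo)%E -> 0 <= M ->
  (forall x, A x -> `|u x| <= M) -> bL2 m (fun x => u x * \1_A x).
Proof.
move=> mu mA Afin M0 uM.
have mI : measurable_fun setT (\1_A : E -> R) by exact: measurable_indic.
have muA : measurable_fun setT (fun x => u x * \1_A x) by exact: measurable_funM.
have leM x : `|u x * \1_A x| <= M * \1_A x.
  rewrite indicE; case: (boolP (x \in A)) => xA; last by rewrite !mulr0 normr0.
  by rewrite !mulr1 uM//; rewrite inE in xA.
split.
  split => //; exists M => x; apply: (le_trans (leM x)).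
  by rewrite indicE ler_piMr//; case: (_ \in _).
apply/Lfun2P; split => //.
apply: (@le_lt_trans _ _ (\int[m]_x ((M ^+ 2)%:E * (\1_A x)%:E))%E).
  apply: ge0_le_integral => //.
  - by move=> x _; rewrite lee_fin sqr_ge0.
  - exact/measurable_EFinP/measurable_funX.
  - by apply: measurable_funeM; exact/measurable_EFinP.
  - move=> x _; rewrite -EFinM lee_fin -real_normK ?num_real//.
    have -> : M ^+ 2 * \1_A x = (M * \1_A x) ^+ 2.
      by rewrite exprMn indicE; case: (_ \in _); rewrite ?expr1n ?expr0n.
    by rewrite ler_sqr ?nnegrE// mulr_ge0// indicE; case: (_ \in _).
rewrite ge0_integralZl//.
- by rewrite integral_indic// setIT lte_mul_pinfty// lee_fin sqr_ge0.
- exact/measurable_EFinP.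
- by rewrite lee_fin sqr_ge0.
Qed.

(** Ensures that P_t |f| is finite almost everywhere for f in L^(2q), even when m is infinite. *)
Lemma norm_le_powR_sqr (R : realType) (q y : R) : 1 <= q ->
  `|y| <= 1 + (y ^+ 2) `^ q.
Proof.
move=> q1; have [y1|y1] := leP `|y| 1; first by rewrite (le_trans y1)// lerDl powR_ge0.
have y21 : `|y| <= y ^+ 2.
  by rewrite -real_normK ?num_real// expr2 ler_peMr// ltW.
have sq1 : 1 <= y ^+ 2 by rewrite (le_trans _ y21)// ltW.
rewrite (le_trans y21)//; have := ler_powR sq1 q1.
by rewrite powRr1 ?sqr_ge0// => /le_trans; apply; rewrite lerDr.
Qed.

(** * The bound for the square function of a Markov semigroup *)

Section semigroup_square_function.
Local Opaque inner.
Context d (R : realType) (E : borelMetricType d R) (m : {measure set E -> \bar R}).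
Hypothesis sf : sigma_finite setT m.
Variables (D : set (E -> R)) (a : (E -> R) -> (E -> R) -> R).
Hypotheses (aD : dirichlet_form m D a) (aR : regular_form m D a).
Variables (J : {measure set (E * E) -> \bar R}) (N : R.-ker E ~> E).
Hypothesis aJ : pure_jump m D a J N.
Hypothesis mset1 : forall x : E, measurable [set x].
Variable C : (set (E * E))^nat.
Hypotheses (mC : forall n, measurable (C n)) (C_off : \bigcup_n C n = offdiag).
Hypothesis JC : forall n, (J (C n) < +oo)%E.
Variable p : R -> E -> {measure set E -> \bar R}.
Hypothesis H : markov_semigroup m p.
Hypothesis D_cvg : forall u, bL2 m u ->
  (D u <-> cvg (approx m p h u u @[h --> (0 : R)^'+])).
Hypothesis a_lim : forall u v, D u -> D v ->
  approx m p h u v @[h --> (0 : R)^'+] --> a u v.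

Local Notation Gam := (flow_gamma N C p).
Local Notation pos := (`]0%R, +oo[%classic : set (measurableTypeR R)).

(** A measurable version of W, the square of the square function. *)
Definition square_energy (f : E -> R) (x : E) : \bar R :=
  (\int[lebesgue_measure]_(t in pos) Pe p t (Gam f t) x)%E.

Variable f : E -> R.
Hypothesis mf : measurable_fun setT f.

Let mPG : measurable_fun setT (fun z : R * E => Pe p z.1 (Gam f z.1) z.2).
Proof.
apply: (measurable_Pe_joint H (tau := id) (f := fun z => Gam f z.1 z.2)) => //.
- by move=> z; exact: flow_gamma_ge0.
- exact: (measurable_flow_gamma aJ mC C_off H).
Qed.

Let PG0 t x : (0 <= Pe p t (Gam f t) x)%E.
Proof. by apply: Pe_ge0 => y; exact: flow_gamma_ge0. Qed.

Lemma square_energy_ge0 x : (0 <= square_energy f x)%E.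
Proof. by apply: integral_ge0 => t _; exact: PG0. Qed.

Let mpos : measurable pos. Proof. exact: measurable_itv. Qed.

Lemma measurable_square_energy : measurable_fun setT (square_energy f).
Proof.
exact: (@measurable_fun_integral_lebesgue _ _ _ pos
  (fun z => Pe p z.1 (Gam f z.1) z.2) mpos (fun z => PG0 z.1 z.2) mPG).
Qed.

(** Duality: symmetry moves P_t from g onto Gamma, and Tonelli's theorem exchanges t and x. *)
Lemma integral_square_energy (g : E -> R) : bL2 m g -> (forall x, 0 <= g x) ->
  (\int[lebesgue_measure]_(t in pos) \int[m]_x ((Pr p t g x)%:E * Gam f t x) =
   \int[m]_x ((g x)%:E * square_energy f x))%E.
Proof.
move=> bg g0; have meg : measurable_fun setT (EFin \o g) by exact/measurable_EFinP/bg.1.1.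
transitivity (\int[lebesgue_measure]_(t in pos) \int[m]_x ((g x)%:E * Pe p t (Gam f t) x))%E.
  apply: eq_integral => t; rewrite inE/= in_itv/= andbT => t0.
  have mGt : measurable_fun setT (Gam f t).
    exact: (measurable_fun_pair2 t (measurable_flow_gamma aJ mC C_off H mf)).
  rewrite -(ms_sym H t0 meg mGt) => [|x|x]; last 2 first.
  - by rewrite lee_fin.
  - exact: flow_gamma_ge0.
  by apply: eq_integral => x _; rewrite (EFin_Pr H t x bg.1).
rewrite (@sigma_finite_tonelli _ _ _ m sf pos
  (fun z => (g z.2)%:E * Pe p z.1 (Gam f z.1) z.2)%E mpos).
- apply: eq_integral => x _; rewrite /square_energy -ge0_integralZl ?lee_fin//.
  by apply: measurable_funTS; exact: (measurable_fun_pair1 x mPG).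
- by move=> z; rewrite mule_ge0// lee_fin.
- apply: emeasurable_funM => //; apply/measurable_EFinP; apply: measurableT_comp => //.
  exact: bg.1.1.
Qed.

Variables (q c0 K : R).
Hypotheses (q1 : 1 <= q) (c00 : 0 < c0) (K0 : 0 < K).
Hypothesis HBq : bellman_family q c0 K.
Let fq x := (f x ^+ 2) `^ q.
Let A0 := (\int[m]_x (fq x)%:E)%E.
Hypothesis fq_fin : (A0 < +oo)%E.

Let mfq : measurable_fun setT fq.
Proof. by apply: (measurableT_comp (measurable_powR q)); exact: measurable_funX. Qed.

Let fq0 x : 0 <= fq x. Proof. exact: powR_ge0. Qed.

Let f_integrable t : 0 < t ->
  {ae m, forall x, (Pe p t (fun y => `|f y|%:E) x < +oo)%E}.
Proof.
move=> t0; have mefq : measurable_fun setT (EFin \o fq) by exact/measurable_EFinP.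
have efq0 x : (0 <= (EFin \o fq) x)%E by rewrite lee_fin.
have ifq : m.-integrable setT (Pe p t (EFin \o fq)).
  apply/integrableP; split; first exact: (measurable_Pe H).
  under eq_integral do rewrite gee0_abs ?(Pe_ge0 p)//.
  exact: (le_lt_trans (integral_Pe_le H t0 efq0 mefq)).
have := integrable_ae measurableT ifq; apply: filterS => x /(_ Logic.I) fin.
have m1 : measurable_fun setT (cst (1%E : \bar R) : E -> \bar R) by [].
apply: (@le_lt_trans _ _ (Pe p t (fun y => 1 + (EFin \o fq) y)%E x)).
  apply: (le_Pe p) => //.
  - by apply/measurable_EFinP; exact: measurableT_comp.
  - exact: emeasurable_funD.
  - by move=> y; rewrite /= -EFinD lee_fin; exact: norm_le_powR_sqr.
rewrite /Pe ge0_integralD//; apply: lte_add_pinfty.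
  rewrite (integral_cst (p t x) measurableT 1)// mul1e.
  by apply: (le_lt_trans (ms_le1 H t x)); rewrite ltry.
by rewrite -ge0_fin_numE// (Pe_ge0 p).
Qed.

Let W := square_energy f.
Let s (n : nat) (x : E) : R := fine (mine (W x) n%:R%:E).

Let s_fin n x : (s n x)%:E = mine (W x) n%:R%:E.
Proof.
rewrite fineK// ge0_fin_numE; last by rewrite le_min square_energy_ge0 lee_fin/=.
by apply: (@le_lt_trans _ _ n%:R%:E); rewrite ?ltry// ge_min lexx orbT.
Qed.

Let s_bound n x : 0 <= s n x <= n%:R.
Proof.
by rewrite -!lee_fin s_fin le_min square_energy_ge0 lee_fin ler0n/= ge_min lexx orbT.
Qed.

Let s_le n x : ((s n x)%:E <= W x)%E.
Proof. by rewrite s_fin ge_min lexx. Qed.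

Let ms_ n : measurable_fun setT (s n).
Proof.
apply: (@measurableT_comp _ _ _ _ _ _ fine setT); first exact: fine_measurable.
by apply: measurable_mine => //; exact: measurable_square_energy.
Qed.

(** The test function is c0 s^(q-1) on [A], where s is W truncated at [j]. Both cut-offs make S, the
    integral of s^q over [A], finite; without this the absorption would be void. The resulting bound
    depends on neither. *)
Let truncated_bound (A : set E) (j : nat) (fn : (E -> R)^nat) :
  measurable A -> (m A < +oo)%E ->
  (forall n, bL2 m (fn n)) -> (forall n y, `|fn n y| <= `|f y|) ->
  (forall y, fn n y @[n --> \oo] --> f y) ->
  (\int[m]_x ((s j x) `^ q * \1_A x)%:E <= (K / c0)%:E * A0)%E.
Proof.
move=> mA Afin bfn fnf fncvg.
have j0 : (0 : R) <= j%:R by [].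
have [B [M [HB gM M0 Bg B0]]] := HBq j0.
have q0 : 0 < q by exact: lt_le_trans q1.
pose g x := c0 * s j x `^ (q - 1) * \1_A x.
have indE x : \1_A x = (x \in A)%:R :> R by rewrite indicE.
have gM' x : 0 <= g x <= M.
  rewrite /g indE; case: (_ \in _); rewrite ?mulr1 ?mulr0 ?lexx//.
  exact: gM.
have g0 x : 0 <= g x by have /andP[] := gM' x.
have mpw r : measurable_fun setT (fun x => s j x `^ r).
  by apply: (measurableT_comp (measurable_powR r)).
have bg : bL2 m g.
  apply: (bL2_indic (M := M)) => //; first exact: measurable_funM.
  by move=> x _; have /andP[h1 h2] := gM _ (s_bound j x); rewrite ger0_norm.
have msq : measurable_fun setT (fun x => s j x `^ q * \1_A x).
  by apply: measurable_funM => //; exact: measurable_indic.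
have sq0 x : 0 <= s j x `^ q * \1_A x by rewrite mulr_ge0// ?powR_ge0// indE.
pose S := (\int[m]_x (s j x `^ q * \1_A x)%:E)%E.
have S0 : (0 <= S)%E by apply: integral_ge0 => x _; rewrite lee_fin.
have Sfin : (S < +oo)%E.
  apply: (@le_lt_trans _ _ (\int[m]_x ((j%:R `^ q)%:E * (\1_A x)%:E))%E).
    apply: ge0_le_integral => //.
    - by move=> x _; rewrite lee_fin.
    - exact/measurable_EFinP.
    - by apply: measurable_funeM; apply/measurable_EFinP; exact: measurable_indic.
    - move=> x _; rewrite -EFinM lee_fin ler_wpM2r ?indE//.
      by have /andP[s0 sj] := s_bound j x; rewrite (ge0_ler_powR (ltW q0))// nnegrE.
  have m1 : measurable_fun setT (fun x => (\1_A x : R)%:E).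
    by apply/measurable_EFinP; exact: measurable_indic.
  have I1 x : setT x -> (0 <= (\1_A x : R)%:E)%E by move=> _; rewrite lee_fin indE.
  rewrite (ge0_integralZl m measurableT m1 I1) ?lee_fin ?powR_ge0//.
  by rewrite integral_indic// setIT lte_mul_pinfty// ?lee_fin ?powR_ge0.
have A00 : (0 <= A0)%E by apply: integral_ge0 => x _; rewrite lee_fin.
have [A0n Sn] : A0 \is a fin_num /\ S \is a fin_num by rewrite !ge0_fin_numE.
have BL n : (\int[m]_x B (fn n x) (g x) <= ((K * fine A0 + c0 * fine S) / q)%:E)%E.
  have mB : measurable_fun setT (fun x => B (fn n x) (g x)).
    by apply: (measurable_bellman HB); [exact: (bfn n).1.1|exact: bg.1.1].
  have Bge x : (0 <= B (fn n x) (g x))%E by exact: (bellman_ge0 HB).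
  rewrite mulrC EFinM -lee_pdivrMl; last by rewrite invr_gt0.
  have eq0 : (0 <= q%:E)%E by rewrite lee_fin ltW.
  rewrite invrK -(ge0_integralZl m measurableT mB (fun x _ => Bge x) eq0).
  rewrite EFinD !EFinM !fineK// -!ge0_integralZl//; last 6 first.
  - exact/measurable_EFinP.
  - by move=> x _; rewrite lee_fin.
  - by rewrite lee_fin ltW.
  - exact/measurable_EFinP.
  - by move=> x _; rewrite lee_fin.
  - by rewrite lee_fin ltW.
  rewrite -ge0_integralD//; last 4 first.
  - by move=> x _; rewrite -EFinM lee_fin mulr_ge0// ltW.
  - by apply: measurable_funeM; exact/measurable_EFinP.
  - by move=> x _; rewrite -EFinM lee_fin mulr_ge0// ltW.
  - by apply: measurable_funeM; exact/measurable_EFinP.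
  apply: ge0_le_integral => //.
  - by move=> x _; rewrite mule_ge0// lee_fin ltW.
  - exact: measurable_funeM.
  - by apply: emeasurable_funD; apply: measurable_funeM; exact/measurable_EFinP.
  move=> x _; rewrite -!EFinM -EFinD.
  have fnle : (fn n x ^+ 2) `^ q <= fq x.
    apply: (ge0_ler_powR (ltW q0)); rewrite ?nnegrE ?sqr_ge0//.
    by rewrite -real_normK ?num_real// -[leRHS]real_normK ?num_real// ler_sqr ?nnegrE.
  rewrite /g indE; case: (_ \in _); rewrite ?mulr1 ?mulr0 ?addr0.
    have /andP[s0 _] := s_bound j x; apply: (le_trans (Bg (fn n x) _ s0)).
    by rewrite lee_fin lerD2r ler_wpM2l// ltW.
  by apply: (le_trans (B0 (fn n x))); rewrite lee_fin ler_wpM2l// ltW.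
have qV0 : 0 < q^-1 by rewrite invr_gt0.
have := integral_flow_gamma_lim_le sf aD aR aJ mset1 mC C_off H D_cvg a_lim qV0 HB
  mf bfn fnf fncvg f_integrable bg gM' BL.
have -> : (\int[lebesgue_measure]_(t in pos)
      \int[m]_x ((Pr p t g x)%:E * (2%:E * Gam f t x)) =
    2%:E * \int[m]_x ((g x)%:E * W x))%E.
  rewrite -(integral_square_energy bg g0).
  have mI : measurable_fun setT (fun z : R * E => ((Pr p z.1 g z.2)%:E * Gam f z.1 z.2)%E).
    apply: emeasurable_funM; last exact: (measurable_flow_gamma aJ mC C_off H).
    by apply/measurable_EFinP; exact: (measurable_Pr_time H bg.1.1).
  have I0 t x : (0 <= (Pr p t g x)%:E * Gam f t x)%E.
    by rewrite mule_ge0 ?lee_fin ?Pr_ge0 ?flow_gamma_ge0.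
  transitivity (\int[lebesgue_measure]_(t in pos)
      (2%:E * \int[m]_x ((Pr p t g x)%:E * Gam f t x)))%E.
    apply: eq_integral => t _; rewrite -ge0_integralZl//.
    - by apply: eq_integral => x _; rewrite muleCA.
    - exact: (measurable_fun_pair2 t mI).
  apply: ge0_integralZl => //.
  - apply: measurable_funTS; exact: (@measurable_fun_integral_sigma_finite _ _ _ _ sf
      (fun z : R * E => ((Pr p z.1 g z.2)%:E * Gam f z.1 z.2)%E)).
  - by move=> t _; exact: integral_ge0.
(* As s <= W, the product g W is at least c0 s^(q-1) s on [A]. *)
have gW : (c0%:E * S <= \int[m]_x ((g x)%:E * W x))%E.
  rewrite -ge0_integralZl//; last 3 first.
  - exact/measurable_EFinP.
  - by move=> x _; rewrite lee_fin.
  - by rewrite lee_fin ltW.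
  apply: ge0_le_integral => //.
  - by move=> x _; rewrite -EFinM lee_fin mulr_ge0// ltW.
  - by apply: measurable_funeM; exact/measurable_EFinP.
  - apply: emeasurable_funM; last exact: measurable_square_energy.
    by apply/measurable_EFinP; exact: bg.1.1.
  - move=> x _; rewrite -EFinM.
    apply: (@le_trans _ _ ((g x)%:E * (s j x)%:E)%E); last first.
      by rewrite lee_wpmul2l// lee_fin.
    have /andP[s0 _] := s_bound j x.
    rewrite -EFinM lee_fin /g mulrAC -!mulrA (ler_wpM2l (ltW c00))//.
    rewrite mulrA ler_wpM2r ?indE//.
    have [->|sn0] := eqVneq (s j x) 0; first by rewrite powR0 ?mulr0// gt_eqF.
    have -> : s j x `^ q = s j x `^ (q - 1) * s j x.
      by rewrite -[X in _ = _ * X]powRr1// -powRD ?subrK// sn0 implybT.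
    exact: lexx.
move=> le1.
have : (q^-1%:E * (2%:E * (c0%:E * S)) <= ((K * fine A0 + c0 * fine S) / q)%:E)%E.
  apply: le_trans le1; apply: lee_wpmul2l; first by rewrite lee_fin ltW.
  exact: lee_wpmul2l.
rewrite -/S -(fineK Sn) -(fineK A0n) -!EFinM !lee_fin.
rewrite mulrC -[X in _ <= X -> _]mulrC; move: (fine S) (fine A0) => S' A' le2.
(* The absorption: one of the two copies of c0 S is cancelled, S being finite. *)
have {}le2 : 2 * (c0 * S') <= K * A' + c0 * S'.
  by move: le2; rewrite mulrC ler_pM2l.
by rewrite mulrAC ler_pdivlMr// mulrC; lra.
Qed.

Lemma integral_square_energy_le :
  (\int[m]_x (square_energy f x `^ q) <=
    (K / c0)%:E * \int[m]_x ((f x ^+ 2) `^ q)%:E)%E.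
Proof.
have q0 : 0 < q by exact: lt_le_trans q1.
have [A [mA Afin Acov]] := sigma_finite_nondecreasing sf.
(* On [T n] the function is bounded and the measure finite, so that the cut-off [fn n] lies in
   [bL2]. *)
pose T n : set E := A n `&` [set x | `|f x| <= n%:R].
have mT n : measurable (T n).
  apply: measurableI => //; rewrite -[X in measurable X]setTI.
  have mn : measurable_fun setT (fun x => `|f x|) by exact: measurableT_comp.
  rewrite (_ : [set _ | _] = (fun x => `|f x|) @^-1` `]-oo, n%:R]).
    by apply: mn => //; exact: measurable_itv.
  by apply/seteqP; split => x /=; rewrite in_itv.
pose fn n x := f x * \1_(T n) x.
have TA n : (m (T n) < +oo)%E.
  by apply: le_lt_trans (Afin n); apply: le_measure; rewrite ?inE//; exact: subIsetl.
have bfn n : bL2 m (fn n).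
  by apply: (bL2_indic (M := n%:R)) => // x [].
have fnf n y : `|fn n y| <= `|f y|.
  by rewrite normrM indicE ler_piMr//; case: (_ \in _); rewrite ?normr1 ?normr0.
have fncvg y : fn n y @[n --> \oo] --> f y.
  apply: (@cvg_near_eq _ _ _ _ (cst (f y))); last exact: cvg_cst.
  near=> n; rewrite /fn indicE mem_set ?mulr1//; split; first by near: n.
  by near: n; exact: nbhs_infty_ger.
have A0n : A0 \is a fin_num.
  by rewrite ge0_fin_numE//; apply: integral_ge0 => x _; rewrite lee_fin.
have mSA n : measurable_fun setT (fun x => (s n x `^ q * \1_(A n) x)%:E).
  apply/measurable_EFinP/measurable_funM; last exact: measurable_indic.
  exact: (measurableT_comp (measurable_powR q)).
rewrite -/A0 -(fineK A0n) -EFinM.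
apply: (@fatou_le _ _ _ m setT set0 (fun n x => (s n x `^ q * \1_(A n) x)%:E) _
  (cst (K / c0 * fine A0))) => //.
- by move=> n x; rewrite lee_fin mulr_ge0// powR_ge0.
- exact: (measurableT_comp (measurable_poweR q) measurable_square_energy).
- by move=> x; exact: poweR_ge0.
- move=> x _ _; rewrite -/W.
  suff cv : (s n x `^ q * \1_(A n) x)%:E @[n --> \oo] --> (W x `^ q)%E.
    by rewrite (cvg_limn_einf_sup cv).1.
  have := square_energy_ge0 x; rewrite -/W; case Wx : (W x) => [r| |] // W0.
    apply: (@cvg_near_eq _ _ _ _ (cst (r%:E `^ q))%E); last exact: cvg_cst.
    near=> n; rewrite /= indicE mem_set ?mulr1; last by near: n; exact: Acov.
    rewrite /s Wx minEle ifT// lee_fin.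
    by near: n; exact: nbhs_infty_ger.
  (* Where W is infinite the truncation equals n, and n^q >= n. *)
  rewrite poweRyr ?gt_eqF//; apply/cvgeryP.
  apply: ger_cvgy cvgr_idn; near=> n.
  rewrite indicE mem_set ?mulr1; last by near: n; exact: Acov.
  rewrite /s Wx minEle/=.
  have n1 : (1 : R) <= n%:R by near: n; exact: nbhs_infty_ger.
  by have := ler_powR n1 q1; rewrite powRr1.
- move=> n; rewrite /cst EFinM fineK//.
  exact: (truncated_bound n (mA n) (Afin n) bfn fnf fncvg).
- exact: cvg_cst.
Unshelve. all: by end_near. Qed.

End semigroup_square_function.

(** * The semigroup of a Hunt process *)

Section kernel_integral.
Import HBNNSimple.
Lemma measurable_fun_kernel_integral d1 d2 (X : measurableType d1)
    (Y : measurableType d2) (R : realType) (l : X -> {measure set Y -> \bar R})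
    (f : Y -> \bar R) :
  (forall C, measurable C -> measurable_fun setT (l ^~ C)) ->
  (forall y, 0 <= f y)%E -> measurable_fun setT f ->
  measurable_fun setT (fun x => \int[l x]_y f y)%E.
Proof.
move=> ml f0 mf; pose f_ := nnsfun_approx measurableT mf.
apply: (@emeasurable_fun_cvg _ _ _ setT (fun n (x : X) => \int[l x]_y (f_ n y)%:E)%E) => [n|x _].
  under eq_fun do rewrite integral_nnsfun// patch_setT sintegralE.
  by apply: emeasurable_fsum => // r; apply: measurable_funeM; exact: ml.
have -> : (\int[l x]_y f y = limn (fun n => \int[l x]_y (f_ n y)%:E))%E.
  rewrite -monotone_convergence//.
  - by apply: eq_integral => y _; apply/esym/cvg_lim => //; exact: cvg_nnsfun_approx.
  - by move=> n; exact/measurable_EFinP.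
  - by move=> n y _; rewrite lee_fin.
  - by move=> y _ i j ij; rewrite lee_fin; exact/lefP/nd_nnsfun_approx.
apply: ereal_nondecreasing_is_cvgn => i j ij; apply: ge0_le_integral => //.
- by move=> y _; rewrite lee_fin.
- exact/measurable_EFinP.
- exact/measurable_EFinP.
- by move=> y _; rewrite lee_fin; exact/lefP/nd_nnsfun_approx.
Qed.

End kernel_integral.

Section distance_to_closed_set.
Context (R : realType) (T : metricType R).
Variables (A : set T) (a0 : T).
Hypothesis Aa0 : A a0.

Definition set_dist (x : T) : R := inf [set mdist x a | a in A].

Let has_inf_dist x : has_inf [set mdist x a | a in A].
Proof.
split; first by exists (mdist x a0), a0.
by exists 0 => _ [a _ <-]; exact: mdist_ge0.
Qed.

Lemma set_dist_ge0 x : 0 <= set_dist x.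
Proof.
apply: lb_le_inf; first by exists (mdist x a0), a0.
by move=> _ [a _ <-]; exact: mdist_ge0.
Qed.

Lemma set_dist_le x y : set_dist x <= mdist x y + set_dist y.
Proof.
rewrite -lerBlDl; apply: lb_le_inf; first by exists (mdist y a0), a0.
move=> _ [a Aa <-]; rewrite lerBlDl.
apply: le_trans (metric_triangle x y a).
by apply: ge_inf; [have [] := has_inf_dist x|exists a].
Qed.

Lemma set_dist_continuous : continuous set_dist.
Proof.
move=> x; apply/cvgrPdist_lt => e e0.
have : \forall y \near x, mdist x y < e.
  apply/metricType_numDomainType.nbhs_mdistP; exists e => //.
apply: filterS => y xy; rewrite ltr_distl.
have := set_dist_le x y; have := set_dist_le y x.
by rewrite (metric_sym y x); move: xy; lra.
Qed.

Lemma set_dist0 x : A x -> set_dist x = 0.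
Proof.
move=> Ax; apply/eqP; rewrite eq_le set_dist_ge0 andbT -(mdistxx x).
by apply: ge_inf; [have [] := has_inf_dist x|exists x].
Qed.

Lemma set_dist_gt0 x : closed A -> ~ A x -> 0 < set_dist x.
Proof.
move=> cA Ax; have : nbhs x (~` A) by apply: open_nbhs_nbhs; split => //; exact: closed_openC.
move=> /metricType_numDomainType.nbhs_mdistP[e e0 eA].
apply: (lt_le_trans e0); apply: lb_le_inf; first by exists (mdist x a0), a0.
by move=> _ [a Aa <-]; rewrite leNgt; apply/negP => xa; exact: (eA a xa).
Qed.

End distance_to_closed_set.

Lemma open_borel_measurable d (R : realType) (E : borelMetricType d R) (U : set E) :
  open U -> measurable U.
Proof. by move=> oU; rewrite measurable_borelE; exact: sub_sigma_algebra. Qed.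

Lemma continuous_borel_measurable d (R : realType) (E : borelMetricType d R)
    (u : E -> R) : continuous u -> measurable_fun setT u.
Proof.
move=> /continuousP cu; apply: (measurability _ (RGenOpens.measurableE R)).
move=> _ [_ [a [b ->] <-]]; rewrite setTI; apply: open_borel_measurable.
exact/cu/interval_open.
Qed.

(** * Joint measurability of kernels that are right-continuous in time *)

Section right_continuous_kernel.
Context d (R : realType) (E : borelMetricType d R).
Variable p : R -> E -> {measure set E -> \bar R}.
Hypothesis p_measurable : forall t B, measurable B -> measurable_fun setT (p t ^~ B).
Hypothesis p_le1 : forall t x, (p t x setT <= 1)%E.
Hypothesis p_nonneg : forall t x, p t x = p (Num.max t 0) x.
Hypothesis p_right_cvg : forall (phi : E -> R) x t (s : R^nat), continuous phi ->
  (forall y, 0 <= phi y <= 1) -> 0 <= t -> (forall n, t < s n) ->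
  s n @[n --> \oo] --> t ->
  (\int[p (s n) x]_y (phi y)%:E @[n --> \oo] --> \int[p t x]_y (phi y)%:E)%E.

Let grid (n : nat) (t : R) : nat := Num.truncn (Num.max t 0 * n.+1%:R).

Let max0 (t : R) : 0 <= Num.max t 0. Proof. by rewrite le_max lexx orbT. Qed.

Let gridP n t k : (grid n t == k) =
  (k%:R <= Num.max t 0 * n.+1%:R < k.+1%:R).
Proof. by rewrite /grid truncn_eq// mulr_ge0. Qed.

Let measurable_grid n k : measurable [set t | grid n t = k].
Proof.
have mt : measurable_fun setT (fun t : R => Num.max t 0 * n.+1%:R).
  by apply: measurable_funM => //; exact: measurable_maxr.
rewrite (_ : [set t | _] = setT `&` (fun t => Num.max t 0 * n.+1%:R) @^-1`
    `[k%:R, k.+1%:R[%classic).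
  by apply: mt => //; exact: measurable_itv.
apply/seteqP; split => t /=; rewrite in_itv/= -gridP.
  by move=> ->.
by move=> [_ /eqP].
Qed.

(** The right end of the grid cell of t: strictly later than t, as right continuity demands, and
    constant on cells, so that measurability in (t, x) reduces to measurability in x on each
    cell. *)
Let step n t : R := (grid n t).+1%:R / n.+1%:R.

Let step_gt n t : Num.max t 0 < step n t.
Proof.
rewrite /step ltr_pdivlMr//.
by have := eqxx (grid n t); rewrite gridP => /andP[].
Qed.

Let step_le n t : step n t <= Num.max t 0 + n.+1%:R^-1.
Proof.
rewrite /step ler_pdivrMr// mulrDl mulVf// -natr1 lerD2r.
by have := eqxx (grid n t); rewrite gridP => /andP[].
Qed.

Let step_cvg t : step n t @[n --> \oo] --> Num.max t 0.
Proof.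
apply: (@squeeze_cvgr _ _ _ _ (cst (Num.max t 0)) (fun n => Num.max t 0 + n.+1%:R^-1)).
- by apply: nearW => n; rewrite step_le (ltW (step_gt n t)).
- exact: cvg_cst.
- rewrite -[X in _ --> X]addr0; apply: cvgD; first exact: cvg_cst.
  exact: cvg_harmonic.
Qed.

Let fine_integral (phi : E -> R) t x : \bar R := (\int[p t x]_y (phi y)%:E)%E.

Let measurable_phi (phi : E -> R) : continuous phi -> (forall y, 0 <= phi y <= 1) ->
  measurable_fun setT (fun z : R * E => fine_integral phi z.1 z.2).
Proof.
move=> cphi phi01.
have mphi : measurable_fun setT (EFin \o phi).
  by apply/measurable_EFinP; exact: continuous_borel_measurable.
have phi0 y : (0 <= (EFin \o phi) y)%E by rewrite lee_fin; have /andP[] := phi01 y.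
have mx t : measurable_fun setT (fine_integral phi t).
  by apply: measurable_fun_kernel_integral => //; exact: p_measurable.
apply: (@emeasurable_fun_cvg _ _ _ setT
  (fun n (z : R * E) => fine_integral phi (step n z.1) z.2)) => [n|[t x] _ /=].
  move=> _ B mB; rewrite setTI.
  rewrite (_ : _ @^-1` B = \bigcup_k ([set t | grid n t = k] `*`
      (setT `&` fine_integral phi (k.+1%:R / n.+1%:R) @^-1` B))).
    apply: bigcupT_measurable => k; apply: measurableX; first exact: measurable_grid.
    exact: mx.
  apply/seteqP; split => -[t x] /=.
    by move=> Bx; exists (grid n t) => //=; split.
  by move=> [k _ [/= <- [_]]].
rewrite /fine_integral p_nonneg.
exact: p_right_cvg.
Qed.

(** The indicator of [U] is the limit of the continuous functions min(1, n dist(x, ~U)). The whole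
    space is treated apart, its complement having no point to measure distances to. *)
Let measurable_open_mass U : open U ->
  measurable_fun setT (fun z : R * E => p z.1 z.2 U).
Proof.
move=> oU; have mU := open_borel_measurable oU.
have [UT|/existsNP[a0 Ua0]] := pselect (forall x, U x).
  have {UT} -> : U = setT by apply/seteqP; split.
  have cphi : continuous (cst (1 : R) : E -> R) by move=> x; exact: cvg_cst.
  have phi01 : forall y : E, 0 <= cst (1 : R) y <= 1 by move=> y; rewrite ler01 lexx.
  apply: eq_measurable_fun (measurable_phi cphi phi01) => -[t x] _ /=.
  by rewrite /fine_integral (integral_cst (p t x) measurableT 1) mul1e.
have cUC : closed (~` U) by exact: open_closedC.
pose delta := set_dist (~` U).
have d0 x : 0 <= delta x := set_dist_ge0 Ua0 x.
pose phi n x := Num.min 1 (n%:R * delta x).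
have cphi n : continuous (phi n).
  move=> x; apply: (@continuous_min _ _ (cst 1) (fun x => n%:R * delta x)).
    exact: cvg_cst.
  by apply: cvgMr; exact: (set_dist_continuous Ua0).
have phi01 n y : 0 <= phi n y <= 1.
  by rewrite le_min ler01 mulr_ge0//= ge_min lexx.
have mphi n : measurable_fun setT (EFin \o phi n).
  by apply/measurable_EFinP; exact: continuous_borel_measurable.
apply: (@emeasurable_fun_cvg _ _ _ setT
  (fun n (z : R * E) => fine_integral (phi n) z.1 z.2)) => [n|[t x] _ /=].
  exact: measurable_phi.
have -> : p t x U = (\int[p t x]_y (\1_U y)%:E)%E by rewrite integral_indic// setIT.
have [] // := @dominated_convergence _ _ _ (p t x) setT measurableT
  (fun n => EFin \o phi n) (EFin \o (\1_U : E -> R)) (cst 1%E).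
- by apply/measurable_EFinP; exact: measurable_indic.
- apply: aeW => y _ /=; apply: cvg_EFin; first exact: nearW.
  apply: (@cvg_near_eq _ R _ _ (cst (\1_U y : R)) (phi^~ y) (\1_U y : R)); last exact: cvg_cst.
  rewrite indicE; have [Uy|Uy] := pselect (U y).
    have dy : 0 < delta y by apply: (set_dist_gt0 Ua0 cUC); exact.
    near=> n; rewrite mem_set//= /phi min_l// -ler_pdivrMr// mul1r.
    by near: n; exact: nbhs_infty_ger.
  apply: nearW => n; rewrite memNset//= /phi /delta (set_dist0 Ua0)//.
  by rewrite mulr0 min_r// ler01.
- apply/integrableP; split => //.
  by rewrite (integral_cst (p t x) measurableT `|1|%E) abse1 mul1e; apply: (le_lt_trans (p_le1 t x)); rewrite ltry.
- apply: aeW => y n _ /=; rewrite lee_fin ger0_norm; first by have /andP[] := phi01 n y.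
  by have /andP[] := phi01 n y.
Unshelve. all: by end_near. Qed.

Lemma measurable_right_continuous_kernel B : measurable B ->
  measurable_fun setT (fun z : R * E => p z.1 z.2 B).
Proof.
have p_fin t x A : measurable A -> (p t x A < +oo)%E.
  move=> mA; apply: (@le_lt_trans _ _ (p t x setT)).
    by apply: le_measure; rewrite ?inE.
  by apply: (le_lt_trans (p_le1 t x)); rewrite ltry.
rewrite measurable_borelE; move: B; apply: (@dynkin_induction _ _ (@open E)
  (fun B => measurable_fun setT (fun z : R * E => p z.1 z.2 B))).
- exact: measurable_borelE.
- by move=> U V; exact: openI.
- exact: measurable_open_mass openT.
- exact: measurable_open_mass.
- move=> S mS IH.
  have -> : (fun z : R * E => p z.1 z.2 (~` S)) =
      (fun z => p z.1 z.2 setT - p z.1 z.2 S)%E.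
    apply/funext => z; rewrite -setTD measureD ?setTI//.
    exact: p_fin.
  by apply: emeasurable_funB => //; exact: measurable_open_mass openT.
- move=> F mF tF IH.
  have -> : (fun z : R * E => p z.1 z.2 (\bigcup_k F k)) =
      (fun z => \sum_(k <oo) p z.1 z.2 (F k))%E.
    apply/funext => z; rewrite measure_semi_bigcup//.
    exact: bigcupT_measurable.
  exact: ge0_emeasurable_sum.
Qed.

End right_continuous_kernel.

Section hunt_semigroup.
Context d (R : realType) (E : borelMetricType d R) dO (Omega : measurableType dO).
Variables (P : one_point_compactification E -> probability Omega R)
  (X : R -> Omega -> one_point_compactification E).
Variable F : R -> set_system Omega.
Hypothesis hF : hunt_axioms P X F.
Hypothesis mset1 : forall x : E, measurable [set x].

Let max0 (t : R) : 0 <= Num.max t 0. Proof. by rewrite le_max lexx orbT. Qed.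

(* Negative times are read as 0, which makes the kernel measurable on the whole
   line. *)
Definition hits (t : R) (B : set E) : set Omega := X (Num.max t 0) @^-1` (Some @` B).

Lemma measurable_hits t B : measurable B -> measurable (hits t B).
Proof. by move=> mB; exact: (hunt_sub hF (max0 t) (hunt_adapted hF (max0 t) mB)). Qed.

Local Notation alive t := (hits t setT).

(* Junk once the process is at the cemetery; [transition] only uses the
   restriction to [alive t]. *)
Definition position (t : R) (w : Omega) : E :=
  if X (Num.max t 0) w is Some y then y else point.

Lemma hitsP t B w : hits t B w <-> alive t w /\ B (position t w).
Proof.
rewrite /hits /position /=; split.
  by move=> [y By <-]; split => //; exists y.
by move=> [[y _ <-] By]; exists y.
Qed.

Lemma measurable_position t : measurable_fun setT (position t).
Proof.
move=> _ B mB; rewrite setTI.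
have -> : position t @^-1` B = hits t B `|` (~` alive t `&` [set _ | B point]).
  apply/seteqP; split => w /=.
    move=> Bw; have [aw|naw] := pselect (alive t w); first by left; apply/hitsP.
    right; split => //; move: Bw; rewrite /position.
    case Xw : (X _ w) => [y|] // _; exfalso; apply: naw.
    by rewrite /hits /= Xw; exists y.
  move=> [/hitsP[]//|[naw]]; rewrite /position; case Xw : (X _ w) => [y|] //.
  by exfalso; apply: naw; rewrite /hits /= Xw; exists y.
apply: measurableU; first exact: measurable_hits.
apply: measurableI; first by apply: measurableC; exact: measurable_hits.
by have [Bp|nBp] := pselect (B point);
  [rewrite (_ : [set _ | _] = setT)|rewrite (_ : [set _ | _] = set0)] => //;
  apply/seteqP; split.
Qed.

(** The law of the position under P_x on the paths still alive; the mass may be less than 1. *)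
Definition transition (t : R) (x : E) : {measure set E -> \bar R} :=
  mpushforward (mrestr (P (Some x)) (measurable_hits t measurableT))
    (measurable_position t).

Lemma transitionE t x B : transition t x B = P (Some x) (hits t B).
Proof.
rewrite /transition /= /mpushforward /pushforward /mrestr; congr (P (Some x) _).
by apply/seteqP; split => w; rewrite hitsP/=; tauto.
Qed.

Lemma measurable_path t (g : E -> \bar R) : 0 <= t -> measurable_fun setT g ->
  measurable_fun setT (fun w => if X t w is Some y then g y else 0%E).
Proof.
move=> t0 mg; have tE : Num.max t 0 = t by rewrite max_l.
rewrite (_ : (fun _ => _) = (g \o position t) \_ (alive t)).
  apply/(measurable_restrictT _ (measurable_hits t measurableT)).
  by apply: measurable_funTS; apply: measurableT_comp => //; exact: measurable_position.
apply/funext => w; rewrite patchE; case: ifPn => [/set_mem|/negP aw].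
  by rewrite /hits /position /= tE => -[y _ <-].
case Xw : (X t w) => [y|] //; exfalso; apply: aw; rewrite inE /hits /= tE Xw.
by exists y.
Qed.

Lemma Pt_transition t x (g : E -> \bar R) : 0 <= t -> (forall y, 0 <= g y)%E ->
  measurable_fun setT g -> Pt P X t g x = (\int[transition t x]_y g y)%E.
Proof.
move=> t0 g0 mg; rewrite /transition.
have mgp := measurableT_comp mg (measurable_position t).
rewrite [RHS]ge0_integral_pushforward//; last exact: measurable_position.
rewrite [RHS](ge0_integral_mrestr _ _ (fun w => g0 (position t w)) mgp).
rewrite [RHS]integral_mkcond; apply: eq_integral => w _.
have tE : Num.max t 0 = t by rewrite max_l.
rewrite patchE; case: ifPn => [/set_mem|/negP aw].
  rewrite /hits /position /= tE => -[y _ <-] //.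
case Xw : (X t w) => [y|] //; exfalso; apply: aw; rewrite inE /hits /= tE Xw.
by exists y.
Qed.

Lemma PtR_transition t x (u : E -> R) : 0 <= t -> measurable_fun setT u ->
  PtR P X t u x = Pr transition t u x.
Proof.
move=> t0 mu; have meu : measurable_fun setT (EFin \o u) by exact/measurable_EFinP.
rewrite /PtR /Pr /Pe; congr fine; rewrite /Pt [LHS]integralE [RHS]integralE; congr (_ - _)%E.
- rewrite -(Pt_transition x t0 (fun y => funepos_ge0 _ y) (measurable_funepos meu)).
  apply: eq_integral => w _; rewrite funeposE; case: (X t w) => [y|]; rewrite ?funeposE//.
  by rewrite maxxx.
- rewrite -(Pt_transition x t0 (fun y => funeneg_ge0 _ y) (measurable_funeneg meu)).
  apply: eq_integral => w _; rewrite funenegE; case: (X t w) => [y|]; rewrite ?funenegE//.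
  by rewrite oppe0 maxxx.
Qed.

Lemma transition_le1 t x : (transition t x setT <= 1)%E.
Proof. by rewrite transitionE; exact: probability_le1 (measurable_hits t measurableT). Qed.

Lemma measurable_transition t B : measurable B ->
  measurable_fun setT (transition t ^~ B).
Proof.
move=> mB; apply: eq_measurable_fun (hunt_transition hF (max0 t) mB) => x _.
by rewrite transitionE.
Qed.

Lemma transition_max t x : transition t x = transition (Num.max t 0) x.
Proof.
apply: eq_measure; apply/funext => B; rewrite !transitionE /hits.
by rewrite (max_l (max0 t)).
Qed.

Let eval (phi : E -> R) t w : R := if X t w is Some y then phi y else 0.

Let eval_right_cvg (phi : E -> R) t (s : R^nat) w : continuous phi -> 0 <= t ->
  (forall n, t < s n) -> s n @[n --> \oo] --> t ->
  eval phi (s n) w @[n --> \oo] --> eval phi t w.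
Proof.
move=> cphi t0 ts st.
have st' : s n @[n --> \oo] --> t^'+.
  move=> A At; suff : \forall n \near \oo, A (s n) by [].
  have : \forall n \near \oo, (t < s n -> A (s n)) := st _ At.
  by apply: filterS => n; apply; exact: ts.
have Xcvg : X (s n) w @[n --> \oo] --> X t w.
  apply: (@cvg_comp _ _ _ s (fun r => X r w) _ _ _ st').
  exact: (hunt_right_continuous hF).
rewrite /eval; case Xw : (X t w) Xcvg => [y|] Xcvg.
  apply/cvgrPdist_lt => e e0.
  have ye : nbhs y [set z | `|phi y - phi z| < e].
    by have /cvgrPdist_lt := cphi y; apply.
  have : \forall n \near \oo, (Some @` [set z | `|phi y - phi z| < e]) (X (s n) w).
    exact: (Xcvg _ (@one_point_compactification_some_nbhs _ y _ ye)).
  by apply: filterS => n /= [z yz <-].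
(* [phi], extended by 0, may be discontinuous at the cemetery; but a path that is there at time t
   remains there. *)
apply: (@cvg_near_eq _ R _ _ (cst 0)); last exact: cvg_cst.
by apply: nearW => n; rewrite (hunt_absorbing hF t0 (ltW (ts n)) Xw).
Qed.

Lemma transition_right_cvg (phi : E -> R) x t (s : R^nat) : continuous phi ->
  (forall y, 0 <= phi y <= 1) -> 0 <= t -> (forall n, t < s n) ->
  s n @[n --> \oo] --> t ->
  (\int[transition (s n) x]_y (phi y)%:E @[n --> \oo] -->
    \int[transition t x]_y (phi y)%:E)%E.
Proof.
move=> cphi phi01 t0 ts st; have s0 n : 0 <= s n by rewrite (le_trans t0)// ltW.
have mphi := continuous_borel_measurable cphi.
have memphi : measurable_fun setT (EFin \o phi) by exact/measurable_EFinP.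
have phi0 y : (0 <= (phi y)%:E)%E by rewrite lee_fin; have /andP[] := phi01 y.
have E1 r : 0 <= r -> (\int[transition r x]_y (phi y)%:E =
    \int[P (Some x)]_w (eval phi r w)%:E)%E.
  move=> r0; rewrite -(Pt_transition x r0 phi0 memphi).
  by apply: eq_integral => w _; rewrite /eval; case: (X r w).
have meval r : 0 <= r -> measurable_fun setT (EFin \o eval phi r).
  move=> r0; apply: eq_measurable_fun (measurable_path r0 memphi) => w _.
  by rewrite /= /eval; case: (X r w).
rewrite E1//; under eq_fun do rewrite E1//.
have [] // := @dominated_convergence _ _ _ (P (Some x)) setT measurableT
  (fun n => EFin \o eval phi (s n)) (EFin \o eval phi t) (cst 1%E).
- by move=> n; exact: meval.
- exact: meval.
- by apply: aeW => w _ /=; apply: cvg_EFin; [exact: nearW|exact: eval_right_cvg].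
- by apply: finite_measure_integrable_cst.
- apply: aeW => w n _ /=; rewrite lee_fin /eval; case: (X (s n) w) => [y|].
    by have /andP[h0 h1] := phi01 y; rewrite ger0_norm.
  by rewrite normr0.
Qed.

Lemma measurable_transition_joint B : measurable B ->
  measurable_fun setT (fun z : R * E => transition z.1 z.2 B).
Proof.
apply: measurable_right_continuous_kernel.
- exact: measurable_transition.
- exact: transition_le1.
- exact: transition_max.
- exact: transition_right_cvg.
Qed.

Let cemetery_hits s B : 0 <= s -> measurable B ->
  P None (X s @^-1` (Some @` B)) = 0%E.
Proof.
move=> s0 mB; have mT := hunt_sub hF s0 (hunt_adapted hF s0 measurableT).
have mBs := hunt_sub hF s0 (hunt_adapted hF s0 mB).
have C1 : ~` (X s @^-1` [set None]) = X s @^-1` (Some @` setT).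
  apply/seteqP; split => w /=; case: (X s w) => [y|] //.
    by move=> _; exists y.
  by move=> [].
have T0 : P None (X s @^-1` (Some @` setT)) = 0%E.
  rewrite -C1 probability_setC; first by rewrite (hunt_cemetery hF s0) subee.
  by rewrite -[X in measurable X]setCK C1; exact: measurableC.
apply/eqP; rewrite eq_le measure_ge0 andbT -T0; apply: le_measure; rewrite ?inE//.
by move=> w /= [y _ <-]; exists y.
Qed.

Lemma transition_add (s t : R) x B : 0 <= s -> 0 <= t -> measurable B ->
  transition (t + s) x B = (\int[transition t x]_y transition s y B)%E.
Proof.
move=> s0 t0 mB; have st0 : 0 <= t + s by rewrite addr_ge0.
have F0 r : 0 <= r -> F r set0 /\ F r setT.
  move=> /(hunt_sigma_algebra hF)[F00 FC _]; split => //.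
  by rewrite -(setD0 setT); exact: FC.
(* Chapman-Kolmogorov is the strong Markov property at this constant time, on the whole of
   [Omega]. *)
have stT : stopping_time F (cst t%:E).
  split; first by move=> w; rewrite lee_fin.
  move=> r r0; have [FT0 FTT] := F0 r r0; have [tr|tr] := leP t r.
    by rewrite (_ : [set _ | _] = setT)//; apply/seteqP; split => // w _ /=; rewrite lee_fin.
  rewrite (_ : [set _ | _] = set0)//; apply/seteqP; split => // w /=.
  by rewrite lee_fin leNgt tr.
have stA : stopped_algebra F (cst t%:E) setT.
  by split => // r r0; rewrite setTI; exact: stT.2.
have SM := hunt_strong_markov hF (Some x) stT s0 mB stA.
rewrite setTI in SM.
have hitsE : hits (t + s) B = [set w | (Some @` B) (Xbar X (cst t%:E w + s%:E)%E w)].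
  by rewrite /hits max_l.
rewrite transitionE hitsE SM.
rewrite -(Pt_transition x t0); last 2 first.
- by move=> y.
- exact: measurable_transition.
apply: eq_integral => w _ /=; case: (X t w) => [y|]; last exact: cemetery_hits.
by rewrite -[RHS]/(transition s y B) transitionE /hits max_l.
Qed.

Lemma transition0 x B : measurable B -> transition 0 x B = \d_x B.
Proof.
move=> mB; rewrite transitionE /hits max_l// diracE.
have X0 := hunt_normal hF (Some x).
have m0 := hunt_adapted hF (lexx 0) (mset1 x).
have {}m0 := hunt_sub hF (lexx 0) m0.
have mB0 := hunt_sub hF (lexx 0) (hunt_adapted hF (lexx 0) mB).
have E0 : X 0 @^-1` (Some @` [set x]) = X 0 @^-1` [set Some x].
  by apply/seteqP; split => w /=; [move=> [_ -> <-]|move=> ->; exists x].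
rewrite E0 in m0.
have [xB|xB] := pselect (B x).
  rewrite mem_set//=; apply/eqP; rewrite eq_le probability_le1//= -X0.
  by apply: le_measure; rewrite ?inE// => w /= ->; exists x.
have C0 : P (Some x) (~` (X 0 @^-1` [set Some x])) = 0%E.
  by rewrite probability_setC// X0 subee.
have z0 : P (Some x) (X 0 @^-1` (Some @` B)) = 0%E.
  apply/eqP; rewrite eq_le measure_ge0 andbT -C0.
  apply: le_measure; rewrite ?inE//; first exact: measurableC.
  by move=> w /= [y By <-] [xy]; apply: xB; rewrite -xy.
by rewrite z0 memNset.
Qed.

Variable m : {measure set E -> \bar R}.
Hypotheses (X_sym : symmetric_process P X m) (X_cons : conservative P X m).

Lemma hunt_markov_semigroup : markov_semigroup m transition.
Proof.
split.
- exact: transition_le1.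
- exact: measurable_transition_joint.
- exact: transition_add.
- exact: transition0.
- move=> t f g t0 mf mg f0 g0.
  transitivity (\int[m]_x (Pt P X t f x * g x))%E.
    by apply: eq_integral => x _; rewrite (Pt_transition _ (ltW t0) f0 mf).
  rewrite (X_sym t0 mf mg f0 g0); apply: eq_integral => x _.
  by rewrite (Pt_transition _ (ltW t0) g0 mg).
- move=> t t0; apply: filterS (X_cons t0) => x <-.
  rewrite (Pt_transition x (ltW t0) (fun=> lee01))//.
  by rewrite (integral_cst (transition t x) measurableT 1) mul1e.
Qed.

End hunt_semigroup.

(** * Locally compact separable metric spaces *)

Section separable_locally_compact.
Context d (R : realType) (E : borelMetricType d R).

Lemma measurable_borel_set1 (x : E) : measurable [set x].
Proof.
rewrite -[X in measurable X]setCK; apply: measurableC; apply: open_borel_measurable.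
apply: closed_openC; apply: accessible_closed_set1; apply: hausdorff_accessible.
exact: metric_hausdorff.
Qed.

Let disc (a : E) (n : nat) : set E := [set y | mdist a y <= n.+1%:R^-1].

Let mdist_continuous (a : E) : continuous (mdist a).
Proof.
move=> x; apply/cvgrPdist_lt => e e0.
have : \forall y \near x, mdist x y < e.
  by apply/metricType_numDomainType.nbhs_mdistP; exists e.
apply: filterS => y xy; rewrite ltr_distl.
have := metric_triangle a x y; have := metric_triangle a y x.
by rewrite (metric_sym y x); move: xy; lra.
Qed.

Let closed_disc a n : closed (disc a n).
Proof.
apply: (@closed_comp _ _ (mdist a) [set r : R | r <= n.+1%:R^-1]).
  by move=> x _; exact: mdist_continuous.
exact: closed_le.
Qed.

Let measurable_disc a n : measurable (disc a n).
Proof.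
rewrite -[X in measurable X]setCK; apply: measurableC; apply: open_borel_measurable.
exact: closed_openC.
Qed.

Hypothesis E_locally_compact : locally_compact [set: E].

(** A closed disc through x of radius less than e / 2 lies in the ball of radius e about x, which is
    chosen inside a compact neighbourhood. *)
Let compact_disc_near (x : E) : exists2 e : R, 0 < e &
  forall a n, n.+1%:R^-1 < e -> disc a n x -> compact (disc a n).
Proof.
have [U xU [cU clU]] := @E_locally_compact x Logic.I.
have /metricType_numDomainType.nbhs_mdistP[e e0 eU] : nbhs x U.
  have : nbhs x (fun y => [set: E] y -> U y) := xU.
  by apply: filterS => y; apply.
exists (e / 2); first by rewrite divr_gt0.
move=> a n ne ax; apply: (subclosed_compact _ cU); first exact: closed_disc.
move=> y ay; apply: eU => /=; move: ax ay; rewrite /disc/= => ax ay.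
have := metric_triangle x a y; rewrite (metric_sym x a).
by move: ne ax ay; move: (n.+1%:R^-1 : R) => r; lra.
Qed.

Hypothesis E_separable : separable E.

Let dense_seq : exists a : E^nat, forall (x : E) (e : R), 0 < e ->
  exists i, mdist (a i) x < e.
Proof.
have [A cA dA] := E_separable; have [g gA] := pcard_surjP cA.
exists g => x e e0.
have [y [xy Ay]] : (ball x e)° `&` A !=set0.
  apply: dA; last exact: open_interior.
  by exists x; apply: nbhsx_ballx.
have [i _ giy] := gA y Ay; exists i; rewrite giy metric_sym.
by have := interior_subset xy; rewrite ballEmdist.
Qed.

(** Closed discs about a dense sequence, the non-compact ones being replaced by the empty set.
    Arbitrarily small members at each point are what separates distinct points in
    [offdiag_cover]. *)
Lemma compact_cover : exists K : (set E)^nat,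
  [/\ forall n, compact (K n), forall n, measurable (K n) &
   forall x (e : R), 0 < e -> exists n, K n x /\ forall y, K n y -> mdist x y < e].
Proof.
have [a Ha] := dense_seq.
pose code (k : nat) : nat * nat := odflt (0, 0)%N (unpickle k).
pose K k := let: (i, n) := code k in
  if `[< compact (disc (a i) n) >] then disc (a i) n else set0.
exists K; split => [k|k|x e e0].
- by rewrite /K; case: (code k) => i n; case: asboolP => // _; exact: compact0.
- by rewrite /K; case: (code k) => i n; case: asboolP => _; [exact: measurable_disc|].
have [e' e'0 He'] := compact_disc_near x.
have [n ne] : exists n, n.+1%:R^-1 < Num.min e' (e / 2).
  have m0 : 0 < Num.min e' (e / 2) by rewrite lt_min e'0 divr_gt0.
  have [n _ Hn] := near_infty_natSinv_lt (PosNum m0).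
  by exists n; exact: (Hn n (leqnn n)).
move: ne; rewrite lt_min => /andP[ne' ne].
have n0 : 0 < n.+1%:R^-1 :> R by rewrite invr_gt0.
have [i ix] := Ha x _ n0.
have dx : disc (a i) n x by rewrite /disc/= ltW.
have cd : compact (disc (a i) n) := He' _ _ ne' dx.
exists (pickle (i, n)); rewrite /K /code pickleK/=.
case: asboolP => // _; split => // y; rewrite /disc/= => iy.
have := metric_triangle x (a i) y; rewrite (metric_sym x (a i)).
by move: ne ix iy; move: (n.+1%:R^-1 : R) => r; lra.
Qed.

Lemma radon_sigma_finite (m : {measure set E -> \bar R}) :
  radon_on [set: E] measurable m -> sigma_finite setT m.
Proof.
move=> [mK _]; have [K [cK mK' HK]] := compact_cover; exists K.
  apply/seteqP; split => // x _; have [n [Kx _]] := HK x 1 ltr01.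
  by exists n.
by move=> n; split => //; exact: mK.
Qed.

(** Products of disjoint compact sets are compact subsets of [offdiag], hence of finite [J]-measure.
    Two distinct points lie in disjoint members of [compact_cover] whose radii about them are half
    their distance. *)
Lemma offdiag_cover (J : {measure set (E * E) -> \bar R}) :
  radon_on (@offdiag d R E) measurable J ->
  exists C : (set (E * E))^nat, [/\ forall n, measurable (C n),
    \bigcup_n C n = offdiag & forall n, (J (C n) < +oo)%E].
Proof.
move=> [JK _]; have [K [cK mK HK]] := compact_cover.
pose code (k : nat) : nat * nat := odflt (0, 0)%N (unpickle k).
pose C k := let: (i, j) := code k in
  if `[< K i `&` K j = set0 >] then K i `*` K j else set0.
have Coff k : C k `<=` offdiag.
  rewrite /C; case: (code k) => i j; case: asboolP => [ij0|_]; last exact: sub0set.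
  move=> [x y] [/= Kx Ky] xy.
  rewrite -[False]/(set0 x) -ij0; split; first exact: Kx.
  by rewrite [x]xy.
exists C; split.
- move=> k; rewrite /C; case: (code k) => i j; case: asboolP => // _.
  exact: measurableX.
- apply/seteqP; split => [z [k _]|]; first exact: Coff.
  move=> [x y] /= /eqP xy; have xy0 : 0 < mdist x y / 2 by rewrite divr_gt0// mdist_gt0.
  have [i [Kx Hx]] := HK x _ xy0; have [j [Ky Hy]] := HK y _ xy0.
  exists (pickle (i, j)) => //; rewrite /C /code pickleK/=.
  case: asboolP => //; case; rewrite -subset0 => w [/Hx xw /Hy yw].
  have := metric_triangle x w y; rewrite (metric_sym w y).
  by move: xw yw; lra.
- move=> k; apply: JK => //; rewrite /C; case: (code k) => i j; case: asboolP => _.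
    exact: compact_setX.
  exact: compact0.
Qed.

End separable_locally_compact.

Lemma le_poweR (R : realType) (r : R) (x y : \bar R) : 0 <= r -> (0 <= x)%E ->
  (x <= y)%E -> (x `^ r <= y `^ r)%E.
Proof.
move=> r0 x0 xy; apply: (gt0_ler_poweR r0) => //; rewrite in_itv/= leey andbT//.
exact: le_trans xy.
Qed.

(** * From the semigroup estimate to the square function of the process *)

Section square_function_bound.
Local Arguments transition : simpl never.
Context d (R : realType) (E : borelMetricType d R) dO (Omega : measurableType dO).
Variables (P : one_point_compactification E -> probability Omega R)
  (X : R -> Omega -> one_point_compactification E).
Variable F : R -> set_system Omega.
Hypothesis hF : hunt_axioms P X F.
Variable m : {measure set E -> \bar R}.
Hypothesis sf : sigma_finite setT m.
Hypotheses (X_sym : symmetric_process P X m) (X_cons : conservative P X m).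
Local Notation p := (transition hF).

Let H : markov_semigroup m p.
Proof. by apply: hunt_markov_semigroup => // x; exact: measurable_borel_set1. Qed.

(** [f] will be Gamma[P_t f], perhaps not measurable, so that its [Pt] is a lower integral on path
    space; paths in [Z] at time t form a null set. *)
Lemma Pt_le t x (f g : E -> \bar R) (Z : set E) : 0 <= t -> measurable Z ->
  p t x Z = 0%E -> (forall y, 0 <= f y)%E -> (forall y, 0 <= g y)%E ->
  measurable_fun setT g -> (forall y, ~ Z y -> f y <= g y)%E ->
  (Pt P X t f x <= Pe p t g x)%E.
Proof.
move=> t0 mZ pZ f0 g0 mg fg.
have tE : Num.max t 0 = t by rewrite max_l.
have mu := measurable_path hF t0 mg.
rewrite /Pe -(Pt_transition hF x t0 g0 mg).
apply: (@le_lower_integral _ _ _ _ (hits X t Z)) => //.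
- exact: (measurable_hits hF).
- by move: pZ; rewrite (transitionE hF).
- by move=> w; case: (X t w).
- by move=> w; case: (X t w).
- move=> w; rewrite /hits/= tE; case: (X t w) => [y|] //= Zy.
  by apply: fg => Zy'; apply: Zy; exists y.
Qed.

Variables (D : set (E -> R)) (a : (E -> R) -> (E -> R) -> R).
Hypotheses (aD : dirichlet_form m D a) (aR : regular_form m D a).
Variables (J : {measure set (E * E) -> \bar R}) (N : R.-ker E ~> E).
Hypothesis aJ : pure_jump m D a J N.
Variable C : (set (E * E))^nat.
Hypotheses (mC : forall n, measurable (C n)) (C_off : \bigcup_n C n = offdiag).
Hypothesis JC : forall n, (J (C n) < +oo)%E.
Hypothesis X_form : associated_form P X m D a.
Local Notation Z := (infinite_mass N C).
Local Notation pos := (`]0%R, +oo[%classic : set (measurableTypeR R)).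

Let approx_formE u v : measurable_fun setT u ->
  \forall h \near (0 : R)^'+, approx_form P X m h u v = approx m p h u v.
Proof.
move=> mu; near=> h; have h0 : 0 <= h by [].
rewrite /approx_form /approx; congr (_ * inner m _ v); apply/funext => x.
by rewrite /= (PtR_transition hF).
Unshelve. all: by end_near. Qed.

Let D_cvg u : bL2 m u -> (D u <-> cvg (approx m p h u u @[h --> (0 : R)^'+])).
Proof.
move=> [[mu _] u2]; apply: (iff_trans (X_form.1 u u2)).
by split => /cvg_ex[l cl]; apply/cvg_ex; exists l; apply: cvg_near_eq cl;
  apply: filterS (approx_formE u mu) => h ->.
Qed.

Let a_lim u v : D u -> D v -> approx m p h u v @[h --> (0 : R)^'+] --> a u v.
Proof.
move=> Du Dv; apply: cvg_near_eq (X_form.2 u v Du Dv).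
exact: (approx_formE v (Lfun2_measurable (df_L2 aD Du))).
Qed.

Let mZ : measurable Z. Proof. exact: (measurable_infinite_mass aJ mC C_off). Qed.

(** By invariance of [m] the integral of p_t(x, Z) dm is m(Z) = 0 for each t > 0; Tonelli's theorem
    exchanges the quantifiers. *)
Let Z_null : {ae m, forall x, {ae lebesgue_measure, forall t : measurableTypeR R,
  pos t -> p t x Z = 0%E}}.
Proof.
have mpos : measurable pos by exact: measurable_itv.
have m1 : measurable_fun setT (fun y : E => (\1_Z y : R)%:E).
  by apply/measurable_EFinP; exact: measurable_indic.
have i0 y : (0 <= (\1_Z y : R)%:E)%E by rewrite lee_fin.
have pE t x : p t x Z = Pe p t (fun y => (\1_Z y)%:E) x.
  by rewrite /Pe integral_indic// setIT.
have mpZ := measurable_transition_joint hF mZ.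
have int0 : (\int[m]_x \int[lebesgue_measure]_(t in pos) p t x Z = 0)%E.
  rewrite -(@sigma_finite_tonelli _ _ _ m sf pos (fun z => p z.1 z.2 Z) mpos)//.
  rewrite integral0_eq// => t; rewrite /= in_itv/= andbT => t0.
  transitivity (\int[m]_x Pe p t (fun y => (\1_Z y)%:E) x)%E.
    by apply: eq_integral => x _; exact: pE.
  rewrite (integral_Pe H t0 i0 m1) integral_indic// setIT.
  exact: (infinite_mass_null aJ mC C_off JC).
have mI := @measurable_fun_integral_lebesgue _ _ _ pos (fun z => p z.1 z.2 Z) mpos
  (fun z => measure_ge0 _ _) mpZ.
have : ae_eq m setT (fun x => \int[lebesgue_measure]_(t in pos) p t x Z)%E (cst 0%E).
  apply/(ae_eq_integral_abs m measurableT mI); rewrite -[RHS]int0.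
  by apply: eq_integral => x _; rewrite gee0_abs// integral_ge0.
apply: filterS => x /(_ Logic.I) /= ix.
have mt : measurable_fun pos (fun t => p t x Z).
  by apply: measurable_funTS; exact: (measurable_fun_pair1 x mpZ).
apply/(ae_eq_integral_abs lebesgue_measure mpos mt); rewrite -[RHS]ix.
by apply: eq_integral => t _; rewrite gee0_abs.
Qed.

Variables (f : E -> R).
Hypothesis mf : measurable_fun setT f.

Lemma square_function_le_energy : {ae m, forall x,
  (square_function P X N f x <= square_energy N C p f x `^ 2^-1)%E}.
Proof.
apply: filterS Z_null => x [A [mA A0 nA]].
have G0 u t y : (0 <= flow_gamma N C p u t y)%E by exact: flow_gamma_ge0.
have mG := measurable_flow_gamma aJ mC C_off H mf.
have mPG : measurable_fun setT
    (fun z : R * E => Pe p z.1 (flow_gamma N C p f z.1) z.2).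
  exact: (measurable_Pe_joint H (tau := id) (f := fun z => flow_gamma N C p f z.1 z.2)).
have Pt0 t u y : (forall y, 0 <= u y)%E -> (0 <= Pt P X t u y)%E.
  by move=> u0; apply: integral_ge0 => w _; case: (X t w).
apply: le_poweR; first by rewrite invr_ge0.
  by apply: integral_ge0 => t _; apply: Pt0 => y; exact: carre_ge0.
rewrite /square_energy integral_mkcond [leRHS]integral_mkcond.
have mpos : measurable pos by exact: measurable_itv.
(* The time 0 is excluded as well: [square_function] integrates over [0, +oo[ and [square_energy]
   over ]0, +oo[. *)
apply: (@le_lower_integral _ _ _ lebesgue_measure (A `|` [set 0])).
- by apply: measurableU => //; exact: measurable_set1.
- by apply: null_set_setU => //; exact: lebesgue_measure_set1.
- by move=> t; apply: erestrict_ge0 => s _; apply: Pt0 => y; exact: carre_ge0.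
- by move=> t; apply: erestrict_ge0 => s _; exact: Pe_ge0.
- apply/(measurable_restrictT _ mpos); apply: measurable_funTS.
  exact: (measurable_fun_pair1 x mPG).
move=> t nAt; have {nAt} [At t_neq0] : ~ A t /\ t != 0.
  by split; [move=> At; apply: nAt; left|apply/eqP => tE; apply: nAt; right].
rewrite !patchE; case: ifPn => [|tN].
  rewrite inE/= in_itv/= andbT le_eqVlt eq_sym (negbTE t_neq0)/= => t0.
  rewrite ifT; last by rewrite inE/= in_itv/= t0.
  have pZ : p t x Z = 0%E.
    by apply: contrapT => h; apply: At; apply: nA => /= /(_ _)/h; apply; rewrite in_itv/= t0.
  apply: (Pt_le (ltW t0) mZ pZ) => //.
  - by move=> y; exact: carre_ge0.
  - exact: (measurable_fun_pair2 t mG).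
  - move=> y Zy; rewrite /flow_gamma patchE ifT ?inE//.
    rewrite le_eqVlt; apply/orP; left; apply/eqP; congr carre_du_champ.
    by apply/funext => z; rewrite (PtR_transition hF _ (ltW t0) mf).
rewrite ifF//; apply/negP; rewrite inE/= in_itv/= andbT => t0.
by move/negP : tN; apply; rewrite inE/= in_itv/= andbT ltW.
Qed.

Variables (q c0 K : R).
Hypotheses (q1 : 1 <= q) (c00 : 0 < c0) (K0 : 0 < K).
Hypothesis HBq : bellman_family q c0 K.

Lemma square_function_bound : f \in Lfun m (2 * q)%:E ->
  ('N[m]_(2 * q)%:E [square_function P X N f] <=
    ((K / c0) `^ (2 * q)^-1)%:E * 'N[m]_(2 * q)%:E [EFin \o f])%E.
Proof.
move=> fL; have q0 : 0 < q by exact: lt_le_trans q1.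
have fqE x : ((f x ^+ 2) `^ q)%:E = (`|(EFin \o f) x| `^ (2 * q))%E.
  rewrite /=; congr EFin.
  by rewrite powRrM powR_mulrn// real_normK ?num_real.
have ffin : (\int[m]_x ((f x ^+ 2) `^ q)%:E < +oo)%E.
  under eq_integral do rewrite fqE.
  move: fL; rewrite inE/= => /andP[_ /[!inE]/=]; rewrite /finite_norm unlock.
  by apply: lty_poweRy; rewrite invr_neq0// mulf_neq0// gt_eqF.
have mset1 := @measurable_borel_set1 _ R E.
have main := integral_square_energy_le sf aD aR aJ mset1 mC C_off H D_cvg a_lim
  mf q1 c00 K0 HBq ffin.
have W0 x := square_energy_ge0 N C p f x.
have mW := measurable_square_energy aJ mC C_off H mf.
have [A [mA A0 nA]] := square_function_le_energy.
have S0 x : (0 <= square_function P X N f x)%E by exact: poweR_ge0.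
have KC0 : 0 <= K / c0 by rewrite divr_ge0// ltW.
rewrite unlock -poweR_EFin -poweRM ?lee_fin//; last first.
  by apply: integral_ge0 => x _; exact: poweR_ge0.
apply: le_poweR.
- by rewrite invr_ge0 mulr_ge0// ltW.
- by apply: integral_ge0 => x _; exact: poweR_ge0.
under [X in (_ <= _ * X)%E]eq_integral do rewrite -fqE.
apply: le_trans main.
apply: (@le_lower_integral _ _ _ m A) => //.
- by move=> x; exact: poweR_ge0.
- by move=> x; exact: poweR_ge0.
- exact: (measurableT_comp (measurable_poweR q) mW).
move=> x Ax; have SW : (square_function P X N f x <= square_energy N C p f x `^ 2^-1)%E.
  by apply: contrapT => h; apply: Ax; exact: nA.
rewrite gee0_abs//.
have -> : (square_energy N C p f x `^ q = (square_energy N C p f x `^ 2^-1) `^ (2 * q))%E.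
  by rewrite -poweRrM mulrA mulVf ?mul1r.
by apply: le_poweR => //; rewrite mulr_ge0// ltW.
Qed.

End square_function_bound.

Theorem theorem4p6 (R : realType) (p : R) (hp : 2 <= p) :
  exists2 C : R, 0 < C &
  forall (d : measure_display) (E : borelMetricType d R)
    (E_locally_compact : locally_compact [set: E]) (E_separable : separable E)
    (m : {measure set E -> \bar R}) (m_radon : radon_on [set: E] measurable m)
    (m_supp : full_support m)
    (D : set (E -> R)) (a : (E -> R) -> (E -> R) -> R)
    (a_dirichlet : dirichlet_form m D a) (a_regular : regular_form m D a)
    (J : {measure set (E * E) -> \bar R}) (N : R.-ker E ~> E)
    (a_jump : pure_jump m D a J N)
    (dO : measure_display) (Omega : measurableType dO)
    (P : one_point_compactification E -> probability Omega R)
    (X : R -> Omega -> one_point_compactification E)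
    (X_hunt : hunt_process P X) (X_sym : symmetric_process P X m)
    (X_form : associated_form P X m D a)
    (X_conservative : conservative P X m)
    (f : E -> R) (f_Lp : f \in Lfun m p%:E),
    ('N[m]_p%:E [square_function P X N f] <= C%:E * 'N[m]_p%:E [EFin \o f])%E.
Proof.
(* The range 2 <= p enters here: the Bellman function is available for exponents q >= 1. *)
have q1 : 1 <= p / 2 by rewrite ler_pdivlMr// mul1r.
have [c0 [K [c00 K0 HB]]] := bellman_exists q1.
(* With the witnesses in [bellman_exists], this is (q - 1)^((q - 1) / p) for q = p / 2 > 1, and 1
   for p = 2. *)
exists ((K / c0) `^ p^-1); first by rewrite powR_gt0// divr_gt0.
move=> d E E_locally_compact E_separable m m_radon _ D a aD aR J N aJ dO Omega P X.
move=> [F hF] X_sym X_form X_cons f fL.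
have [C [mC C_off JC]] := offdiag_cover E_locally_compact E_separable (jump_radon aJ).
have sf := radon_sigma_finite E_locally_compact E_separable m_radon.
have pE : 2 * (p / 2) = p by rewrite mulrC divfK.
have mf : measurable_fun setT f by move: fL; rewrite inE => /andP[/[!inE]].
have := square_function_bound hF sf X_sym X_cons aD aR aJ mC C_off JC X_form mf
  q1 c00 K0 HB.
by rewrite pE; exact.
Qed.
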